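(* Let $A(\lambda)$, $B(\lambda)$ be the autoregressive and moving average polynomials of the context, let $F(\lambda)=A(\lambda)^{-1}B(\lambda)$ be irreducible, and let $R_1,\ldots,R_p\in\mathbb{C}^{d\times d}$ be a complete set of regular right solvents of $A(\lambda)$. Define for $k=1,\ldots,p$ the multivariate complex-valued Ornstein-Uhlenbeck processes $$Y_k(t)=e^{R_k t}Y_k(0)+\int_0^t e^{R_k(t-u)}\,\mathrm{Res}[F,R_k]\,\mathrm{d}L(u),\qquad t\ge 0,$$ with some initial condition $Y_k(0)$ in $\mathbb{C}^d$ such that $V(R_1,\ldots,R_p)\,[Y_1(0)^\top,\ldots,Y_p(0)^\top]^\top\in\mathbb{R}^{pd}$. Then $Y(t)=\sum_{k=1}^p Y_k(t)$, $t\ge 0$, is an $\mathbb{R}^d$-valued solution of the state space model $$Y(t)=C^*X(t),\qquad \mathrm{d}X(t)=A^*X(t)\,\mathrm{d}t+B^*\,\mathrm{d}L(t),$$ and hence a MCARMA$(p,q)$ process.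
   Context: Let $d,m\ge 1$ be integers and $p>q$ positive integers. $L=(L(t))_{t\ge0}$ is an $\mathbb{R}^m$-valued Lévy process: $L(0)=0_m$ a.s., stationary and independent increments, càdlàg paths. Let $$A(\lambda)=I_d\lambda^p+A_1\lambda^{p-1}+\ldots+A_p,\qquad B(\lambda)=B_0\lambda^q+\ldots+B_{q-1}\lambda+B_q,$$ with $A_1,\ldots,A_p\in\mathbb{R}^{d\times d}$, $B_0,\ldots,B_q\in\mathbb{R}^{d\times m}$. State space matrices: $A^*\in\mathbb{R}^{pd\times pd}$ is the block companion matrix whose $i$-th block row, $1\le i\le p-1$, has $I_d$ in block column $i+1$ and zero blocks elsewhere, and whose last block row is $(-A_p,-A_{p-1},\ldots,-A_1)$; $C^*=(I_d,0_{d\times d},\ldots,0_{d\times d})\in\mathbb{R}^{d\times pd}$; $B^*=(\beta_1^\top\cdots\beta_p^\top)^\top\in\mathbb{R}^{pd\times m}$ with $\beta_1=\ldots=\beta_{p-q-1}=0_{d\times m}$ and $\beta_{p-j}=-\sum_{i=1}^{p-j-1}A_i\beta_{p-j-i}+B_{q-j}$ for $j=0,\ldots,q$. An $\mathbb{R}^d$-valued process $Y$ is called a MCARMA$(p,q)$ process (a solution of the state space model) if $Y(t)=C^*X(t)$ for some $\mathbb{R}^{pd}$-valued process $X$ with $\mathrm{d}X(t)=A^*X(t)\,\mathrm{d}t+B^*\,\mathrm{d}L(t)$. Solvents: $\sigma(A(\cdot))=\{\lambda\in\mathbb{C}:\det A(\lambda)=0\}$, and $\sigma(R)$ is the set of eigenvalues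 of a matrix $R$. A matrix $R\in\mathbb{C}^{d\times d}$ is a right solvent of $A(\lambda)$ if $R^p+A_1R^{p-1}+\ldots+A_{p-1}R+A_p=0_{d\times d}$. It is regular if $\sigma(R)\cap\sigma(A^{(1)}(\cdot))=\emptyset$, where $A^{(1)}(\lambda)$ is the monic matrix polynomial of degree $p-1$ with $A(\lambda)=A^{(1)}(\lambda)(\lambda I_d-R)$. A set of right solvents $R_1,\ldots,R_p$ is complete if $\sigma(A(\cdot))=\bigcup_{k=1}^p\sigma(R_k)$. $F(\lambda)=A(\lambda)^{-1}B(\lambda)$ is irreducible if $A(\lambda)$ and $B(\lambda)$ are left coprime. For a regular right solvent $R$, the residue is $\mathrm{Res}[F,R]=\frac{1}{2\pi i}\oint_{\Gamma_R}F(\lambda)\,\mathrm{d}\lambda\in\mathbb{C}^{d\times m}$, where $\Gamma_R$ is a simple closed (positively oriented) contour with $\sigma(R)$ in its interior and $\sigma(A(\cdot))\setminus\sigma(R)$ in its exterior. For $S_1,\ldots,S_p\in\mathbb{C}^{d\times d}$, $V(S_1,\ldots,S_p)\in\mathbb{C}^{pd\times pd}$ is the block Vandermonde matrix whose $(i,k)$ block is $S_k^{i-1}$, $i,k=1,\ldots,p$. *)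

(* Defs.v *)
From HB Require Import structures.
From mathcomp Require Import all_boot all_order all_algebra complex.
From mathcomp Require Import all_classical all_reals all_analysis.

Set Implicit Arguments.
Unset Strict Implicit.
Unset Printing Implicit Defensive.

Import Order.TTheory GRing.Theory Num.Theory.
Import numFieldNormedType.Exports.

Local Open Scope classical_set_scope.
Local Open Scope ring_scope.
Local Open Scope complex_scope.

(* Families of coefficient matrices are functions on nat; only the indices that
   occur in the formulas below (1..p for A, 0..q for B) are ever used. *)

(* I_d X^p + A_1 X^(p-1) + ... + A_p *)
Definition monic_mxpoly (K : fieldType) (d p : nat) (A : nat -> 'M[K]_d) :
    'M[{poly K}]_d :=
  ('X^p)%:M + \sum_(1 <= k < p.+1) 'X^(p - k) *: map_mx polyC (A k).

(* B_0 X^q + B_1 X^(q-1) + ... + B_q *)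
Definition mxpoly_of (K : fieldType) (d m q : nat) (B : nat -> 'M[K]_(d, m)) :
    'M[{poly K}]_(d, m) :=
  \sum_(0 <= k < q.+1) 'X^(q - k) *: map_mx polyC (B k).

Definition mxpoly_eval (K : fieldType) (m n : nat) (P : 'M[{poly K}]_(m, n))
    (z : K) : 'M[K]_(m, n) :=
  map_mx (fun a : {poly K} => a.[z]) P.

(* Over {poly K}, [D \in unitmx] says that D is unimodular. *)
Definition left_coprime (K : fieldType) (d m : nat) (A : 'M[{poly K}]_d)
    (B : 'M[{poly K}]_(d, m)) : Prop :=
  forall (D A' : 'M[{poly K}]_d) (B' : 'M[{poly K}]_(d, m)),
    A = D *m A' -> B = D *m B' -> D \in unitmx.

Definition mxpoly_spectrum (K : fieldType) (d : nat) (P : 'M[{poly K}]_d) :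
    set K :=
  [set z | \det (mxpoly_eval P z) = 0].

Definition mx_spectrum (K : fieldType) (d : nat) (M : 'M[K]_d) : set K :=
  [set z | eigenvalue M z].

Definition right_solvent (K : fieldType) (d p : nat) (A : nat -> 'M[K]_d)
    (S : 'M[K]_d) : Prop :=
  S ^+ p + \sum_(1 <= k < p.+1) A k *m S ^+ (p - k) = 0.

(* A1 is the left quotient of A(X) by X - S, which is unique. *)
Definition regular_right_solvent (K : fieldType) (d p : nat)
    (A : nat -> 'M[K]_d) (S : 'M[K]_d) : Prop :=
  right_solvent p A S /\
  exists A1 : nat -> 'M[K]_d,
    monic_mxpoly p A =
      monic_mxpoly p.-1 A1 *m ('X%:M - map_mx polyC S) /\
    mx_spectrum S `&` mxpoly_spectrum (monic_mxpoly p.-1 A1) = set0.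

Definition complete_solvents (K : fieldType) (d p : nat) (A : nat -> 'M[K]_d)
    (S : 'I_p -> 'M[K]_d) : Prop :=
  mxpoly_spectrum (monic_mxpoly p A) = \bigcup_(k in [set: 'I_p]) mx_spectrum (S k).

Definition block_vandermonde (K : fieldType) (d p : nat) (S : 'I_p -> 'M[K]_d) :
    'M[K]_(\sum_(i < p) d, \sum_(k < p) d) :=
  \mxblock_(i < p, k < p) (S k ^+ i).

(* Block indices below are 0-based. *)
Definition Astar (K : fieldType) (d p : nat) (A : nat -> 'M[K]_d) :
    'M[K]_(\sum_(i < p) d, \sum_(j < p) d) :=
  \mxblock_(i < p, j < p)
    (if i.+1 == p then - A (p - j)%N
     else if j == i.+1 :> nat then 1%:M else 0).

Definition Cstar (K : fieldType) (d p : nat) : 'M[K]_(d, \sum_(j < p) d) :=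
  \mxrow_(j < p) (if j == 0 :> nat then 1%:M else 0).

(* [beta_rec] is course-of-values recursion on a fuel argument; see
   [beta_small] and [beta_large] for the defining equations. *)
Fixpoint beta_rec (K : fieldType) (d m p q : nat) (A : nat -> 'M[K]_d)
    (B : nat -> 'M[K]_(d, m)) (fuel n : nat) : 'M[K]_(d, m) :=
  if fuel is f.+1 then
    if (n < p - q)%N then 0
    else - (\sum_(1 <= i < n) A i *m beta_rec p q A B f (n - i))
         + B (q - (p - n))%N
  else 0.

Definition beta (K : fieldType) (d m p q : nat) (A : nat -> 'M[K]_d)
    (B : nat -> 'M[K]_(d, m)) (n : nat) : 'M[K]_(d, m) :=
  beta_rec p q A B n n.

Lemma beta_small (K : fieldType) (d m p q : nat) (A : nat -> 'M[K]_d)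
    (B : nat -> 'M[K]_(d, m)) (n : nat) :
  (n < p - q)%N -> beta p q A B n = 0.
Proof. by rewrite /beta; case: n => //= n ->. Qed.

Lemma beta_rec_fuel (K : fieldType) (d m p q : nat) (A : nat -> 'M[K]_d)
    (B : nat -> 'M[K]_(d, m)) (f g n : nat) :
  (0 < n <= f)%N -> (n <= g)%N -> beta_rec p q A B f n = beta_rec p q A B g n.
Proof.
elim: f g n => [|f IH] [|g] n /andP[n0 nf] ng.
- by move: n0; rewrite ltnNge nf.
- by move: n0; rewrite ltnNge nf.
- by move: n0; rewrite ltnNge ng.
rewrite /=; case: ifP => // _; congr (- _ + _).
rewrite !big_nat; apply: eq_bigr => i /andP[i0 lt_in]; congr (_ *m _).
have lt_n : (n - i < n)%N by rewrite ltn_subrL i0 n0.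
by apply: IH; rewrite ?subn_gt0 ?lt_in /= -ltnS (leq_trans lt_n).
Qed.

Lemma beta_large (K : fieldType) (d m p q : nat) (A : nat -> 'M[K]_d)
    (B : nat -> 'M[K]_(d, m)) (j : nat) :
  (q < p)%N -> (j <= q)%N ->
  beta p q A B (p - j) =
    - (\sum_(1 <= i < p - j) A i *m beta p q A B (p - j - i)) + B (q - j)%N.
Proof.
move=> qp jq.
have jp : (j < p)%N by exact: leq_ltn_trans qp.
have pj0 : (0 < p - j)%N by rewrite subn_gt0.
rewrite {1}/beta; case E : (p - j)%N pj0 => [//|n] _.
rewrite [LHS]/= -E ltnNge leq_sub2l //= subKn ?(ltnW jp) //.
congr (- _ + _); rewrite !big_nat; apply: eq_bigr => i /andP[i0 lt_i].
congr (_ *m _); apply: beta_rec_fuel => //.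
by rewrite subn_gt0 lt_i /= -ltnS -E ltn_subrL i0 subn_gt0.
Qed.

Definition Bstar (K : fieldType) (d m p q : nat) (A : nat -> 'M[K]_d)
    (B : nat -> 'M[K]_(d, m)) : 'M[K]_(\sum_(i < p) d, m) :=
  \mxcol_(i < p) beta p q A B i.+1.

Definition mxC (R : realType) (m n : nat) (M : 'M[R]_(m, n)) : 'M[R[i]]_(m, n) :=
  map_mx (real_complex R) M.

Definition clim (R : realType) (u : nat -> R[i]) : R[i] :=
  limn (fun n => complex.Re (u n)) +i* limn (fun n => complex.Im (u n)).

Definition mexp (R : realType) (d : nat) (M : 'M[R[i]]_d) : 'M[R[i]]_d :=
  \matrix_(i, j) clim (fun n => (\sum_(k < n) (k`!%:R)^-1 *: M ^+ k) i j).

Definition path_derivative (R : realType) (g : R -> R[i]) (t : R) : R[i] :=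
  (fun s => complex.Re (g s))^`()%classic t
    +i* (fun s => complex.Im (g s))^`()%classic t.

Definition C1_path (R : realType) (g : R -> R[i]) : Prop :=
  forall t : R,
    [/\ derivable (fun s => complex.Re (g s)) t 1,
        derivable (fun s => complex.Im (g s)) t 1,
        {for t, continuous (fun s => complex.Re (path_derivative g s))} &
        {for t, continuous (fun s => complex.Im (path_derivative g s))}].

(* On each closed piece, [g] agrees with a C^1 path defined on the whole line,
   i.e. [g] is C^1 there up to and including the end points. *)
Definition piecewise_C1 (R : realType) (g : R -> R[i]) : Prop :=
  exists2 s : seq R, itv_partition 0 1 s &
    forall j : nat, (j < size s)%N ->
      exists2 h : R -> R[i], C1_path h &
        {in `[nth 0 (0 :: s) j, nth 0 s j], g =1 h}.

Definition simple_closed_contour (R : realType) (g : R -> R[i]) : Prop :=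
  [/\ piecewise_C1 g, g 0 = g 1 & {in `[0, 1[ &, injective g}].

Definition contour_image (R : realType) (g : R -> R[i]) : set R[i] :=
  g @` `[0, 1]%classic.

Definition cbounded (R : realType) (U : set R[i]) : Prop :=
  exists M : R, forall z, U z -> `|z| <= M%:C.

(* [R[i]^o] carries the usual topology of the complex plane. *)
Definition component_off (R : realType) (g : R -> R[i]) (z : R[i]) : set R[i] :=
  @connected_component R[i]^o (~` contour_image g) z.

Definition contour_interior (R : realType) (g : R -> R[i]) : set R[i] :=
  [set z | ~ contour_image g z /\ cbounded (component_off g z)].

Definition contour_exterior (R : realType) (g : R -> R[i]) : set R[i] :=
  [set z | ~ contour_image g z /\ ~ cbounded (component_off g z)].

(* At the finitely many break points [path_derivative g] may be meaningless,
   which does not affect the integral. *)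
Definition contour_integral (R : realType) (g : R -> R[i]) (f : R[i] -> R[i]) :
    R[i] :=
  Rintegral lebesgue_measure `[0, 1]%classic
    (fun t => complex.Re (f (g t) * path_derivative g t))
  +i* Rintegral lebesgue_measure `[0, 1]%classic
    (fun t => complex.Im (f (g t) * path_derivative g t)).

Definition two_pi_i (R : realType) : R[i] := 0 +i* (2 * pi).

Definition winding_number (R : realType) (g : R -> R[i]) (z : R[i]) : R[i] :=
  (two_pi_i R)^-1 * contour_integral g (fun w => (w - z)^-1).

Definition positively_oriented (R : realType) (g : R -> R[i]) : Prop :=
  forall z, contour_interior g z -> winding_number g z = 1.

(* [M] is the residue at [S] of F(z) = P(z)^-1 Q(z). *)
Definition is_residue (R : realType) (d m : nat) (P : 'M[{poly R[i]}]_d)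
    (Q : 'M[{poly R[i]}]_(d, m)) (S : 'M[R[i]]_d) (M : 'M[R[i]]_(d, m)) : Prop :=
  exists g : R -> R[i],
    [/\ simple_closed_contour g, positively_oriented g,
        mx_spectrum S `<=` contour_interior g,
        mxpoly_spectrum P `\` mx_spectrum S `<=` contour_exterior g &
        M = \matrix_(i, j) ((two_pi_i R)^-1 *
              contour_integral g (fun z =>
                (invmx (mxpoly_eval P z) *m mxpoly_eval Q z) i j))].

Definition random_vector (dO : measure_display) (Omega : measurableType dO)
    (R : realType) (n : nat) (X : Omega -> 'cV[R]_n) : Prop :=
  forall i, measurable_fun [set: Omega] (fun w => X w i 0).

Definition crandom_vector (dO : measure_display) (Omega : measurableType dO)
    (R : realType) (n : nat) (X : Omega -> 'cV[R[i]]_n) : Prop :=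
  forall i, measurable_fun [set: Omega] (fun w => complex.Re (X w i 0)) /\
            measurable_fun [set: Omega] (fun w => complex.Im (X w i 0)).

Definition borel_set (R : realType) (n : nat) : set (set 'cV[R]_n) :=
  <<s [set U : set 'cV[R]_n | open U] >>.

(* Càdlàg on [0, +oo[. *)
Definition cadlag (R : realType) (n : nat) (f : R -> 'cV[R]_n) : Prop :=
  (forall t : R, 0 <= t -> f x @[x --> t^'+] --> f t) /\
  (forall t : R, 0 < t -> cvg (f x @[x --> t^'-])).

(* Processes are indexed by R, but only their values at times t >= 0 matter. *)
Definition levy_process (dO : measure_display) (Omega : measurableType dO)
    (R : realType) (P : probability Omega R) (m : nat)
    (L : R -> Omega -> 'cV[R]_m) : Prop :=
  [/\ forall t : R, 0 <= t -> random_vector (L t),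
      {ae P, forall w, L 0 w = 0},
      forall (s t : R) (U : set 'cV[R]_m), 0 <= s -> 0 <= t -> borel_set U ->
        P [set w | U (L (s + t) w - L s w)] = P [set w | U (L t w - L 0 w)],
      forall (n : nat) (t : nat -> R) (U : nat -> set 'cV[R]_m),
        0 <= t 0 -> (forall i, t i <= t i.+1) -> (forall i, borel_set (U i)) ->
        P [set w | forall i, (i < n)%N -> U i (L (t i.+1) w - L (t i) w)] =
          (\prod_(i < n) P [set w | U i (L (t i.+1) w - L (t i) w)%R])%E &
      {ae P, forall w, cadlag (L ^~ w)}].

(* Left-point sums along the partition 0 = u_0 < u_1 < ... < u_n = t coded by
   [s] = [u_1; ...; u_n]. *)
Definition riemann_sum (Omega : Type) (R : realType) (d m : nat)
    (L : R -> Omega -> 'cV[R]_m) (f : R -> 'M[R[i]]_(d, m)) (s : seq R)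
    (w : Omega) : 'cV[R[i]]_d :=
  \sum_(j < size s)
    f (nth 0 (0 :: s) j) *m mxC (L (nth 0 s j) w - L (nth 0 (0 :: s) j) w).

(* [I] is (a version of) the stochastic integral of the deterministic continuous
   integrand [f] against dL over [0, t]: the limit in probability of the
   left-point sums as the mesh of the partition of [0, t] tends to 0. *)
Definition is_stochastic_integral (dO : measure_display)
    (Omega : measurableType dO) (R : realType) (P : probability Omega R)
    (d m : nat) (L : R -> Omega -> 'cV[R]_m) (f : R -> 'M[R[i]]_(d, m)) (t : R)
    (I : Omega -> 'cV[R[i]]_d) : Prop :=
  crandom_vector I /\
  forall eps eta : R, 0 < eps -> 0 < eta ->
    exists2 delta : R, 0 < delta &
      forall s : seq R, itv_partition 0 t s ->
        (forall j, (j < size s)%N -> nth 0 s j - nth 0 (0 :: s) j < delta) ->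
        forall i, (P [set w | (eps%:C <= `|(riemann_sum L f s w - I w) i 0|)%R]
                     <= eta%:E)%E.

(* Y(t) = e^(S t) Y(0) + int_0^t e^(S (t - u)) M dL(u), t >= 0 *)
Definition is_OU_process (dO : measure_display) (Omega : measurableType dO)
    (R : realType) (P : probability Omega R) (d m : nat)
    (L : R -> Omega -> 'cV[R]_m) (S : 'M[R[i]]_d) (M : 'M[R[i]]_(d, m))
    (Y : R -> Omega -> 'cV[R[i]]_d) : Prop :=
  forall t : R, 0 <= t ->
    crandom_vector (Y t) /\
    exists2 I : Omega -> 'cV[R[i]]_d,
      is_stochastic_integral P L (fun u => mexp ((t - u)%:C *: S) *m M) t I &
      {ae P, forall w, Y t w = mexp (t%:C *: S) *m Y 0 w + I w}.

(* dX(t) = A X(t) dt + B dL(t), understood as the integral equation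
   X(t) = X(0) + int_0^t A X(s) ds + B (L(t) - L(0)) for all t >= 0, a.s.;
   càdlàg paths make the Lebesgue integral meaningful. *)
Definition solves_sde (dO : measure_display) (Omega : measurableType dO)
    (R : realType) (P : probability Omega R) (n m : nat)
    (L : R -> Omega -> 'cV[R]_m) (A : 'M[R]_n) (B : 'M[R]_(n, m))
    (X : R -> Omega -> 'cV[R]_n) : Prop :=
  (forall t : R, 0 <= t -> random_vector (X t)) /\
  {ae P, forall w, cadlag (X ^~ w) /\
    forall t : R, 0 <= t ->
      X t w = X 0 w
        + \col_i Rintegral lebesgue_measure `[0, t]%classic
                   (fun s => (A *m X s w) i 0)
        + B *m (L t w - L 0 w)}.

Definition is_MCARMA (dO : measure_display) (Omega : measurableType dO)
    (R : realType) (P : probability Omega R) (d m p q : nat)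
    (L : R -> Omega -> 'cV[R]_m) (A : nat -> 'M[R]_d)
    (B : nat -> 'M[R]_(d, m)) (Y : R -> Omega -> 'cV[R]_d) : Prop :=
  exists2 X : R -> Omega -> 'cV[R]_(\sum_(i < p) d),
    solves_sde P L (Astar p A) (Bstar p q A B) X &
    forall t : R, 0 <= t -> {ae P, forall w, Y t w = Cstar R d p *m X t w}.

(* Main.v *)
Require Import Defs.
From HB Require Import structures.
From mathcomp Require Import all_boot all_order all_algebra complex.
From mathcomp Require Import all_classical all_reals all_analysis measurable_realfun.
From mathcomp Require Import perm ring lra zify.

(** Let [V_k] be the block column [(I, S_k, ..., S_k^(p-1))] of powers of the solvent
    [S_k]. The companion matrix acts on it as the solvent, [Astar V_k = V_k S_k], hence
    [exp(t Astar) V_k = V_k exp(t S_k)]. Put [X = sum_k V_k Y_k]; at time zero this is the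
    Vandermonde matrix applied to the initial values. The Ornstein-Uhlenbeck equations
    add up to
    [X(t) = exp(t Astar) X(0) + int_0^t exp((t - u) Astar) (sum_k V_k Res_k) dL(u)],
    and [Cstar V_k = I] gives [sum_k Y_k = Cstar X]. It remains to see that
    [sum_k V_k Res_k = Bstar] and that this process solves the state equation.

    The first point is [solvent_residue_sum]: [sum_k S_k^i Res_k = beta_(i+1)] for
    [i < p]. Since [A(z) = A1(z) (z - S_k)] with a quotient [A1] that is invertible on
    the spectrum of [S_k], the function [(z - S_k) F(z) = A1(z)^-1 B(z)] has no pole inside
    the [k]-th contour, so that [S_k^i Res_k] is the integral of [z^i F(z) / (2 pi i)]
    over that contour. Counting multiplicities shows that the spectra of the solvents are disjoint
    ([covering_factors_disjoint]). Every pole of [F] therefore lies inside exactly one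
    contour, and the sum of the integrals is the coefficient of [1 / z] in the expansion
    of [z^i F(z)] at infinity, which is [beta_(i+1)] by the recursion for [beta]
    ([expansion_restP]).

    For rational functions the residue theorem needs no general form of Cauchy's theorem.
    By partial fractions everything reduces to powers of [(z - a)^-1]
    ([residue_functional_coef]). All of them except the first have a primitive, and the
    first one defines the winding number. The winding number is one in the interior by
    the orientation. It vanishes in the exterior, because it is locally constant and
    tends to zero along an unbounded component ([winding_exterior]).

    For the second point, the integrand is smooth and deterministic, so that the
    stochastic integral is given path by path through integration by parts. For every
    càdlàg path [N] starting at zero, the function [path_solution] is càdlàg, solves the
    integral equation ([path_solution_integral]), and contains the limit of the left-point
    Riemann sums along uniform grids ([path_solution_riemann]). The same sums, combined
    from those of the [Y_k], converge in probability to [sum_k V_k I_k] with [I_k] the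
    given stochastic integrals; the two limits agree almost surely
    ([limit_in_probability_ae]). Since [Astar], [Bstar] and [X(0)] are real, so is the
    process obtained in this way. *)

Set Implicit Arguments.
Unset Strict Implicit.
Unset Printing Implicit Defensive.

Import Order.TTheory GRing.Theory Num.Theory.
Import numFieldNormedType.Exports.

Local Open Scope classical_set_scope.
Local Open Scope ring_scope.
Local Open Scope complex_scope.

(** * Piecewise smooth functions on an interval *)

Section RealLine.
Variable R : realType.
Implicit Types (a b x t : R) (f g : R -> R).
Local Notation mu := (@lebesgue_measure R).

(** An interval cut by a partition is handled one piece at a time, from the left;
    properties [P] of whole intervals are obtained from properties [Q] of pieces. *)
Lemma partition_ind (P Q : R -> R -> Prop) :
  (forall a, P a a) ->
  (forall a x b, a < x -> x <= b -> Q a x -> P x b -> P a b) ->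
  forall (s : seq R) a b, itv_partition a b s ->
    (forall j, (j < size s)%N -> Q (nth 0 (a :: s) j) (nth 0 s j)) -> P a b.
Proof.
move=> P0 PS; elim=> [|x s IH] a b ab Qs; first by rewrite (itv_partition_nil ab).
have xb := itv_partition_cons ab.
have ax : a < x by case: ab => /= /andP[].
apply: (PS a x b ax); first exact: itv_partition_le xb.
  exact: (Qs 0%N).
by apply: IH => // j js; apply: (Qs j.+1).
Qed.

(** Over [n] equal steps the increments add up to at most [k (b - a)^2 / n]. This
    replaces differentiation: it applies to functions that are only known through
    estimates, such as winding numbers and integrals of discontinuous functions. *)
Lemma quadratic_modulus_cst f a b (k : R) : a <= b ->
  (forall s t, a <= s -> s <= t -> t <= b -> `|f t - f s| <= k * (t - s) ^+ 2) ->
  f a = f b.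
Proof.
move=> ab fk; apply/eqP; rewrite eq_sym -subr_eq0 -normr_eq0.
have bound (n : nat) : `|f b - f a| <= k * (b - a) ^+ 2 / n.+1%:R.
  pose x (i : nat) := a + i%:R * ((b - a) / n.+1%:R).
  have x0 : x 0%N = a by rewrite /x mul0r addr0.
  have xn : x n.+1 = b by rewrite /x mulrCA divff ?pnatr_eq0// mulr1 addrC subrK.
  have xS i : x i.+1 - x i = (b - a) / n.+1%:R by rewrite /x -natr1; ring.
  have h0 : 0 <= (b - a) / n.+1%:R by rewrite divr_ge0// subr_ge0.
  have xle i j : (i <= j)%N -> x i <= x j.
    by move=> ij; rewrite /x lerD2l ler_wpM2r// ler_nat.
  have -> : f b - f a = \sum_(0 <= i < n.+1) (f (x i.+1) - f (x i)).
    by rewrite telescope_sumr// xn x0.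
  rewrite (le_trans (ler_norm_sum _ _ _))//.
  rewrite (@le_trans _ _ (\sum_(0 <= i < n.+1) (k * ((b - a) / n.+1%:R) ^+ 2)))//.
    apply: ler_sum_nat => i /andP[_ iN]; rewrite -(xS i) fk//.
    - by rewrite -x0 xle.
    - exact: xle.
    - by rewrite -xn xle.
  rewrite sumr_const_nat subn0 -mulr_natr.
  have n0 : n.+1%:R != 0 :> R by rewrite pnatr_eq0.
  by rewrite le_eqVlt; apply/orP; left; apply/eqP; field.
rewrite eq_le normr_ge0 andbT leNgt; apply/negP => /[dup] f0 + .
set c := `|_| in f0 bound *; move=> _.
have k0 : 0 < k * (b - a) ^+ 2.
  by have := bound 0%N; rewrite divr1; apply: lt_le_trans.
have := archi_boundP (ltW (divr_gt0 k0 f0)).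
set n := Num.bound _ => kn; have := bound n.
apply/negP; rewrite -ltNge ltr_pdivrMr ?ltr0n//.
rewrite ltr_pdivrMr// in kn; rewrite (lt_trans kn)//.
by rewrite [ltRHS]mulrC ltr_pM2r// ltr_nat.
Qed.

Lemma within_segment_continuous a b f :
  (forall t, a <= t <= b -> {for t, continuous f}) ->
  {within `[a, b], continuous f}.
Proof.
move=> cf; apply: continuous_in_subspaceT => t; rewrite inE /= in_itv /= => tab.
exact: cf.
Qed.

Lemma integrable_bounded_itv a b f (M : R) :
  measurable_fun `[a, b] f -> (forall t, a <= t <= b -> `|f t| <= M) ->
  mu.-integrable `[a, b] (EFin \o f).
Proof.
move=> mf fM; apply: measurable_bounded_integrable => //.
  rewrite /= lebesgue_measure_itv /=; case: ifP => _; last by rewrite ltry.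
  by rewrite -EFinB ltry.
exists M; split; first exact: num_real.
move=> N MN t /=; rewrite in_itv /= => tab.
by rewrite (le_trans (fM _ tab))// ltW.
Qed.

Lemma Rintegral_norm_bound a b f (M : R) : a <= b ->
  measurable_fun `[a, b] f -> (forall t, a <= t <= b -> `|f t| <= M) ->
  `|Rintegral mu `[a, b]%classic f| <= M * (b - a).
Proof.
move=> ab mf fM; have fi := integrable_bounded_itv mf fM.
rewrite (le_trans (le_normr_Rintegral _ fi))//.
have -> : M * (b - a) = Rintegral mu `[a, b]%classic (cst M).
  rewrite Rintegral_cst//= lebesgue_measure_itv /= lte_fin.
  by move: ab; rewrite le_eqVlt => /predU1P[->|->//]; rewrite ltxx subrr.
apply: le_Rintegral => //.
- apply: (@integrable_bounded_itv _ _ _ M); first exact: measurableT_comp.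
  by move=> t tab; rewrite normr_id; exact: fM.
- exact: (@integrable_bounded_itv _ _ _ `|M|).
Qed.

Lemma continuous_FTC a b f g : a <= b ->
  (forall t, a <= t <= b -> is_derive t 1 f (g t)) ->
  (forall t, a <= t <= b -> {for t, continuous g}) ->
  Rintegral mu `[a, b]%classic g = f b - f a.
Proof.
rewrite le_eqVlt => /predU1P[->|ab] df cg.
  by rewrite set_itv1 Rintegral_set1 subrr.
have fc t : a <= t <= b -> {for t, continuous f}.
  move=> tab; have ? := df t tab.
  exact/differentiable_continuous/derivable1_diffP.
rewrite /Rintegral (@continuous_FTC2 R g f)//; first exact: within_segment_continuous.
- split.
  + move=> t /[!in_itv]/= /andP[ta tb]; have := df t.
    by rewrite !ltW// => /(_ isT) ?.
  + by apply: cvg_at_right_filter; apply: fc; rewrite lexx ltW.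
  + by apply: cvg_at_left_filter; apply: fc; rewrite lexx ltW.
- move=> t /[!in_itv]/= /andP[ta tb]; have := df t.
  by rewrite !ltW// => /(_ isT) ?; rewrite derive1E; exact: derive_val.
Qed.

(** The comparison function is continuous up to the end points, where [f] itself may
    take any value: the derivative of a piecewise smooth path is of this kind. *)
Definition piece_continuous f a b :=
  exists2 h : R -> R, (forall t, a <= t <= b -> {for t, continuous h}) &
    {in `]a, b[, f =1 h}.

Definition piece_primitive (F : R -> R) f a b :=
  exists H, exists2 h : R -> R,
    (forall t, a <= t <= b -> {for t, continuous h} /\ is_derive t 1 H (h t)) &
    {in `]a, b[, f =1 h} /\ {in `[a, b], F =1 H}.

Lemma segment_setU a x b : a <= x -> x <= b ->
  `[a, b]%classic = `[a, x]%classic `|` `]x, b]%classic.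
Proof.
move=> ax xb; apply/seteqP; split => t /=; rewrite !in_itv /=.
  move=> /andP[ta tb]; have [tx|xt] := leP t x; [left|right]; first by rewrite ta.
  by rewrite tb.
by move=> [/andP[-> tx]|/andP[xt ->]]; rewrite ?(le_trans tx)// (le_trans ax) ?ltW.
Qed.

Lemma piece_measurable_bounded f a b : a < b -> piece_continuous f a b ->
  measurable_fun `[a, b] f /\ exists M : R, forall t, a <= t <= b -> `|f t| <= M.
Proof.
move=> ab [h hc fh]; split.
  rewrite -(@setU1itv _ _ _ _ false) ?bnd_simp ?ltW// -(@setUitv1 _ _ _ _ true) ?bnd_simp//.
  apply/measurable_funU => //; first exact: measurableU.
  split; first exact: measurable_fun_set1.
  apply/measurable_funU => //; split; last exact: measurable_fun_set1.
  apply: (@eq_measurable_fun _ _ _ _ _ h).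
    by move=> t; rewrite inE /= => /fh ->.
  apply: (@measurable_funS _ _ _ _ `[a, b]) => //.
    by apply: subset_itv_oo_cc.
  apply: subspace_continuous_measurable_fun => //.
  exact: within_segment_continuous.
have cn : {within `[a, b], continuous (fun t => `|h t|)}.
  apply: within_segment_continuous => t tab.
  by apply: (@cvg_norm _ R^o); exact: hc.
have [c _ hmax] := EVT_max (ltW ab) cn.
exists (`|h c| + `|f a| + `|f b|) => t /andP[].
rewrite le_eqVlt => /predU1P[<- _|ta]; first by rewrite addrAC lerDr addr_ge0.
rewrite le_eqVlt => /predU1P[->|tb]; first by rewrite lerDr addr_ge0.
rewrite fh ?in_itv/= ?ta// -addrA.
have tab : t \in `[a, b] by rewrite in_itv /= !ltW.
by apply: (le_trans (hmax t tab)); rewrite /= lerDl addr_ge0.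
Qed.

(** Boundedness on a closed piece comes from the extreme value theorem for the
    continuous comparison function; the end points only contribute two more values. *)
Lemma pw_measurable_bounded f a b (s : seq R) : itv_partition a b s ->
  (forall j, (j < size s)%N -> piece_continuous f (nth 0 (a :: s) j) (nth 0 s j)) ->
  measurable_fun `[a, b] f /\ exists M : R, forall t, a <= t <= b -> `|f t| <= M.
Proof.
move: s a b; apply: partition_ind => [a|a x b ax xb fax [mf [M fM]]].
  rewrite set_itv1; split; first exact: measurable_fun_set1.
  by exists `|f a| => t /le_anti ->.
have [mf' [M' fM']] := piece_measurable_bounded ax fax.
split.
  rewrite (segment_setU (ltW ax) xb); apply/measurable_funU => //.
  split=> //; apply: measurable_funS mf => //; exact: subset_itv_oc_cc.
exists (`|M| + `|M'|) => t /andP[ta tb]; have [tx|xt] := leP t x.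
  by rewrite (le_trans (fM' t _)) ?ta// (le_trans (ler_norm _))// lerDr.
by rewrite (le_trans (fM t _)) ?(ltW xt)// (le_trans (ler_norm _))// lerDl.
Qed.

Lemma Rintegral_segment_oo a b f : mu.-integrable `[a, b] (EFin \o f) ->
  Rintegral mu `[a, b]%classic f = Rintegral mu `]a, b[%classic f.
Proof.
move=> fi; rewrite -(@Rintegral_itv_bndo_bndc _ (BLeft a) b).
  rewrite -(@Rintegral_itv_obnd_cbnd _ a (BLeft b))//.
  by apply: integrableS fi => //; exact: subset_itv_oo_cc.
by apply: integrableS fi => //; exact: subset_itv_co_cc.
Qed.

(** The values of the primitive at the break points telescope. *)
Lemma pw_FTC F f a b (s : seq R) : itv_partition a b s ->
  (forall j, (j < size s)%N -> piece_primitive F f (nth 0 (a :: s) j) (nth 0 s j)) ->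
  Rintegral mu `[a, b]%classic f = F b - F a.
Proof.
move=> sab fs.
suff : [/\ measurable_fun `[a, b] f,
           exists M : R, forall t, a <= t <= b -> `|f t| <= M &
           Rintegral mu `[a, b]%classic f = F b - F a] by case.
move: s a b sab fs; apply: partition_ind => [a|a x b ax xb fax [mf [M fM] If]].
  rewrite set_itv1; split; [exact: measurable_fun_set1| |].
    by exists `|f a| => t /le_anti ->.
  by rewrite Rintegral_set1 subrr.
have fpw : piece_continuous f a x.
  by case: fax => H [h hc [fh _]]; exists h => // t /hc[].
have [mf' [M' fM']] := piece_measurable_bounded ax fpw.
have mab : measurable_fun `[a, b] f.
  rewrite (segment_setU (ltW ax) xb); apply/measurable_funU => //.
  split=> //; apply: measurable_funS mf => //; exact: subset_itv_oc_cc.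
have bab : forall t, a <= t <= b -> `|f t| <= `|M| + `|M'|.
  move=> t /andP[ta tb]; have [tx|xt] := leP t x.
    by rewrite (le_trans (fM' t _)) ?ta// (le_trans (ler_norm _))// lerDr.
  by rewrite (le_trans (fM t _)) ?(ltW xt)// (le_trans (ler_norm _))// lerDl.
have iab := integrable_bounded_itv mab bab.
split=> //; first by exists (`|M| + `|M'|).
have <- : F x - F a + (F b - F x) = F b - F a by rewrite addrC addrA subrK.
rewrite (segment_setU (ltW ax) xb) Rintegral_setU//; last 2 first.
- by rewrite -(segment_setU (ltW ax) xb).
- apply/disj_setPS => y [/=]; rewrite 2!in_itv/= => /andP[_ yx] /andP[].
  by rewrite ltNge yx.
congr (_ + _); last first.
  rewrite -If Rintegral_itv_obnd_cbnd//.
  by apply: integrableS iab => //; apply: subset_itvr; rewrite bnd_simp ltW.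
case: fax => H [h hc [fh FH]].
rewrite !FH ?in_itv/= ?lexx ?(ltW ax)//.
have <- : Rintegral mu `[a, x]%classic h = H x - H a.
  by apply: continuous_FTC; [exact: ltW|move=> t /hc[]|move=> t /hc[]].
have hi : mu.-integrable `[a, x] (EFin \o h).
  apply: continuous_compact_integrable; first exact: segment_compact.
  by apply: within_segment_continuous => t /hc[].
have fi : mu.-integrable `[a, x] (EFin \o f).
  by apply: integrableS iab => //; apply: subset_itvl; rewrite bnd_simp.
rewrite !Rintegral_segment_oo//.
by apply: eq_Rintegral => t; rewrite inE /= => /fh.
Qed.
End RealLine.

(** * Differentiation along paths in the complex plane *)

Section ComplexPaths.
Variable R : realType.
Local Notation C := R[i].
Implicit Types (f : C -> C) (h k : R -> C) (z w : C) (t : R).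
Local Notation Re := complex.Re.
Local Notation Im := complex.Im.

Lemma ReD z w : Re (z + w) = Re z + Re w. Proof. by case: z w => ? ? []. Qed.
Lemma ImD z w : Im (z + w) = Im z + Im w. Proof. by case: z w => ? ? []. Qed.
Lemma ReN z : Re (- z) = - Re z. Proof. by case: z. Qed.
Lemma ImN z : Im (- z) = - Im z. Proof. by case: z. Qed.
Lemma ReM z w : Re (z * w) = Re z * Re w - Im z * Im w.
Proof. by case: z w => ? ? []. Qed.
Lemma ImM z w : Im (z * w) = Re z * Im w + Im z * Re w.
Proof. by case: z w => ? ? []. Qed.
Lemma ReV z : Re z^-1 = Re z / (Re z ^+ 2 + Im z ^+ 2).
Proof. by case: z. Qed.
Lemma ImV z : Im z^-1 = - (Im z / (Re z ^+ 2 + Im z ^+ 2)).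
Proof. by case: z. Qed.
Lemma complex_ext z w : Re z = Re w -> Im z = Im w -> z = w.
Proof. by case: z w => ? ? [? ?] /= -> ->. Qed.
Lemma sqr_norm_neq0 z : z != 0 -> Re z ^+ 2 + Im z ^+ 2 != 0.
Proof.
apply: contraNneq => /eqP.
by rewrite paddr_eq0 ?sqr_ge0// !sqrf_eq0 eq_complex.
Qed.

Definition path_cont h t : Prop :=
  {for t, continuous (fun s => Re (h s))} /\ {for t, continuous (fun s => Im (h s))}.

Definition path_deriv h t (v : C) : Prop :=
  is_derive t (1 : R) (fun s => Re (h s)) (Re v) /\
  is_derive t (1 : R) (fun s => Im (h s)) (Im v).

Lemma path_deriv_cont h t v : path_deriv h t v -> path_cont h t.
Proof.
by move=> [? ?]; split; exact/differentiable_continuous/derivable1_diffP.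
Qed.

Lemma path_cont_cst z t : path_cont (fun=> z) t.
Proof. by split; exact: cvg_cst. Qed.

Lemma path_contD h k t : path_cont h t -> path_cont k t ->
  path_cont (fun s => h s + k s) t.
Proof.
move=> [hr hi] [kr ki]; split.
  rewrite (_ : (fun s => _) = fun s => Re (h s) + Re (k s)).
    by apply: cvgD. 
  by apply/funext => s; rewrite ReD.
rewrite (_ : (fun s => _) = fun s => Im (h s) + Im (k s)).
  by apply: cvgD.
by apply/funext => s; rewrite ImD.
Qed.

Lemma path_contM h k t : path_cont h t -> path_cont k t ->
  path_cont (fun s => h s * k s) t.
Proof.
move=> [hr hi] [kr ki]; split.
  rewrite (_ : (fun s => _) = fun s => Re (h s) * Re (k s) - Im (h s) * Im (k s)).
    by apply: cvgB; apply: cvgM.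
  by apply/funext => s; rewrite ReM.
rewrite (_ : (fun s => _) = fun s => Re (h s) * Im (k s) + Im (h s) * Re (k s)).
  by apply: cvgD; apply: cvgM.
by apply/funext => s; rewrite ImM.
Qed.

Lemma path_contV h t : h t != 0 -> path_cont h t -> path_cont (fun s => (h s)^-1) t.
Proof.
move=> h0 [hr hi].
have n0 := sqr_norm_neq0 h0.
have nc : {for t, continuous (fun s => (Re (h s) ^+ 2 + Im (h s) ^+ 2)^-1)}.
  apply: cvgV => //; rewrite /= !expr2.
  rewrite (_ : (fun s => _) = fun s => Re (h s) * Re (h s) + Im (h s) * Im (h s)).
    by apply: cvgD; apply: cvgM.
  by apply/funext => s; rewrite !expr2.
split.
  rewrite (_ : (fun s => _) = fun s => Re (h s) * (Re (h s) ^+ 2 + Im (h s) ^+ 2)^-1).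
    exact: cvgM.
  by apply/funext => s; rewrite ReV.
rewrite (_ : (fun s => _) = fun s => - (Im (h s) * (Re (h s) ^+ 2 + Im (h s) ^+ 2)^-1)).
  by apply: cvgN; exact: cvgM.
by apply/funext => s; rewrite ImV.
Qed.

Lemma path_deriv_cst z t : path_deriv (fun=> z) t 0.
Proof. by split; exact: is_derive_cst. Qed.

Lemma path_derivD h k t v w : path_deriv h t v -> path_deriv k t w ->
  path_deriv (fun s => h s + k s) t (v + w).
Proof.
move=> [hr hi] [kr ki]; split.
  rewrite (_ : (fun s => _) = (fun s => Re (h s)) + (fun s => Re (k s))).
    by rewrite ReD; exact: is_deriveD.
  by apply/funext => s; rewrite ReD.
rewrite (_ : (fun s => _) = (fun s => Im (h s)) + (fun s => Im (k s))).
  by rewrite ImD; exact: is_deriveD.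
by apply/funext => s; rewrite ImD.
Qed.

(** Computed on real and imaginary parts, as are all rules for paths: complex
    differentiability is only ever needed along a curve. *)
Lemma path_derivM h k t v w : path_deriv h t v -> path_deriv k t w ->
  path_deriv (fun s => h s * k s) t (v * k t + h t * w).
Proof.
move=> [hr hi] [kr ki]; split.
  rewrite (_ : (fun s => _) = (fun s => Re (h s)) * (fun s => Re (k s)) -
                              (fun s => Im (h s)) * (fun s => Im (k s))).
    have := is_deriveB (is_deriveM hr kr) (is_deriveM hi ki).
    congr (is_derive _ _ _ _); rewrite ReD !ReM /GRing.scale /=.
    by move: (Re (h t)) (Im (h t)) (Re (k t)) (Im (k t)) => a b c e; ring.
  by apply/funext => s; rewrite ReM.
rewrite (_ : (fun s => _) = (fun s => Re (h s)) * (fun s => Im (k s)) +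
                            (fun s => Im (h s)) * (fun s => Re (k s))).
  have := is_deriveD (is_deriveM hr ki) (is_deriveM hi kr).
  congr (is_derive _ _ _ _); rewrite ImD !ImM /GRing.scale /=.
  by move: (Re (h t)) (Im (h t)) (Re (k t)) (Im (k t)) => a b c e; ring.
by apply/funext => s; rewrite ImM.
Qed.

Lemma path_derivV h t v : h t != 0 -> path_deriv h t v ->
  path_deriv (fun s => (h s)^-1) t (- (h t) ^- 2 * v).
Proof.
move=> h0 [hr hi]; have n0 := sqr_norm_neq0 h0.
pose n2 := (fun s => Re (h s)) * (fun s => Re (h s)) +
           (fun s => Im (h s)) * (fun s => Im (h s)).
have n2t : n2 t != 0 by rewrite /n2 /= -[_ t]/(Re (h t) * Re (h t) + Im (h t) * Im (h t)) -!expr2.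
have n2E s : n2 s = Re (h s) ^+ 2 + Im (h s) ^+ 2 by rewrite !expr2.
have n2d : is_derive t (1 : R) (fun s => (n2 s)^-1) _ :=
  is_deriveV n2t (is_deriveD (is_deriveM hr hr) (is_deriveM hi hi)).
split.
  rewrite (_ : (fun s => _) = (fun s => Re (h s)) * (fun s => (n2 s)^-1)).
    apply: is_derive_eq; rewrite ReM ReN ImN -!exprVn !expr2 ReM ImM ReV ImV -n2E.
    rewrite /GRing.scale /= n2E.
    by field.
  by apply/funext => s; rewrite ReV -n2E.
rewrite (_ : (fun s => _) = - ((fun s => Im (h s)) * (fun s => (n2 s)^-1))).
  apply: is_derive_eq; rewrite ImM ReN ImN -!exprVn !expr2 ReM ImM ReV ImV -n2E.
  rewrite /GRing.scale /= n2E.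
  by field.
by apply/funext => s; rewrite ImV -n2E.
Qed.

(** Continuity and holomorphy of [f] at [z] are expressed by what [f] does to paths
    through [z]. This is all that contour integrals see, and it makes the rules for
    sums, products and inverses consequences of those for real functions. *)
Definition path_continuous_at f z : Prop :=
  forall h t, h t = z -> path_cont h t -> path_cont (fun s => f (h s)) t.

Definition has_cderiv f z (df : C) : Prop :=
  forall h t v, h t = z -> path_deriv h t v -> path_deriv (fun s => f (h s)) t (df * v).

Lemma continuous_at_cst w z : path_continuous_at (fun=> w) z.
Proof. by move=> h t _ _; exact: path_cont_cst. Qed.

Lemma continuous_at_id z : path_continuous_at id z.
Proof. by []. Qed.

Lemma continuous_atD f g z : path_continuous_at f z -> path_continuous_at g z ->
  path_continuous_at (fun w => f w + g w) z.
Proof. by move=> fc gc h t ht hc; apply: path_contD; [exact: fc|exact: gc]. Qed.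

Lemma continuous_atM f g z : path_continuous_at f z -> path_continuous_at g z ->
  path_continuous_at (fun w => f w * g w) z.
Proof. by move=> fc gc h t ht hc; apply: path_contM; [exact: fc|exact: gc]. Qed.

Lemma continuous_atV f z : f z != 0 -> path_continuous_at f z ->
  path_continuous_at (fun w => (f w)^-1) z.
Proof. by move=> f0 fc h t ht hc; apply: path_contV; [rewrite ht|exact: fc]. Qed.

Lemma continuous_atX f z n : path_continuous_at f z ->
  path_continuous_at (fun w => (f w) ^+ n) z.
Proof.
move=> fc; elim: n => [|n IH]; first exact: continuous_at_cst.
rewrite (_ : (fun _ => _) = fun w => f w * (f w) ^+ n); first exact: continuous_atM.
by apply/funext => w; rewrite exprS.
Qed.

Lemma continuous_at_horner (N : {poly C}) z : path_continuous_at (fun w => N.[w]) z.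
Proof.
elim/poly_ind: N => [|N c IH].
  rewrite (_ : (fun _ => _) = fun=> 0); first exact: continuous_at_cst.
  by apply/funext => w; rewrite horner0.
rewrite (_ : (fun _ => _) = fun w => N.[w] * w + c).
  apply: continuous_atD; last exact: continuous_at_cst.
  by apply: continuous_atM => //; exact: continuous_at_id.
by apply/funext => w; rewrite !hornerE.
Qed.

Lemma continuous_at_subC a z : path_continuous_at (fun w => w - a) z.
Proof. exact: (@continuous_atD id (fun=> - a) z (@continuous_at_id z) (@continuous_at_cst _ z)). Qed.

Lemma has_cderiv_subC a z : has_cderiv (fun w => w - a) z 1.
Proof.
move=> h t v ht hd; rewrite mul1r -[v]addr0.
exact: path_derivD (path_deriv_cst _ _).
Qed.

Lemma has_cderivX f z (df : C) n : has_cderiv f z df ->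
  has_cderiv (fun w => (f w) ^+ n.+1) z (n.+1%:R * f z ^+ n * df).
Proof.
move=> fd; elim: n => [|n IH] h t v ht hd.
  rewrite (_ : (fun _ => _) = fun s => f (h s)); last by apply/funext => s; rewrite expr1.
  by rewrite expr0 mulr1 mul1r; exact: fd.
rewrite (_ : (fun _ => _) = fun s => f (h s) * (f (h s)) ^+ n.+1); last first.
  by apply/funext => s; rewrite exprS.
have := path_derivM (fd h t v ht hd) (IH h t v ht hd).
rewrite ht; congr (path_deriv _ _ _).
by rewrite -[n.+2%:R]natr1 !exprS; ring.
Qed.

Lemma has_cderivV f z (df : C) : f z != 0 -> has_cderiv f z df ->
  has_cderiv (fun w => (f w)^-1) z (- (f z) ^- 2 * df).
Proof.
move=> f0 fd h t v ht hd; rewrite -mulrA.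
have := @path_derivV (fun s => f (h s)) t (df * v).
by rewrite ht; apply => //; exact: fd.
Qed.

Lemma has_cderivZ f z (df : C) c : has_cderiv f z df ->
  has_cderiv (fun w => c * f w) z (c * df).
Proof.
move=> fd h t v ht hd.
have := path_derivM (path_deriv_cst c t) (fd h t v ht hd).
by rewrite mul0r add0r mulrA.
Qed.
End ComplexPaths.

(** * Contour integrals *)

Section Contour.
Variable R : realType.
Local Notation C := R[i].
Local Notation Re := complex.Re.
Local Notation Im := complex.Im.
Local Notation mu := (@lebesgue_measure R).
Local Notation I01 := (`[0, 1]%classic : set R).
Local Notation normc := Normc.normc.
Implicit Types (f : C -> C) (z w : C) (t : R).

Lemma normc_Re z : `|Re z| <= normc z.
Proof. by have := normc_ge_Re z; rewrite lecR. Qed.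

Lemma normc_Im z : `|Im z| <= normc z.
Proof.
case: z => a b /=; rewrite -sqrtr_sqr ler_sqrt ?addr_ge0 ?sqr_ge0//.
by rewrite lerDr sqr_ge0.
Qed.

Lemma normc_ge0 z : 0 <= normc z.
Proof. exact: le_trans (normc_Re z). Qed.

Lemma normc_sqr z : normc z ^+ 2 = Re z ^+ 2 + Im z ^+ 2.
Proof. by case: z => a b /=; rewrite sqr_sqrtr// addr_ge0 ?sqr_ge0. Qed.

Lemma normc_le_ReIm z (e : R) : `|Re z| <= e -> `|Im z| <= e -> normc z <= 2 * e.
Proof.
move=> re im; have e0 : 0 <= e by exact: le_trans re.
rewrite -(ler_pXn2r (ltn0Sn 1)) ?nnegrE ?normc_ge0 ?mulr_ge0//.
rewrite normc_sqr -[Re z ^+ 2]real_normK ?num_real// -[Im z ^+ 2]real_normK ?num_real//.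
have r2 : `|Re z| ^+ 2 <= e ^+ 2 by rewrite lerXn2r// nnegrE.
have i2 : `|Im z| ^+ 2 <= e ^+ 2 by rewrite lerXn2r// nnegrE.
by rewrite (le_trans (lerD r2 i2))// exprMn; nra.
Qed.

Lemma C1_path_deriv (h : R -> C) t : C1_path h ->
  path_deriv h t (path_derivative h t) /\ path_cont (path_derivative h) t.
Proof.
move=> /(_ t)[dr di cr ci]; split; last by split.
have hr := derivableP dr; have hi := derivableP di.
by rewrite -!derive1E in hr hi; split.
Qed.

Lemma path_derivative_piece (g h : R -> C) a b : {in `[a, b], g =1 h} ->
  {in `]a, b[, path_derivative g =1 path_derivative h}.
Proof.
move=> gh t tab; rewrite /path_derivative !derive1E.
have near_t : \forall s \near t, g s = h s.
  near=> s; apply: gh; apply: subset_itv_oo_cc.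
  near: s; exact: near_in_itvoo.
by congr (_ +i* _); apply: near_eq_derive; apply: filterS near_t => s ->.
Unshelve. all: by end_near. Qed.

Section OneContour.
Variable g : R -> C.
Hypothesis g_pw : piecewise_C1 g.
Let img := contour_image g.

Let C1_piece (a b : R) := [/\ 0 <= a, a < b, b <= 1 &
  exists2 h : R -> C, C1_path h & {in `[a, b], g =1 h}].

(** The partition from the definition, with the bounds that keep each piece inside
    the unit interval. *)
Lemma contour_pieces : exists2 s : seq R, itv_partition 0 1 s &
  forall j, (j < size s)%N -> C1_piece (nth 0 (0 :: s) j) (nth 0 s j).
Proof.
case: g_pw => s s01 hs; exists s => // j js; split; last exact: hs.
- rewrite (set_nth_default 1) /=; last by rewrite ltnS ltnW.
  by apply: itv_partition_nth_ge s01; rewrite ltnS ltnW.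
- by case: s01 => /(pathP 0) + _; apply.
- rewrite -[nth 0 s j]/(nth 0 (0 :: s) j.+1) (set_nth_default 1) ?ltnS//.
  by apply: itv_partition_nth_le s01; rewrite ltnS.
Qed.

Lemma piece_image a b h t : 0 <= a -> b <= 1 -> {in `[a, b], g =1 h} ->
  a <= t <= b -> img (h t).
Proof.
move=> a0 b1 gh /andP[ta tb]; exists t => /=.
  by rewrite in_itv /= (le_trans a0 ta) (le_trans tb b1).
by rewrite gh// in_itv /= ta.
Qed.

Lemma contour_integrand_pw f : (forall z, img z -> path_continuous_at f z) ->
  forall a b, C1_piece a b ->
  piece_continuous (fun t => Re (f (g t) * path_derivative g t)) a b /\
  piece_continuous (fun t => Im (f (g t) * path_derivative g t)) a b.
Proof.
move=> fc a b [a0 ab b1 [h hC1 gh]].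
have hc t : a <= t <= b -> path_cont (fun t => f (h t) * path_derivative h t) t.
  move=> tab; have [hd dc] := C1_path_deriv t hC1.
  apply: path_contM => //; apply: (fc (h t)) => //; last exact: path_deriv_cont hd.
  exact: piece_image tab.
have fE : {in `]a, b[, forall t, f (g t) * path_derivative g t = f (h t) * path_derivative h t}.
  by move=> t tab; rewrite (path_derivative_piece gh)// gh// subset_itv_oo_cc.
split; [exists (fun t => Re (f (h t) * path_derivative h t))
       |exists (fun t => Im (f (h t) * path_derivative h t))].
- by move=> t /hc[].
- by move=> t /fE ->.
- by move=> t /hc[].
- by move=> t /fE ->.
Qed.

Lemma contour_integrand_bounded f : (forall z, img z -> path_continuous_at f z) ->
  (measurable_fun I01 (fun t => Re (f (g t) * path_derivative g t)) /\
   exists M : R, forall t, 0 <= t <= 1 -> `|Re (f (g t) * path_derivative g t)| <= M) /\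
  (measurable_fun I01 (fun t => Im (f (g t) * path_derivative g t)) /\
   exists M : R, forall t, 0 <= t <= 1 -> `|Im (f (g t) * path_derivative g t)| <= M).
Proof.
move=> fc; have [s s01 hs] := contour_pieces.
split; apply: (pw_measurable_bounded s01) => j /hs /(contour_integrand_pw fc).
  by case.
by case.
Qed.

Lemma contour_integrable f : (forall z, img z -> path_continuous_at f z) ->
  mu.-integrable I01 (EFin \o (fun t => Re (f (g t) * path_derivative g t))) /\
  mu.-integrable I01 (EFin \o (fun t => Im (f (g t) * path_derivative g t))).
Proof.
move=> /contour_integrand_bounded[[mr [Mr fr]] [mi [Mi fi]]].
by split; [exact: integrable_bounded_itv fr|exact: integrable_bounded_itv fi].
Qed.

Lemma contour_integralD f1 f2 :
  (forall z, img z -> path_continuous_at f1 z) ->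
  (forall z, img z -> path_continuous_at f2 z) ->
  contour_integral g (fun z => f1 z + f2 z) =
  contour_integral g f1 + contour_integral g f2.
Proof.
move=> /contour_integrable[r1 i1] /contour_integrable[r2 i2].
rewrite /contour_integral; apply: complex_ext; rewrite /= -RintegralD//.
  by apply: eq_Rintegral => t _; rewrite mulrDl ReD.
by apply: eq_Rintegral => t _; rewrite mulrDl ImD.
Qed.

Lemma contour_integralZ c f : (forall z, img z -> path_continuous_at f z) ->
  contour_integral g (fun z => c * f z) = c * contour_integral g f.
Proof.
move=> /contour_integrable[ir ii].
have iZ a (F : R -> R) : mu.-integrable I01 (EFin \o F) ->
    mu.-integrable I01 (EFin \o (fun t => a * F t)).
  by move=> iF; apply: (integrableZl _ a iF).
rewrite /contour_integral; apply: complex_ext; rewrite ?ReM ?ImM /=.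
  rewrite -!RintegralZl// -RintegralB//; try exact: iZ.
  by apply: eq_Rintegral => t _; rewrite -mulrA ReM.
rewrite -!RintegralZl// -RintegralD//; try exact: iZ.
by apply: eq_Rintegral => t _; rewrite -mulrA ImM.
Qed.

Lemma eq_contour_integral f1 f2 : (forall z, img z -> f1 z = f2 z) ->
  contour_integral g f1 = contour_integral g f2.
Proof.
move=> f12; rewrite /contour_integral; congr (_ +i* _); apply: eq_Rintegral => t;
  by rewrite inE => t01; rewrite f12//; exists t.
Qed.

(** On each smooth piece the integrand is the derivative of [F] along the path; the
    increments of [F] telescope to zero because the contour is closed. *)
Lemma contour_integral_primitive F f : g 0 = g 1 ->
  (forall z, img z -> path_continuous_at f z) ->
  (forall z, img z -> has_cderiv F z (f z)) ->
  contour_integral g f = 0.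
Proof.
move=> g01 fc Fd; have [s s01 hs] := contour_pieces.
have prim a b : C1_piece a b ->
  piece_primitive (fun t => Re (F (g t))) (fun t => Re (f (g t) * path_derivative g t)) a b /\
  piece_primitive (fun t => Im (F (g t))) (fun t => Im (f (g t) * path_derivative g t)) a b.
  move=> [a0 ab b1 [h hC1 gh]].
  have hc t : a <= t <= b -> path_cont (fun t => f (h t) * path_derivative h t) t
     /\ path_deriv (fun t => F (h t)) t (f (h t) * path_derivative h t).
    move=> tab; have [hd dc] := C1_path_deriv t hC1.
    have ht : img (h t) by exact: piece_image tab.
    split; last exact: (Fd (h t)).
    by apply: path_contM => //; apply: (fc (h t)) => //; exact: path_deriv_cont hd.
  have fE : {in `]a, b[, forall t, f (g t) * path_derivative g t = f (h t) * path_derivative h t}.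
    by move=> t tab; rewrite (path_derivative_piece gh)// gh// subset_itv_oo_cc.
  split; [exists (fun t => Re (F (h t))); exists (fun t => Re (f (h t) * path_derivative h t))
         |exists (fun t => Im (F (h t))); exists (fun t => Im (f (h t) * path_derivative h t))].
  - by move=> t /hc[[? ?] [? ?]].
  - by split => t; [move=> /fE ->|move=> /gh ->].
  - by move=> t /hc[[? ?] [? ?]].
  - by split => t; [move=> /fE ->|move=> /gh ->].
apply: complex_ext; rewrite /contour_integral /=.
  rewrite (pw_FTC s01 (F := fun t => Re (F (g t)))) ?g01 ?subrr//.
  by move=> j /hs /prim[].
rewrite (pw_FTC s01 (F := fun t => Im (F (g t)))) ?g01 ?subrr//.
by move=> j /hs /prim[].
Qed.

(** The constant depends on the contour only; the derivative of the contour is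
    bounded since it is piecewise continuous. *)
Lemma contour_integral_bound : exists2 K : R, 0 <= K & forall f (e : R),
  (forall z, img z -> path_continuous_at f z) ->
  (forall z, img z -> normc (f z) <= e) ->
  normc (contour_integral g f) <= K * e.
Proof.
have c1 z : img z -> path_continuous_at (fun=> 1) z by move=> _; exact: continuous_at_cst.
have [[_ [Mr fr]] [_ [Mi fi]]] := contour_integrand_bounded c1.
exists (2 * (`|Mr| + `|Mi|)); first by rewrite mulr_ge0// addr_ge0.
move=> f e fc fe.
have [[mr _] [mi _]] := contour_integrand_bounded fc.
have e0 : 0 <= e.
  apply: le_trans (fe (g 0) _); first exact: normc_ge0.
  by exists 0 => //=; rewrite in_itv /= lexx ler01.
have bt t : 0 <= t <= 1 -> [/\ `|Re (f (g t))| <= e, `|Im (f (g t))| <= e,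
    `|Re (path_derivative g t)| <= `|Mr| & `|Im (path_derivative g t)| <= `|Mi|].
  move=> t01; have it : img (g t) by exists t => //=; rewrite in_itv.
  have := fr t t01; have := fi t t01; rewrite !mul1r => i1 r1.
  split; [exact: le_trans (normc_Re _) (fe _ it)|exact: le_trans (normc_Im _) (fe _ it)|..].
    exact: le_trans r1 (ler_norm _).
  exact: le_trans i1 (ler_norm _).
rewrite -mulrA; apply: normc_le_ReIm; rewrite /contour_integral /=.
  rewrite -[leRHS]mulr1 -[X in _ * X]subr0.
  apply: Rintegral_norm_bound => // t /bt[r1 i1 r2 i2].
  rewrite ReM (le_trans (ler_normB _ _))// !normrM mulrDl.
  by rewrite lerD// mulrC ler_pM.
rewrite -[leRHS]mulr1 -[X in _ * X]subr0.
apply: Rintegral_norm_bound => // t /bt[r1 i1 r2 i2].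
rewrite ImM (le_trans (ler_normD _ _))// !normrM mulrDl addrC.
by rewrite lerD// mulrC ler_pM.
Qed.

Lemma contour_image_bounded : exists M : R, forall z, img z -> normc z <= M.
Proof.
have [s s01 hs] := contour_pieces.
have pc a b : C1_piece a b -> piece_continuous (fun t => Re (g t)) a b /\
    piece_continuous (fun t => Im (g t)) a b.
  move=> [a0 ab b1 [h hC1 gh]].
  have hc t : path_cont h t by have [hd _] := C1_path_deriv t hC1; exact: path_deriv_cont hd.
  split; [exists (fun t => Re (h t))|exists (fun t => Im (h t))].
  - by move=> t _; case: (hc t).
  - by move=> t /subset_itv_oo_cc /gh ->.
  - by move=> t _; case: (hc t).
  - by move=> t /subset_itv_oo_cc /gh ->.
have [_ [M1 f1]] := pw_measurable_bounded s01 (fun j js => (pc _ _ (hs j js)).1).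
have [_ [M2 f2]] := pw_measurable_bounded s01 (fun j js => (pc _ _ (hs j js)).2).
exists (2 * (`|M1| + `|M2|)) => _ [t /= + <-]; rewrite in_itv /= => t01.
apply: normc_le_ReIm.
  by rewrite (le_trans (f1 t t01))// (le_trans (ler_norm _))// lerDl.
by rewrite (le_trans (f2 t t01))// (le_trans (ler_norm _))// lerDr.
Qed.

(** The inverse of the squared distance to [z] is piecewise continuous along the
    contour, hence bounded. *)
Lemma contour_image_dist z : ~ img z ->
  exists2 r : R, 0 < r & forall w, img w -> r <= normc (w - z).
Proof.
move=> zg; have [s s01 hs] := contour_pieces.
(* A bound [N] for [F] yields the distance [1 / sqrt N]. *)
pose F t := (normc (g t - z) ^+ 2)^-1.
have pc a b : C1_piece a b -> piece_continuous F a b.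
  move=> [a0 ab b1 [h hC1 gh]].
  exists (fun t => ((Re (h t - z)) ^+ 2 + (Im (h t - z)) ^+ 2)^-1); last first.
    by move=> t /subset_itv_oo_cc /gh; rewrite /F normc_sqr => ->.
  move=> t tab; have [hd _] := C1_path_deriv t hC1.
  have ht : img (h t) by exact: piece_image tab.
  have h0 : h t - z != 0 by rewrite subr_eq0; apply: contra_notN zg => /eqP <-.
  have [cr ci] : path_cont (fun t => h t - z) t.
    by apply: path_contD; [exact: path_deriv_cont hd|exact: path_cont_cst].
  apply: cvgV; first exact: sqr_norm_neq0.
  rewrite !expr2.
  rewrite (_ : (fun s => _) = fun s => Re (h s - z) * Re (h s - z) +
                                       Im (h s - z) * Im (h s - z)).
    by apply: cvgD; apply: cvgM.
  by apply/funext => u; rewrite !expr2.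
have [_ [M fM]] := pw_measurable_bounded s01 (fun j js => pc _ _ (hs j js)).
pose N := `|M| + 1; have N0 : 0 < N by rewrite ltr_wpDl.
exists (Num.sqrt N^-1); first by rewrite sqrtr_gt0 invr_gt0.
move=> _ [t /= + <-]; rewrite in_itv /= => t01.
have gz : 0 < normc (g t - z) ^+ 2.
  rewrite exprn_gt0// lt_neqAle normc_ge0 andbT eq_sym.
  apply: contra_notN zg => /eqP/Normc.eq0_normc/eqP; rewrite subr_eq0 => /eqP <-.
  by exists t => //=; rewrite in_itv.
rewrite -(ler_pXn2r (ltn0Sn 1)) ?nnegrE ?normc_ge0 ?sqrtr_ge0//.
rewrite sqr_sqrtr ?invr_ge0 ?(ltW N0)// -[leRHS]invrK.
rewrite lef_pV2 ?posrE ?invr_gt0//.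
have := fM t t01; rewrite /F ger0_norm ?invr_ge0 ?sqr_ge0// => /le_trans; apply.
by rewrite /N (le_trans (ler_norm _))// lerDl.
Qed.
End OneContour.
End Contour.

(** * Winding numbers *)

Section Winding.
Variable R : realType.
Local Notation C := R[i].
Local Notation Re := complex.Re.
Local Notation Im := complex.Im.
Local Notation normc := Normc.normc.

(** The level set of [W x] in [A] is open and closed in [A]. *)
Lemma locally_constant_connected (T : topologicalType) (V : Type) (A : set T) (W : T -> V) :
  connected A -> (forall z, A z -> \forall w \near z, W w = W z) ->
  forall x y, A x -> A y -> W y = W x.
Proof.
move=> cA lc x y Ax Ay.
pose E := A `&` [set w | W w = W x].
suff EA : E = A by have [] : E y by rewrite EA.
apply: cA; first by exists x.
  exists (interior [set w | W w = W x]); first exact: open_interior.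
  apply/seteqP; split => z [Az Wz]; split => //.
    by rewrite /interior /= -Wz; exact: lc.
  exact: interior_subset Wz.
exists (~` interior [set w | W w <> W x]).
  by apply: open_closedC; exact: open_interior.
apply/seteqP; split => z [Az Wz]; split => //.
  by move=> /interior_subset.
apply: contrapT => Wzx; apply: Wz; rewrite /interior /=.
by apply: filterS (lc z Az) => w /= ->.
Qed.

Lemma normc_real (x : R) : normc x%:C = `|x|.
Proof. by rewrite /= expr0n addr0 sqrtr_sqr. Qed.

Lemma normcX (z : C) n : normc (z ^+ n) = normc z ^+ n.
Proof. by elim: n => [|n IH]; rewrite ?expr0 ?Normc.normc1// !exprS Normc.normcM IH. Qed.

Section OneContour.
Implicit Types (z w : C).
Variable g : R -> C.
Hypothesis g_pw : piecewise_C1 g.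
Hypothesis g01 : g 0 = g 1.
Let img := contour_image g.
Let W z := contour_integral g (fun w => (w - z)^-1).

Lemma img_sub_neq0 z : ~ img z -> forall w, img w -> w - z != 0.
Proof. by move=> zg w wg; rewrite subr_eq0; apply: contra_notN zg => /eqP <-. Qed.

Lemma continuous_at_inv_subC (a z : C) : z - a != 0 ->
  path_continuous_at (fun w => (w - a)^-1) z.
Proof. by move=> za; apply: continuous_atV => //; exact: continuous_at_subC. Qed.

(** Powers of [(w - z)^-1] from the second on have a primitive off [z]. *)
Lemma contour_integral_inv_pow z n : ~ img z ->
  contour_integral g (fun w => (w - z)^-1 ^+ n.+2) = 0.
Proof.
move=> zg; have z0 := img_sub_neq0 zg.
(* [c (w - z)^-(n+1)] is a primitive of [(w - z)^-(n+2)]. *)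
pose c : C := - (n.+1%:R)^-1.
apply: (contour_integral_primitive g_pw (F := fun w => c * (w - z)^-1 ^+ n.+1)) => //.
  by move=> w /z0 wz; apply: continuous_atX; exact: continuous_at_inv_subC.
move=> w /z0 wz.
have := has_cderivZ c (has_cderivX n
  (has_cderivV (f := fun w => w - z) wz (@has_cderiv_subC _ z w))).
congr (has_cderiv _ _ _).
have n0 : n.+1%:R != 0 :> C by rewrite pnatr_eq0.
rewrite /c mulr1 -exprVn; set x := (_ - _)^-1; rewrite !exprS expr0; set y := x ^+ n.
by rewrite mulrN mulNr mulrN opprK; field.
Qed.

Lemma contour_integral_monomial n : contour_integral g (fun z => z ^+ n) = 0.
Proof.
apply: (contour_integral_primitive g_pw (F := fun w => (n.+1%:R)^-1 * w ^+ n.+1)) => //.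
  by move=> w _; apply: continuous_atX; exact: continuous_at_id.
move=> w _; have idd : has_cderiv id w 1 by move=> h t v _; rewrite mul1r.
have := has_cderivZ (n.+1%:R)^-1 (has_cderivX n idd).
congr (has_cderiv _ _ _).
by rewrite mulr1 mulrA mulVf ?mul1r// pnatr_eq0.
Qed.

Lemma contour_integral_poly (N : {poly C}) : contour_integral g (fun z => N.[z]) = 0.
Proof.
rewrite (@eq_contour_integral _ g _ (fun z => \sum_(i < size N) N`_i * z ^+ i)); last first.
  by move=> z _; rewrite horner_coef.
have cX i z : path_continuous_at (fun z : C => N`_i * z ^+ i) z.
  apply: continuous_atM; first exact: continuous_at_cst.
  by apply: continuous_atX; exact: continuous_at_id.
have cS n z : path_continuous_at (fun z : C => \sum_(i < n) N`_i * z ^+ i) z.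
  elim: n => [|n IH].
    rewrite (_ : (fun _ => _) = fun=> 0); first exact: continuous_at_cst.
    by apply/funext => u; rewrite big_ord0.
  rewrite (_ : (fun _ => _) = fun z => \sum_(i < n) N`_i * z ^+ i + N`_n * z ^+ n).
    exact: continuous_atD.
  by apply/funext => u; rewrite big_ord_recr.
elim: (size N) => [|n IH].
  rewrite (@eq_contour_integral _ g _ (fun z => 0 * z ^+ 0)).
    rewrite contour_integralZ// ?mul0r//.
    by move=> z _; exact: continuous_at_cst.
  by move=> z _; rewrite big_ord0 mul0r.
rewrite (@eq_contour_integral _ g _ (fun z => \sum_(i < n) N`_i * z ^+ i + N`_n * z ^+ n)).
  rewrite contour_integralD//.
  rewrite IH add0r contour_integralZ// ?contour_integral_monomial ?mulr0//.
  by move=> z _; apply: continuous_atX; exact: continuous_at_id.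
by move=> z _; rewrite big_ord_recr.
Qed.

(** With [d = z1 - z2], partial fractions give
    [(w - z1)^-1 = (w - z2)^-1 + d (w - z2)^-2 + d^2 (w - z1)^-1 (w - z2)^-2].
    The middle term integrates to zero, so that only a term of order two in [d]
    remains. This stands for the statement that the derivative of the winding number
    vanishes. *)
Lemma winding_quadratic z0 (r : R) : 0 < r -> (forall w, img w -> 2 * r <= normc (w - z0)) ->
  exists K : R, forall z1 z2, normc (z1 - z0) < r -> normc (z2 - z0) < r ->
    normc (W z1 - W z2) <= K * normc (z1 - z2) ^+ 2.
Proof.
move=> r0 rg; have [K K0 Kb] := contour_integral_bound g_pw.
exists (K * (r^-1 ^+ 3)) => z1 z2 z1r z2r.
have far z : normc (z - z0) < r -> forall w, img w -> r <= normc (w - z).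
  move=> zr w wg; have := le_normcD (w - z) (z - z0).
  by rewrite addrA subrK => /(le_trans (rg w wg)); move: zr; lra.
have neq z : normc (z - z0) < r -> forall w, img w -> w - z != 0.
  move=> zr w wg; apply/eqP => wz; have := far z zr w wg.
  by rewrite wz Normc.normc0 leNgt r0.
have inv z : normc (z - z0) < r -> forall w, img w -> normc (w - z)^-1 <= r^-1.
  move=> zr w wg; rewrite Normc.normcV lef_pV2 ?posrE ?(far z)//.
  by rewrite (lt_le_trans r0)// (far z).
have ci z : normc (z - z0) < r -> forall w, img w ->
    path_continuous_at (fun w => (w - z)^-1) w.
  by move=> zr w wg; apply: continuous_at_inv_subC; exact: (neq z).
have z2g : ~ img z2.
  by move=> /(neq _ z2r); rewrite subrr eqxx.
pose d := z1 - z2.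
pose rest w := (w - z1)^-1 * (w - z2)^-1 ^+ 2.
have restc w : img w -> path_continuous_at rest w.
  by move=> wg; apply: continuous_atM; [exact: (ci z1)|apply: continuous_atX; exact: (ci z2)].
have -> : W z1 - W z2 = d ^+ 2 * contour_integral g rest.
  rewrite /W (@eq_contour_integral _ g (fun w => (w - z1)^-1)
     (fun w => (w - z2)^-1 + (d * (w - z2)^-1 ^+ 2 + d ^+ 2 * rest w))); last first.
    move=> w wg; have w1 := neq _ z1r w wg; have w2 := neq _ z2r w wg.
    by rewrite /rest /d; field; apply/andP.
  have c2 w : img w -> path_continuous_at (fun w => (w - z2)^-1 ^+ 2) w.
    by move=> wg; apply: continuous_atX; exact: (ci z2).
  have cZ c (f : C -> C) w : path_continuous_at f w -> path_continuous_at (fun z => c * f z) w.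
    by move=> fc; apply: continuous_atM => //; exact: continuous_at_cst.
  rewrite contour_integralD//; last 2 first.
  - exact: ci.
  - by move=> w wg; apply: continuous_atD; apply: cZ; [exact: c2|exact: restc].
  rewrite contour_integralD//; last 2 first.
  - by move=> w wg; apply: cZ; exact: c2.
  - by move=> w wg; apply: cZ; exact: restc.
  rewrite !contour_integralZ//.
  by rewrite (contour_integral_inv_pow 0)// mulr0 add0r addrC addKr.
rewrite Normc.normcM normcX mulrC ler_wpM2r ?sqr_ge0//; apply: Kb => // w wg.
rewrite /rest Normc.normcM normcX [r^-1 ^+ 3]exprS.
apply: ler_pM; [exact: normc_ge0|by rewrite exprn_ge0 ?normc_ge0|exact: inv|].
by rewrite lerXn2r ?nnegrE ?normc_ge0 ?invr_ge0 ?(ltW r0)//; exact: inv.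
Qed.

(** A quadratic modulus along the segment from [z0] to [z] forces equality. *)
Lemma winding_locally_constant z0 : ~ img z0 ->
  exists2 r : R, 0 < r & forall z, normc (z - z0) < r -> W z = W z0.
Proof.
move=> /(contour_image_dist g_pw)[r2 r20 rg].
pose r := r2 / 2; have r0 : 0 < r by rewrite divr_gt0.
have {}rg w : img w -> 2 * r <= normc (w - z0).
  by move=> /rg; rewrite /r mulrC divfK ?pnatr_eq0.
have [K Kq] := winding_quadratic r0 rg.
exists r => // z zr.
(* The segment from [z0] to [z] stays in the disc of radius [r]. *)
pose p (s : R) := z0 + s%:C * (z - z0).
have pr s : 0 <= s -> s <= 1 -> normc (p s - z0) < r.
  move=> s0 s1; rewrite /p addrAC subrr add0r Normc.normcM normc_real ger0_norm//.
  by rewrite (le_lt_trans _ zr)// ler_piMl ?normc_ge0.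
have pd s t : normc (p t - p s) = `|t - s| * normc (z - z0).
  by rewrite -normc_real -Normc.normcM rmorphB /= /p; congr normc; ring.
have q s t : 0 <= s -> s <= t -> t <= 1 ->
    normc (W (p t) - W (p s)) <= (K * normc (z - z0) ^+ 2) * (t - s) ^+ 2.
  move=> s0 st t1.
  have := Kq (p t) (p s) (pr _ (le_trans s0 st) t1) (pr _ s0 (le_trans st t1)).
  by rewrite pd exprMn real_normK ?num_real// mulrCA mulrC.
have -> : W z = W (p 1) by rewrite /p mul1r addrC subrK.
have -> : W z0 = W (p 0) by rewrite /p mul0r addr0.
apply: complex_ext.
- apply/esym/(quadratic_modulus_cst (f := fun s => Re (W (p s))) ler01) => s t s0 st t1.
  rewrite -ReN -ReD; exact: le_trans (normc_Re _) (q _ _ s0 st t1).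
- apply/esym/(quadratic_modulus_cst (f := fun s => Im (W (p s))) ler01) => s t s0 st t1.
  rewrite -ImN -ImD; exact: le_trans (normc_Im _) (q _ _ s0 st t1).
Qed.

(** The winding number is constant on the component of [z], and on an unbounded
    component it is arbitrarily small. *)
Lemma winding_exterior z : contour_exterior g z -> W z = 0.
Proof.
move=> [zg unb]; apply: contrapT => Wz.
have Wn : 0 < normc (W z).
  by rewrite lt_neqAle normc_ge0 andbT eq_sym; apply/eqP => /Normc.eq0_normc.
have cst y : component_off g z y -> W y = W z /\ ~ img y.
  move=> [A [Az Ai cA] Ay]; split; last exact: Ai.
  apply: (locally_constant_connected cA) => // w Aw.
  have [r r0 rW] := winding_locally_constant (Ai _ Aw).
  apply/nbhs_ballP; exists (r%:C) => /=; first by rewrite ltcR.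
  move=> u; rewrite /ball /= => wu; apply: rW.
  by rewrite -ltcR -[(normc _)%:C]/(`|u - w|) distrC.
have [M Mg] := contour_image_bounded g_pw.
have [K K0 Kb] := contour_integral_bound g_pw.
apply: unb; exists (`|M| + (K + 1) / normc (W z)) => y yz.
have [Wy yg] := cst y yz.
rewrite -[`|y|]/((normc y)%:C) lecR leNgt; apply/negP => ybig.
pose e := normc y - `|M|.
have e0 : (K + 1) / normc (W z) < e by rewrite /e ltrBrDl.
have ep : 0 < e by apply: le_lt_trans e0; rewrite divr_ge0 ?normc_ge0// addr_ge0.
have : normc (W y) <= K * e^-1.
  apply: Kb => w wg; first by apply: continuous_at_inv_subC; exact: img_sub_neq0.
  rewrite Normc.normcV lef_pV2 ?posrE//.
    have := le_normcD (w - y) (- w); rewrite addrAC subrr add0r !normcN /e => h.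
    by have := Mg w wg; have := ler_norm M; lra.
  rewrite lt_neqAle normc_ge0 andbT eq_sym; apply/eqP => /Normc.eq0_normc/eqP.
  by apply/negP; exact: img_sub_neq0.
rewrite Wy ler_pdivlMr//; apply/negP; rewrite -ltNge.
rewrite ltr_pdivrMr// in e0; rewrite mulrC; apply: lt_trans e0.
by rewrite ltrDl.
Qed.
End OneContour.
End Winding.

(** * Residues as a functional on fractions *)

Section FormalResidue.
Variables (K : fieldType) (D : {pred K}) (Phi : {poly K} -> seq K -> K) (c : K).
Hypothesis PhiL : forall a (N1 N2 : {poly K}) (s : seq K), {subset s <= D} ->
  Phi (a *: N1 + N2) s = a * Phi N1 s + Phi N2 s.
Hypothesis PhiM : forall (N : {poly K}) a (s : seq K), a \in D -> {subset s <= D} ->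
  Phi (N * ('X - a%:P)) (a :: s) = Phi N s.
Hypothesis PhiP : forall (N : {poly K}) (s1 s2 : seq K), {subset s1 <= D} -> perm_eq s1 s2 ->
  Phi N s1 = Phi N s2.
Hypothesis Phi_high : forall a n, a \in D -> Phi 1 (nseq n.+2 a) = 0.
Hypothesis Phi_simple : forall a, a \in D -> Phi 1 [:: a] = c.

Let Phi0 (s : seq K) : {subset s <= D} -> Phi 0 s = 0.
Proof.
move=> sD; have := PhiL 1 0 0 sD; rewrite scaler0 addr0 mul1r => PhiD.
by apply: (@addrI _ (Phi 0 s)); rewrite addr0.
Qed.

Let PhiZ a N (s : seq K) : {subset s <= D} -> Phi (a *: N) s = a * Phi N s.
Proof. by move=> sD; rewrite -[_ *: _]addr0 PhiL// Phi0// addr0. Qed.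

Let Phi_cancel N (s t : seq K) : {subset s <= D} -> {subset t <= D} ->
  Phi (N * \prod_(a <- s) ('X - a%:P)) (s ++ t) = Phi N t.
Proof.
elim: s N => [|a s IH] N; first by rewrite big_nil mulr1.
move=> asD tD; have aD : a \in D by apply: asD; rewrite mem_head.
have sD : {subset s <= D} by move=> x xs; apply: asD; rewrite in_cons xs orbT.
rewrite big_cons [_ * (_ * _)]mulrCA mulrC /= PhiM//; first exact: IH.
by move=> x; rewrite mem_cat => /orP[/sD//|/tD].
Qed.

(** A functional on fractions [N / prod_(a <- s) ('X - a)] that is linear, respects
    cancellation, kills the higher powers of [('X - a)^-1] and takes the same value
    [c] on every [('X - a)^-1] is [c] times the coefficient of [1 / 'X] in the
    expansion at infinity. Induction on [s]: if all poles coincide, expand [N] in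
    powers of ['X - a]; otherwise two distinct poles [a] and [e] are separated by
    [(a - e) / (('X - a) ('X - e)) = 1 / ('X - a) - 1 / ('X - e)]. *)
Lemma residue_functional_coef (s : seq K) (N : {poly K}) : {subset s <= D} ->
  (size N <= size s)%N -> Phi N s = c * N`_(size s).-1.
Proof.
have [n] := ubnP (size s); elim: n s N => // n IH s N /ltnSE sn sD Ns.
case: s => [|a s] in sn sD Ns *.
  by move: Ns; rewrite leqn0 size_poly_eq0 => /eqP ->; rewrite Phi0// coef0 mulr0.
have aD : a \in D by apply: sD; rewrite mem_head.
case: s => [|b s] in sn sD Ns *.
  by rewrite (size1_polyC Ns) -alg_polyC PhiZ// Phi_simple//= alg_polyC coefC eqxx mulrC.
have [/all_pred1P sa|] := boolP (all (pred1 a) (b :: s)).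
  rewrite -/(nseq (size s).+1 a) in sa.
  have /factor_theorem[Q NQ] : root (N - (N.[a])%:P) a.
    by rewrite rootE !hornerE subrr.
  have {}NQ : N = N.[a] *: 1 + Q * ('X - a%:P).
    by rewrite -NQ alg_polyC addrC subrK.
  have sz : (size Q <= (size s).+1)%N.
    have [->|Q0] := eqVneq Q 0; first by rewrite size_poly0.
    have sQ : size (Q * ('X - a%:P)) = (size Q).+1.
      by rewrite size_Mmonic// ?monicXsubC// size_XsubC addn2.
    rewrite -ltnS -sQ; have -> : Q * ('X - a%:P) = N - (N.[a])%:P.
      by rewrite {1}NQ alg_polyC addrAC subrr add0r.
    rewrite (leq_trans (size_polyD _ _))// geq_max Ns size_polyN.
    by rewrite (leq_trans (size_polyC_leq1 _)).
  rewrite {1}NQ PhiL// sa {1}/nseq /= -/(nseq (size s).+2 a).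
  have nD : {subset nseq (size s).+1 a <= D}.
    by move=> x; rewrite mem_nseq => /andP[_ /eqP ->].
  rewrite Phi_high// mulr0 add0r PhiM//.
  have sn' : size (nseq (size s).+1 a) = (size s).+1 by rewrite size_nseq.
  rewrite IH ?sn'//= size_nseq.
  rewrite [in RHS]NQ coefD mulrBr coefB coefMX coefMC alg_polyC coefC /= add0r.
  by rewrite [Q`__.+1]nth_default ?mul0r ?subr0.
case/allPn => e es; rewrite /= => ea.
have eD : e \in D by apply: sD; rewrite in_cons es orbT.
pose s' := rem e (b :: s).
have ps : perm_eq (a :: b :: s) (a :: e :: s').
  by rewrite perm_cons perm_to_rem.
have sz : size s' = size s by rewrite size_rem.
rewrite (PhiP _ sD ps).
have s'D : {subset s' <= D}.
  by move=> x /mem_rem xs; apply: sD; rewrite in_cons xs orbT.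
have aeD : {subset a :: e :: s' <= D}.
  by move=> x; rewrite !in_cons => /or3P[/eqP->|/eqP->|/s'D].
have asD : {subset a :: s' <= D}.
  by move=> x; rewrite !in_cons => /orP[/eqP->|/s'D].
have esD : {subset e :: s' <= D}.
  by move=> x; rewrite !in_cons => /orP[/eqP->|/s'D].
pose l := N`_(size s).+1.
(* Subtracting a multiple of [M] lowers the degree of the numerator; the fraction
   [M / prod] itself is [1 / ('X - e)]. *)
pose M := \prod_(x <- a :: s') ('X - x%:P).
have sM : size M = (size s).+2 by rewrite size_prod_XsubC /= sz.
have mM : M`_(size s).+1 = 1.
  have /monicP : M \is monic by exact: monic_prod_XsubC.
  by rewrite /lead_coef sM.
pose N' := N - l *: M.
have sN' : (size N' <= (size s).+1)%N.
  apply/leq_sizeP => j; rewrite leq_eqVlt => /predU1P[<-|js].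
    by rewrite coefB coefZ mM mulr1 subrr.
  by rewrite coefB coefZ [N`_j]nth_default ?(leq_trans Ns)// [M`_j]nth_default ?sM// mulr0 subrr.
have -> : N = l *: (1 * M) + N' by rewrite mul1r /N' addrC subrK.
rewrite PhiL//.
have -> : Phi (1 * M) (a :: e :: s') = c.
  rewrite (@PhiP _ _ ((a :: s') ++ [:: e]))//; last first.
    by rewrite /= perm_cons cats1 perm_sym perm_rcons.
  by rewrite Phi_cancel// ?Phi_simple// => x; rewrite inE => /eqP ->.
(* Separating [a] from [e] leaves two fractions with the same numerator and one pole
   less, whose values agree by induction. *)
have -> : Phi N' (a :: e :: s') = 0.
  have ae : a - e != 0 by rewrite subr_eq0 eq_sym.
  have -> : N' = (a - e)^-1 *: (N' * ('X - e%:P)) +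
     ((- (a - e)^-1) *: (N' * ('X - a%:P)) + 0).
    have aeE : 'X - e%:P - ('X - a%:P) = (a - e)%:P :> {poly K}.
      by rewrite polyCB; ring.
    by rewrite addr0 scaleNr -scalerBr -mulrBr aeE mulrC mul_polyC scalerA mulVf// scale1r.
  rewrite !PhiL// Phi0// PhiM//.
  have -> : Phi (N' * ('X - e%:P)) [:: a, e & s'] = Phi N' (a :: s').
    rewrite (@PhiP _ _ [:: e, a & s'])//; first by rewrite PhiM.
    by rewrite -(cat1s a) -(cat1s e) perm_catCA.
  rewrite !IH ?sz//= ?sz//.
  by rewrite addr0 mulNr subrr.
rewrite addr0 mul1r /= [l * _]mulrC /N' /l -/M; congr (_ * _).
by rewrite coefD coefB coefZ mM mulr1 addrC subrK.
Qed.
End FormalResidue.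

(** * Leading coefficients of determinants *)

Section TopCoefficients.
Variable K : fieldType.

(** The indices [a] and [b] are bounds for the degrees, not the degrees themselves,
    so that no case distinction on vanishing leading coefficients is needed. *)
Lemma coefM_top (a b : nat) (f g : {poly K}) :
  (size f <= a.+1)%N -> (size g <= b.+1)%N -> (f * g)`_(a + b) = f`_a * g`_b.
Proof.
move=> fa gb; rewrite coefM.
have la : (a < (a + b).+1)%N by rewrite ltnS leq_addr.
rewrite (bigD1 (Ordinal la)) //= addKn big1 ?addr0// => i ia.
have : i != a :> nat by apply: contraNneq ia => ia; exact/eqP/val_inj.
rewrite neq_ltn => /orP[lia|lai]; last by rewrite nth_default ?mul0r// (leq_trans fa).
rewrite [g`__]nth_default ?mulr0// (leq_trans gb)//.
by have := ltn_ord i; lia.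
Qed.

Lemma size_sum_leq_bound (I : Type) (r : seq I) (Q : pred I) (F : I -> {poly K}) n :
  (forall i, Q i -> (size (F i) <= n)%N) -> (size (\sum_(i <- r | Q i) F i)%R <= n)%N.
Proof.
move=> Fn; apply: (big_ind (fun f : {poly K} => (size f <= n)%N)) => //.
- by rewrite size_poly0.
- by move=> f g fn gn; rewrite (leq_trans (size_polyD _ _))// geq_max fn.
Qed.

Lemma size_prod_bound (I : Type) (r : seq I) (F : I -> {poly K}) e :
  (forall i, (size (F i) <= e.+1)%N) ->
  (size (\prod_(i <- r) F i)%R <= (size r * e).+1)%N /\
  (\prod_(i <- r) F i)`_(size r * e) = \prod_(i <- r) (F i)`_e.
Proof.
move=> Fe; elim: r => [|i r [IH1 IH2]].
  by rewrite !big_nil /= size_poly1 coef1.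
rewrite !big_cons /= mulSn; split.
  rewrite (leq_trans (size_polyMleq _ _))// -subn1 leq_subLR add1n.
  by rewrite (leq_trans (leq_add (Fe i) IH1))// addSn addnS.
by rewrite coefM_top// IH2.
Qed.

Lemma size_signM (b : bool) n (f : {poly K}) :
  (size f <= n)%N -> (size ((-1) ^+ b * f)%R <= n)%N.
Proof. by case: b; rewrite ?mul1r// mulN1r size_polyN. Qed.

(** Both parts are read off the Leibniz formula. *)
Lemma det_poly_bound n (M : 'M[{poly K}]_n) e :
  (forall i j, (size (M i j) <= e.+1)%N) ->
  (size (\det M) <= (n * e).+1)%N /\
  (\det M)`_(n * e) = \det (map_mx (fun f : {poly K} => f`_e) M).
Proof.
move=> Me.
have Ms (s : 'S_n) := size_prod_bound (index_enum 'I_n) (fun i => Me i (s i)).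
have sz : size (index_enum 'I_n) = n by rewrite -sum1_size sum1_card card_ord.
rewrite sz in Ms; split.
  by apply: size_sum_leq_bound => s _; apply: size_signM; case: (Ms s).
rewrite coef_sum; apply: eq_bigr => s _.
have -> : \prod_i (map_mx (fun f : {poly K} => f`_e) M) i (s i) =
          (\prod_i M i (s i))`_(n * e).
  by rewrite (Ms s).2; apply: eq_bigr => i _; rewrite mxE.
by case: (odd_perm s); rewrite ?expr1 ?expr0 ?mul1r// !mulN1r coefN.
Qed.

Lemma size_adj_bound n (M : 'M[{poly K}]_n) e :
  (forall i j, (size (M i j) <= e.+1)%N) ->
  forall i j, (size (\adj M i j) <= (n.-1 * e).+1)%N.
Proof.
move=> Me i j; rewrite mxE /cofactor -signr_odd; apply: size_signM.
by apply: (proj1 (det_poly_bound _)) => i' j'; rewrite !mxE.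
Qed.
End TopCoefficients.

(** * Spectra of a complete set of solvents *)

Section DisjointFactors.
Variable T : eqType.

Lemma count_flattenE (I : finType) (t : I -> seq T) (x : T) :
  count_mem x (flatten [seq t k | k <- enum I]) = (\sum_k count_mem x (t k))%N.
Proof. by rewrite count_flatten sumnE !big_map -big_enum. Qed.

Lemma size_flattenE (I : finType) (t : I -> seq T) :
  size (flatten [seq t k | k <- enum I]) = (\sum_k size (t k))%N.
Proof. by rewrite size_flatten sumnE /shape !big_map -big_enum. Qed.

(** Multisets [t k] of total size [size s] that cover [s], each containing its
    elements with their multiplicity in [s], must be disjoint: a common element would
    be counted twice.

    It is applied to the roots [s] of [det A] and the eigenvalues [t k] of the
    solvents; regularity says that an eigenvalue of a solvent has the same
    multiplicity in both. *)
Lemma covering_factors_disjoint (I : finType) (s : seq T) (t w : I -> seq T) :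
  (forall k, perm_eq s (t k ++ w k)) ->
  (forall k x, x \in t k -> x \notin w k) ->
  (forall x, x \in s -> exists k, x \in t k) ->
  (\sum_k size (t k) = size s)%N ->
  forall j k x, x \in t j -> x \in t k -> j = k.
Proof.
move=> stw tw scov ssz j k x xj xk; apply: contrapT => /eqP jk.
pose fl := flatten [seq t k | k <- enum I].
have cnt y i : y \in t i -> count_mem y s = count_mem y (t i).
  move=> yi; rewrite (seq.permP (stw i)) count_cat [X in (_ + X)%N](count_memPn _) ?addn0//.
  exact: tw.
have le y : (count_mem y s <= count_mem y fl)%N.
  have [/scov[i yi]|/count_memPn ->//] := boolP (y \in s).
  by rewrite (cnt _ _ yi) count_flattenE (bigD1 i)//= leq_addr.
have [s' s'fl ss'] := (count_subseqP s fl).1 le.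
have sfl : s' = fl.
  apply/eqP; rewrite -(size_subseq_leqif s'fl).2 -(perm_size ss').
  by rewrite size_flattenE ssz.
have : count_mem x fl = count_mem x s by rewrite -sfl (seq.permP ss').
rewrite count_flattenE (bigD1 j)//= (bigD1 k) 1?eq_sym//= -(cnt _ _ xj) -(cnt _ _ xk).
have : (0 < count_mem x s)%N by rewrite (cnt _ _ xj) -has_count has_pred1.
by lia.
Qed.
End DisjointFactors.

(** * Expansion of the transfer function at infinity *)

Section ExpansionAtInfinity.
Variables (K : fieldType) (d p : nat) (A : nat -> 'M[K]_d).

Let A0 (k : nat) : 'M[K]_d := if k == 0%N then 1%:M else A k.
Let Am := monic_mxpoly p A.

Lemma monic_mxpoly_sum :
  Am = \sum_(0 <= k < p.+1) 'X^(p - k) *: map_mx polyC (A0 k).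
Proof.
rewrite /Am /monic_mxpoly [RHS]big_nat_recl//= subn0 /A0 eqxx map_mx1 scalemx1.
by rewrite big_add1.
Qed.

Lemma coef_monomial_mx a b (M : 'M[K]_(a, b)) e i j t :
  (('X^e *: map_mx polyC M) i j)`_t = (M i j) *+ (t == e).
Proof.
rewrite !mxE mulrC coefCM coefXn mulr_natr; by case: eqP.
Qed.

Lemma coef_sum_monomial_mx a b (C : nat -> 'M[K]_(a, b)) (f : nat -> nat) u v i j t :
  ((\sum_(u <= k < v) 'X^(f k) *: map_mx polyC (C k)) i j)`_t =
  \sum_(u <= k < v) (C k i j) *+ (t == f k).
Proof.
by rewrite summxE coef_sum; apply: eq_bigr => k _; rewrite coef_monomial_mx.
Qed.

Lemma sum_nat_pick (V : zmodType) (F : nat -> V) u v t :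
  \sum_(u <= k < v) F k *+ (k == t) = F t *+ (u <= t < v)%N.
Proof.
have [utv|utv] := boolP (u <= t < v)%N.
  rewrite (bigD1_seq t) ?iota_uniq ?mem_index_iota//= eqxx big1 ?addr0// => k kt.
  by rewrite (negPf kt).
rewrite big_nat_cond big1 ?mulr0n// => k /andP[kuv _].
by case: eqP => // kt; rewrite -kt kuv in utv.
Qed.

Lemma coef_monic_mxpoly i j t :
  (Am i j)`_t = A0 (p - t) i j *+ (t <= p)%N.
Proof.
rewrite monic_mxpoly_sum coef_sum_monomial_mx.
have [tp|pt] := leqP t p; last first.
  rewrite big_nat big1// => k /andP[_ kp].
  by case: eqP => // tk; move: pt; rewrite tk ltnNge leq_subr.
rewrite (eq_big_nat _ _ (F2 := fun k => A0 k i j *+ (k == p - t)%N)).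
  by rewrite sum_nat_pick ltnS leq_subr.
by move=> k /andP[_ kp]; congr (_ *+ _); congr nat_of_bool; apply/eqP/eqP; lia.
Qed.

Lemma size_monic_mxpoly i j : (size (Am i j) <= p.+1)%N.
Proof.
by apply/leq_sizeP => t pt; rewrite coef_monic_mxpoly leqNgt pt.
Qed.

Lemma det_monic_mxpoly : (size (\det Am) <= (d * p).+1)%N /\ (\det Am)`_(d * p) = 1.
Proof.
have [? ->] := det_poly_bound size_monic_mxpoly; split=> //.
rewrite -[RHS](det1 K d); congr (\det _); apply/matrixP => i j.
by rewrite [LHS]mxE coef_monic_mxpoly leqnn subnn.
Qed.

Lemma monic_det_monic_mxpoly : \det Am \is monic.
Proof.
have [sz c1] := det_monic_mxpoly; rewrite monicE /lead_coef.
suff -> : size (\det Am) = (d * p).+1 by rewrite c1.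
apply/eqP; rewrite eqn_leq sz ltnNge; apply/negP => sz'.
by move: c1; rewrite nth_default// => /esym/eqP; rewrite oner_eq0.
Qed.

Variables (m q : nat) (B : nat -> 'M[K]_(d, m)).
Hypothesis qp : (q < p)%N.
Let bet := beta p q A B.
Let Bm := mxpoly_of q B.

Let W : 'M[{poly K}]_(d, m) :=
  \sum_(1 <= j < p.+1) 'X^(p - j) *: map_mx polyC (bet j).
(** Polynomial part of ['X^i F] at infinity, where [F = A^-1 B = sum_j beta_j 'X^(- j)]. *)
Definition expansion_poly i : 'M[{poly K}]_(d, m) :=
  \sum_(1 <= j < i.+1) 'X^(i - j) *: map_mx polyC (bet j).
Let T' i : 'M[{poly K}]_(d, m) :=
  \sum_(i.+1 <= j < p.+1) 'X^(p - j) *: map_mx polyC (bet j).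

Let betaE n : (0 < n <= p)%N ->
  \sum_(0 <= i < n) A0 i *m bet (n - i) =
  if (n < p - q)%N then 0 else B (q - (p - n))%N.
Proof.
move=> /andP[n0 np]; rewrite big_ltn// subn0 [A0 0]/= mul1mx.
case: ifPn => [npq|].
  rewrite /bet beta_small// add0r big_nat big1// => i /andP[i1 _].
  by rewrite beta_small ?mulmx0//; lia.
rewrite -leqNgt => pqn.
have jq : (p - n <= q)%N by lia.
have npn : (p - (p - n) = n)%N by lia.
rewrite /bet -{1}npn beta_large// npn addrAC.
rewrite [X in _ + X + _](_ : _ = \sum_(1 <= i < n) A i *m beta p q A B (n - i)).
  by rewrite addNr add0r.
by apply: eq_big_nat => -[|i].
Qed.

Let D := 'X^p *: Bm - Am *m W.

Let mulmx_monomial (M : 'M[K]_d) (N : 'M[K]_(d, m)) a b :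
  ('X^a *: map_mx polyC M) *m ('X^b *: map_mx polyC N) =
  'X^(a + b) *: map_mx polyC (M *m N).
Proof. by rewrite -scalemxAl -scalemxAr scalerA exprD map_mxM. Qed.

Let coefAW i j t : (p <= t)%N -> ((Am *m W) i j)`_t = (('X^p *: Bm) i j)`_t.
Proof.
move=> pt; rewrite monic_mxpoly_sum mulmx_suml.
under eq_bigr => k _.
  rewrite mulmx_sumr.
  under eq_bigr => l _ do rewrite mulmx_monomial.
  over.
rewrite summxE coef_sum.
under eq_bigr => k _ do rewrite coef_sum_monomial_mx.
have -> : (('X^p *: Bm) i j)`_t =
   \sum_(0 <= k < q.+1) B k i j *+ (t == p + (q - k))%N.
  rewrite mxE coefXnM ltnNge pt /= /Bm /mxpoly_of coef_sum_monomial_mx.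
  by apply: eq_bigr => k _; congr (_ *+ _); congr nat_of_bool; apply/eqP/eqP; lia.
have [tp|tp] := leqP (p + p) t.
  rewrite !big_nat !big1// => k /andP[_ kp].
    by case: eqP => //; lia.
  by rewrite big_nat big1// => l /andP[l0 lp]; case: eqP => //; lia.
(* The coefficient of degree [t = p + (p - n)] is a convolution of length [n]. *)
pose n := (p + p - t)%N.
have n0p : (0 < n <= p)%N by rewrite /n; lia.
transitivity ((\sum_(0 <= k < n) A0 k *m bet (n - k)) i j).
  rewrite summxE (big_cat_nat (n := n))//=; last by lia.
  rewrite [X in _ + X]big_nat [X in _ + X]big1 ?addr0; last first.
    move=> k /andP[nk kp]; rewrite big_nat big1// => l /andP[l0 lp].
    by case: eqP => //; rewrite /n in nk; lia.
  apply: eq_big_nat => k /andP[_ kn].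
  rewrite (eq_big_nat _ _ (F2 := fun l => (A0 k *m bet l) i j *+ (l == n - k)%N)).
    rewrite (sum_nat_pick (fun l => (A0 k *m bet l) i j)).
    by have -> : (0 < n - k < p.+1)%N by lia.
  move=> l /andP[l0 lp]; congr (_ *+ _); congr nat_of_bool.
  by apply/eqP/eqP; rewrite /n in kn *; lia.
rewrite betaE//; case: ifPn => npq.
  rewrite mxE big_nat big1// => k /andP[_ kq]; case: eqP => //; rewrite /n in npq; lia.
rewrite (eq_big_nat _ _ (F2 := fun k => B k i j *+ (k == q - (p - n))%N)).
  rewrite (sum_nat_pick (fun k => B k i j)).
  by have -> : (0 <= q - (p - n) < q.+1)%N by lia.
move=> k /andP[_ kq]; congr (_ *+ _); congr nat_of_bool.
by apply/eqP/eqP; rewrite /n in npq *; lia.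
Qed.

Let sizeD i j : (size (D i j) <= p)%N.
Proof.
apply/leq_sizeP => t pt; rewrite /D mxE [X in _ + X]mxE coefD coefN.
by rewrite coefAW// subrr.
Qed.

(** [det A] times the proper part of ['X^i F]. *)
Definition expansion_rest i := 'X^i *: (\adj Am *m Bm) - \det Am *: expansion_poly i.

Let restE i : (i < p)%N ->
  'X^(p - i) *: expansion_rest i = \adj Am *m D + \det Am *: T' i.
Proof.
move=> ip.
have WE : W = 'X^(p - i) *: expansion_poly i + T' i.
  rewrite /W (big_cat_nat (n := i.+1))//=; last by lia.
  congr (_ + _); rewrite scaler_sumr; apply: eq_big_nat => j /andP[j1 ji].
  by rewrite scalerA -exprD; congr ('X^_ *: _); lia.
rewrite /D mulmxBr mulmxA mul_adj_mx mul_scalar_mx WE.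
rewrite /expansion_rest scalerBr scalerA -exprD subnK 1?ltnW// -scalemxAr.
rewrite [\det Am *: (_ + _)]scalerDr opprD !scalerA [_ * \det Am]mulrC.
by rewrite addrA subrK.
Qed.

(** Put [W = sum_j beta_j 'X^(p - j)]. The recursion for [beta] says that ['X^p B] and
    [A W] have the same coefficients from degree [p] on ([coefAW]). Multiplying by the
    adjugate, ['X^p adj(A) B] equals [det A W] up to degree less than [d p], and the
    coefficients of [W] can be read off the top degrees. *)
Lemma expansion_restP i a b : (i < p)%N ->
  (size (expansion_rest i a b) <= d * p)%N /\
  (expansion_rest i a b)`_(d * p).-1 = beta p q A B i.+1 a b.
Proof.
move=> ip.
have d0 : (0 < d)%N by case: (d) a => // -[].
have dp0 : (0 < d * p)%N by rewrite muln_gt0 d0 (leq_ltn_trans _ qp).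
have sT : (size (T' i a b) <= (p - i).-1.+1)%N.
  apply/leq_sizeP => t pt; rewrite /T' coef_sum_monomial_mx big_nat big1//.
  by move=> k /andP[ik kp]; case: eqP => //; lia.
have cT : (T' i a b)`_(p - i).-1 = bet i.+1 a b.
  rewrite /T' coef_sum_monomial_mx.
  rewrite (eq_big_nat _ _ (F2 := fun k => bet k a b *+ (k == i.+1)%N)).
    by rewrite (sum_nat_pick (fun k => bet k a b)) leqnn ltnS ip.
  by move=> k /andP[ik kp]; congr (_ *+ _); congr nat_of_bool; apply/eqP/eqP; lia.
have [szdet c1] := det_monic_mxpoly.
have sadj : (size ((\adj Am *m D) a b) <= d * p)%N.
  rewrite mxE; apply: size_sum_leq_bound => k _.
  rewrite (leq_trans (size_polyMleq _ _))//.
  have := leq_add (size_adj_bound size_monic_mxpoly a k) (sizeD k b).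
  have -> : ((d.-1 * p).+1 + p = (d * p).+1)%N.
    by rewrite addSn -mulSnr prednK.
  by case: (_ + _)%N.
have coefE t : (expansion_rest i a b)`_t =
    ((\adj Am *m D) a b)`_(t + (p - i)) + (\det Am * T' i a b)`_(t + (p - i)).
  transitivity (('X^(p - i) *: expansion_rest i) a b)`_(t + (p - i)).
    by rewrite [in RHS]mxE coefXnM ltnNge leq_addl /= addnK.
  by rewrite restE// mxE [X in _ + X]mxE coefD.
split.
  apply/leq_sizeP => t pt; rewrite coefE !nth_default ?addr0//.
    rewrite (leq_trans (size_polyMleq _ _))// -subn1 leq_subLR add1n.
    by rewrite (leq_trans (leq_add szdet sT))//; lia.
  by rewrite (leq_trans sadj)// (leq_trans pt)// leq_addr.
rewrite coefE nth_default ?add0r; last by rewrite (leq_trans sadj)//; lia.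
have -> : ((d * p).-1 + (p - i) = d * p + (p - i).-1)%N by lia.
by rewrite coefM_top// c1 mul1r.
Qed.
End ExpansionAtInfinity.

(** * Contour integrals of fractions *)

Section ContourFunctional.
Variable R : realType.
Local Notation C := R[i].
Implicit Types (z w a : C) (N : {poly C}) (s : seq C).

(** The seq [s] lists the poles with multiplicity. *)
Definition contour_functional (g : R -> C) N s : C :=
  (two_pi_i R)^-1 * contour_integral g (fun z => N.[z] / (\prod_(a <- s) ('X - a%:P)).[z]).

Section OneContour.
Variable g : R -> C.
Hypothesis g_pw : piecewise_C1 g.
Hypothesis g01 : g 0 = g 1.
Let img := contour_image g.
Variable D : {pred C}.
Hypothesis Dimg : forall a, a \in D -> ~ img a.

Lemma horner_prod_neq0 s z : {subset s <= D} -> img z ->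
  (\prod_(a <- s) ('X - a%:P)).[z] != 0.
Proof.
move=> sD zg; rewrite -[_ == 0]/(root _ z) root_prod_XsubC.
by apply/negP => /sD /Dimg; apply.
Qed.

Lemma continuous_at_fraction N s z : {subset s <= D} -> img z ->
  path_continuous_at (fun z => N.[z] / (\prod_(a <- s) ('X - a%:P)).[z]) z.
Proof.
move=> sD zg; apply: continuous_atM; first exact: continuous_at_horner.
by apply: continuous_atV; [exact: horner_prod_neq0|exact: continuous_at_horner].
Qed.

Lemma contour_functionalL c N1 N2 s : {subset s <= D} ->
  contour_functional g (c *: N1 + N2) s =
  c * contour_functional g N1 s + contour_functional g N2 s.
Proof.
move=> sD; have cf N z := @continuous_at_fraction N s z sD.
pose F N z := N.[z] / (\prod_(a <- s) ('X - a%:P)).[z].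
rewrite /contour_functional -/(F N1) -/(F N2) [RHS](_ : _ =
  (two_pi_i R)^-1 * (c * contour_integral g (F N1) + contour_integral g (F N2))); last first.
  by rewrite mulrDr mulrCA.
congr (_ * _); rewrite -contour_integralZ//; last by move=> z; exact: cf.
rewrite -contour_integralD//; last 2 first.
- by move=> z zg; apply: continuous_atM; [exact: continuous_at_cst|exact: cf].
- by move=> z; exact: cf.
by apply: eq_contour_integral => z _; rewrite /F hornerD hornerZ mulrDl mulrA.
Qed.

Lemma contour_functionalM N a s : a \in D -> {subset s <= D} ->
  contour_functional g (N * ('X - a%:P)) (a :: s) = contour_functional g N s.
Proof.
move=> aD sD; congr (_ * _); apply: eq_contour_integral => z zg.
rewrite big_cons !hornerM invfM mulrA mulfK//.
rewrite -[_ == 0]/(root _ z) root_XsubC.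
by apply: contra_notN (Dimg aD) => /eqP <-.
Qed.

Lemma contour_functionalP N s1 s2 : {subset s1 <= D} -> perm_eq s1 s2 ->
  contour_functional g N s1 = contour_functional g N s2.
Proof. by move=> _ s12; rewrite /contour_functional (perm_big _ s12). Qed.

Lemma contour_functional_inv s :
  contour_functional g 1 s =
  (two_pi_i R)^-1 * contour_integral g (fun z => \prod_(a <- s) (z - a)^-1).
Proof.
congr (_ * _); apply: eq_contour_integral => z zg.
rewrite hornerE mul1r horner_prod -prodfV.
by apply: eq_bigr => a _; rewrite hornerXsubC.
Qed.

Lemma contour_functional_high a n : a \in D ->
  contour_functional g 1 (nseq n.+2 a) = 0.
Proof.
move=> aD; rewrite contour_functional_inv.
rewrite (@eq_contour_integral _ g _ (fun z => (z - a)^-1 ^+ n.+2)); last first.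
  by move=> z _; rewrite big_nseq -Monoid.iteropE.
by rewrite contour_integral_inv_pow// ?mulr0//; exact: Dimg.
Qed.

Lemma contour_functional_simple a :
  contour_functional g 1 [:: a] = winding_number g a.
Proof.
rewrite contour_functional_inv; congr (_ * _); apply: eq_contour_integral => z _.
by rewrite big_seq1.
Qed.

Lemma contour_functional_poly N s : {subset s <= D} ->
  contour_functional g (N * \prod_(a <- s) ('X - a%:P)) s = 0.
Proof.
move=> sD; rewrite /contour_functional (@eq_contour_integral _ g _ (fun z => N.[z])).
  by rewrite contour_integral_poly ?mulr0.
by move=> z zg; rewrite hornerM mulfK// horner_prod_neq0.
Qed.
End OneContour.

(** After division by the denominator only a proper fraction remains, to which the
    algebraic residue theorem applies with [c = 0]. *)
Lemma contour_functional_exterior g N s : piecewise_C1 g -> g 0 = g 1 ->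
  (forall a, a \in s -> contour_exterior g a) -> contour_functional g N s = 0.
Proof.
move=> g_pw g01 ext.
have Dimg a : a \in mem s -> ~ contour_image g a by move=> /ext[].
have ss : {subset s <= mem s} by [].
pose M := \prod_(a <- s) ('X - a%:P).
have M0 : M != 0 by apply: monic_neq0; exact: monic_prod_XsubC.
rewrite (divp_eq N M) -[_ * _]scale1r (contour_functionalL g_pw Dimg)//.
rewrite (contour_functional_poly g_pw g01 Dimg)// mulr0 add0r.
rewrite (@residue_functional_coef _ (mem s) (contour_functional g) 0)// ?mul0r//.
- exact: contour_functionalL.
- exact: contour_functionalM.
- exact: contour_functionalP.
- exact: contour_functional_high.
- move=> a aD; rewrite contour_functional_simple /winding_number.
  by rewrite winding_exterior ?mulr0//; exact: ext.
- have := ltn_modp N M; rewrite M0 /M size_prod_XsubC => h.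
  by rewrite -ltnS h.
Qed.

(** Only the sum of the winding numbers matters; the individual contours may well
    surround different sets of poles. *)
Lemma sum_contour_functional (I : finType) (g : I -> R -> C) N s :
  (forall k, piecewise_C1 (g k)) -> (forall k, g k 0 = g k 1) ->
  (forall k a, a \in s -> ~ contour_image (g k) a) ->
  (forall a, a \in s -> \sum_k winding_number (g k) a = 1) ->
  (size N <= size s)%N ->
  \sum_k contour_functional (g k) N s = N`_(size s).-1.
Proof.
move=> g_pw g01 Dimg wind Ns.
rewrite -[RHS]mul1r.
apply: (@residue_functional_coef _ (mem s) (fun N s => \sum_k contour_functional (g k) N s)) => //.
- move=> c N1 N2 s' sD; rewrite mulr_sumr -big_split; apply: eq_bigr => k _ /=.
  exact: (contour_functionalL (g_pw k) (Dimg k)).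
- move=> N' a s' aD sD; apply: eq_bigr => k _.
  exact: (contour_functionalM (Dimg k)).
- move=> N' s1 s2 sD s12; apply: eq_bigr => k _.
  exact: (contour_functionalP _ _ sD).
- move=> a n aD; apply: big1 => k _.
  exact: (contour_functional_high (g_pw k) (g01 k) (Dimg k)).
- move=> a aD; rewrite -(wind a aD); apply: eq_bigr => k _.
  exact: contour_functional_simple.
Qed.
End ContourFunctional.

(** * Moments of the solvent residues *)

Section SolventResidues.
Variable R : realType.
Local Notation C := R[i].

Lemma mxpoly_evalM (a b c : nat) (P : 'M[{poly C}]_(a, b)) (Q : 'M[{poly C}]_(b, c)) z :
  mxpoly_eval (P *m Q) z = mxpoly_eval P z *m mxpoly_eval Q z.
Proof. exact: (map_mxM (horner_eval z)). Qed.

Lemma det_mxpoly_eval (d : nat) (P : 'M[{poly C}]_d) z :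
  \det (mxpoly_eval P z) = (\det P).[z].
Proof. exact: (det_map_mx (horner_eval z)). Qed.

Lemma mxpoly_spectrumE (d : nat) (P : 'M[{poly C}]_d) z :
  mxpoly_spectrum P z <-> root (\det P) z.
Proof. by rewrite /mxpoly_spectrum /= det_mxpoly_eval; split; [move=> /eqP|move=> /eqP]. Qed.

Lemma invmx_mxpoly_eval (d m : nat) (P : 'M[{poly C}]_d) (Q : 'M[{poly C}]_(d, m)) z i j :
  (\det P).[z] != 0 ->
  (invmx (mxpoly_eval P z) *m mxpoly_eval Q z) i j =
  ((\adj P *m Q) i j).[z] / (\det P).[z].
Proof.
move=> Pz; have u : mxpoly_eval P z \in unitmx.
  by rewrite unitmxE det_mxpoly_eval unitfE.
have adjE : \adj (mxpoly_eval P z) = mxpoly_eval (\adj P) z.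
  by rewrite -(map_mx_adj (horner_eval z)).
rewrite /invmx u -scalemxAl det_mxpoly_eval adjE -mxpoly_evalM.
by rewrite !mxE mulrC.
Qed.

Lemma monic_prod_roots (f : {poly C}) : f \is monic ->
  {s : seq C | f = \prod_(a <- s) ('X - a%:P)}.
Proof.
move=> /monicP fm; have [s fs] := closed_field_poly_normal f.
by exists s; rewrite [LHS]fs fm scale1r.
Qed.

Variables (d m p q : nat) (A : nat -> 'M[C]_d) (B : nat -> 'M[C]_(d, m)).
Hypothesis qp : (q < p)%N.
Variable S : 'I_p -> 'M[C]_d.
Hypothesis regS : forall k, regular_right_solvent p A (S k).
Hypothesis complS : complete_solvents A S.
Variable Res : 'I_p -> 'M[C]_(d, m).
Hypothesis resS : forall k, is_residue (monic_mxpoly p A) (mxpoly_of q B) (S k) (Res k).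

Let Am := monic_mxpoly p A.
Let Bm := mxpoly_of q B.
Let G := \adj Am *m Bm.

(** The linear factor of the solvent cancels the part of [det A] that vanishes on its
    spectrum. In terms of [F] this says that [(z - T) F(z) = A1(z)^-1 B(z)], which has no
    pole at the eigenvalues of [T] if [T] is regular. *)
Lemma solvent_adjugate (T : 'M[C]_d) (A1 : nat -> 'M[C]_d) :
  Am = monic_mxpoly p.-1 A1 *m ('X%:M - map_mx polyC T) ->
  ('X%:M - map_mx polyC T) *m \adj Am = char_poly T *: \adj (monic_mxpoly p.-1 A1).
Proof.
set A1m := monic_mxpoly _ _ => AE.
have d0 : \det A1m != 0 by apply: monic_neq0; exact: monic_det_monic_mxpoly.
have detE : \det Am = \det A1m * char_poly T by rewrite AE det_mulmx.
have := mul_mx_adj Am; rewrite {1}AE -mulmxA => /(congr1 (mulmx (\adj A1m))).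
rewrite [\adj A1m *m (A1m *m _)]mulmxA mul_adj_mx mul_scalar_mx scalar_mxC.
rewrite mul_scalar_mx detE -scalerA => /matrixP h.
apply/matrixP => i j; apply: (mulfI d0).
by have := h i j; rewrite [LHS]mxE [RHS]mxE.
Qed.

(** Multiplying a residue by its solvent amounts to multiplying the integrand by [z],
    because the difference has all its poles outside the contour. Hence the sum on
    the left is the sum over [k] of the integrals of [z^i F(z) / (2 pi i)]. Every pole of [F]
    is surrounded by exactly one contour, so this is the coefficient of [1 / z] of
    [z^i F(z)] at infinity. *)
Theorem solvent_residue_sum (i : nat) : (i < p)%N ->
  \sum_k (S k ^+ i *m Res k) = beta p q A B i.+1.
Proof.
move=> ip.
have p0 : (0 < p)%N by exact: leq_ltn_trans qp.
have [s sE] := monic_prod_roots (monic_det_monic_mxpoly p A).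
rewrite -/Am in sE.
have sz_s : size s = (d * p)%N.
  have [sz1 c1] := det_monic_mxpoly p A.
  have szs : size (\det Am) = (size s).+1 by rewrite sE size_prod_XsubC.
  apply/eqP; rewrite eqn_leq -ltnS -szs sz1 /= leqNgt; apply/negP => lt.
  by move: c1; rewrite nth_default ?szs// => /esym/eqP; rewrite oner_eq0.
have /choice[A1 A1P] : forall k, exists A1 : nat -> 'M[C]_d,
    Am = monic_mxpoly p.-1 A1 *m ('X%:M - map_mx polyC (S k)) /\
    mx_spectrum (S k) `&` mxpoly_spectrum (monic_mxpoly p.-1 A1) = set0.
  by move=> k; case: (regS k).
(* [s], [t k] and [w k] list the roots of [det A], of the characteristic polynomial
   of [S k] and of the determinant of its cofactor, so that [s] is the union of the
   last two for every [k]. *)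
pose t k := sval (monic_prod_roots (char_poly_monic (S k))).
have tE k : char_poly (S k) = \prod_(a <- t k) ('X - a%:P).
  exact: (svalP (monic_prod_roots (char_poly_monic (S k)))).
pose w k := sval (monic_prod_roots (monic_det_monic_mxpoly p.-1 (A1 k))).
have wE k : \det (monic_mxpoly p.-1 (A1 k)) = \prod_(a <- w k) ('X - a%:P).
  exact: (svalP (monic_prod_roots (monic_det_monic_mxpoly p.-1 (A1 k)))).
have t_spec k a : (a \in t k) = eigenvalue (S k) a.
  by rewrite eigenvalue_root_char tE root_prod_XsubC.
have s_spec a : a \in s <-> mxpoly_spectrum Am a.
  by rewrite mxpoly_spectrumE sE root_prod_XsubC.
have stw k : perm_eq s (t k ++ w k).
  apply: prod_XsubC_eq; rewrite big_cat -tE -wE -sE /= (A1P k).1 det_mulmx mulrC.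
  by [].
have tw k a : a \in t k -> a \notin w k.
  rewrite t_spec => ak; apply/negP => aw.
  have : (mx_spectrum (S k) `&` mxpoly_spectrum (monic_mxpoly p.-1 (A1 k))) a.
    split => //; apply/mxpoly_spectrumE.
    by rewrite wE root_prod_XsubC.
  by rewrite (A1P k).2.
have cov a : a \in s -> exists k, a \in t k.
  move=> /s_spec; rewrite complS => -[k _ ak]; exists k.
  by rewrite t_spec.
have sz_t k : size (t k) = d.
  by have := size_char_poly (S k); rewrite tE size_prod_XsubC => -[].
have sum_t : (\sum_k size (t k) = size s)%N.
  rewrite (eq_bigr (fun=> d)) ?sum_nat_const ?card_ord ?sz_s 1?mulnC//.
have disj := covering_factors_disjoint stw tw cov sum_t.
have /choice[g gP] := resS.
have g_pw k : piecewise_C1 (g k) by have [[]] := gP k.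
have g01 k : g k 0 = g k 1 by have [[]] := gP k.
have int_t k a : a \in t k -> contour_interior (g k) a.
  by rewrite t_spec => ak; have [_ _ + _ _] := gP k; apply.
have ext_t k a : a \in s -> a \notin t k -> contour_exterior (g k) a.
  move=> /s_spec sa; rewrite t_spec => /negP ak.
  by have [_ _ _ + _] := gP k; apply.
have simg k a : a \in s -> ~ contour_image (g k) a.
  by move=> sa; have [/int_t[]|/(ext_t _ _ sa)[]] := boolP (a \in t k).
(* By disjointness a root lies inside its own contour and outside all others. *)
have wind a : a \in s -> \sum_k winding_number (g k) a = 1.
  move=> sa; have [k ak] := cov a sa.
  rewrite (bigD1 k)//= [X in _ + X]big1 ?addr0.
    by have [_ + _ _ _] := gP k; apply; exact: int_t.
  move=> j jk; rewrite /winding_number winding_exterior ?mulr0//.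
  apply: ext_t => //; apply/negP => aj.
  by move: jk; rewrite (disj j k a aj ak) eqxx.
pose Phi k N := contour_functional (g k) N s.
have PhiL k c (N1 N2 : {poly C}) : Phi k (c *: N1 + N2) = c * Phi k N1 + Phi k N2.
  by apply: (contour_functionalL (g_pw k) (D := mem s)) => //; exact: simg.
have Phi0 k : Phi k 0 = 0.
  have := PhiL k 1 0 0; rewrite scaler0 addr0 mul1r => h.
  by apply: (@addrI _ (Phi k 0)); rewrite addr0.
have Phi_sum k (J : finType) (c : J -> C) (N : J -> {poly C}) :
    Phi k (\sum_l c l *: N l) = \sum_l c l * Phi k (N l).
  apply: (big_rec2 (fun (x : {poly C}) y => Phi k x = y)) => [|l y x _ <-].
    exact: Phi0.
  exact: PhiL.
have PhiB k N1 N2 : Phi k N1 - Phi k N2 = Phi k (N1 - N2).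
  have := PhiL k (-1) N2 N1; rewrite scaleN1r mulN1r [- N2 + _]addrC => ->.
  by rewrite addrC.
have PhiN k N : Phi k (- N) = - Phi k N.
  by have := PhiB k 0 N; rewrite sub0r Phi0 sub0r.
have PhiD k N1 N2 : Phi k (N1 + N2) = Phi k N1 + Phi k N2.
  by have := PhiL k 1 N1 N2; rewrite scale1r mul1r.
(* The integral of [z^n F(z)] over the [k]-th contour, divided by [2 pi i]. *)
pose I k n := \matrix_(a, b) Phi k ('X^n * G a b).
have detN0 k z : contour_image (g k) z -> (\det Am).[z] != 0.
  move=> zg; rewrite -[_ == 0]/(root _ z) sE root_prod_XsubC.
  by apply/negP => /(simg k).
have Res0 k : Res k = I k 0%N.
  have [_ _ _ _ ->] := gP k; apply/matrixP => a b; rewrite [LHS]mxE [RHS]mxE; congr (_ * _).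
  apply: eq_contour_integral => z zg.
  by rewrite invmx_mxpoly_eval ?(detN0 k)// expr0 mul1r -sE.
(* [(S_k - z) z^n F(z)] is a fraction with poles [w k], all of them exterior. *)
have Sres k n : S k *m I k n = I k n.+1.
  apply/matrixP => a b; rewrite [LHS]mxE [RHS]mxE.
  under eq_bigr => c _ do rewrite [I k n c b]mxE.
  rewrite -Phi_sum; apply/eqP; rewrite -subr_eq0 PhiB; apply/eqP.
  pose H := \adj (monic_mxpoly p.-1 (A1 k)) *m Bm.
  have -> : \sum_l (S k a l) *: ('X^n * G l b) - 'X^(n.+1) * G a b =
            - ('X^n * H a b * char_poly (S k)).
    have E0 : 'X * G a b - \sum_l (S k a l)%:P * G l b = char_poly (S k) * H a b.
      transitivity ((('X%:M - map_mx polyC (S k)) *m G) a b).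
        rewrite mulmxBl mul_scalar_mx [RHS]mxE [in RHS]mxE; congr (_ + _).
        rewrite [RHS]mxE [in RHS]mxE; congr (- _).
        by apply: eq_bigr => l _; congr (_ * _); rewrite mxE.
      by rewrite /G mulmxA (solvent_adjugate (A1P k).1) -scalemxAl mxE.
    rewrite -mulrA [H a b * _]mulrC -E0 mulrBr opprB mulrA -exprSr; congr (_ - _).
    rewrite mulr_sumr; apply: eq_bigr => l _.
    by rewrite mulrCA mul_polyC.
  rewrite PhiN; apply/eqP; rewrite oppr_eq0; apply/eqP.
  have -> : Phi k ('X^n * H a b * char_poly (S k)) =
            contour_functional (g k) ('X^n * H a b) (w k).
    rewrite /Phi /contour_functional; congr (_ * _).
    apply: eq_contour_integral => z zg.
    have := detN0 k z zg.
    rewrite -sE -wE (A1P k).1 det_mulmx -[\det ('X%:M - _)]/(char_poly (S k)).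
    rewrite !hornerM mulf_eq0 negb_or => /andP[z1 z2].
    by field; rewrite z1 z2.
  apply: contour_functional_exterior => // c cw.
  apply: ext_t; first by rewrite (perm_mem (stw k)) mem_cat cw orbT.
  by apply/negP => /tw; rewrite cw.
have SI k n : S k ^+ n *m Res k = I k n.
  elim: n => [|n IH]; first by rewrite expr0 mul1mx.
  by rewrite exprS -mulmxA IH Sres.
apply/matrixP => a b; rewrite summxE.
under eq_bigr => k _ do rewrite SI mxE.
have [szQ cQ] := expansion_restP A B qp a b ip.
have -> : 'X^i * G a b =
   expansion_poly p A q B i a b * \det Am + expansion_rest p A q B i a b.
  have -> : expansion_rest p A q B i a b = 'X^i * G a b - \det Am * expansion_poly p A q B i a b.
    by rewrite /expansion_rest mxE [X in X + _]mxE [X in _ + X]mxE [X in - X]mxE.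
  by rewrite [_ * \det Am]mulrC addrC subrK.
under eq_bigr => k _.
  rewrite PhiD {1}/Phi {1}sE.
  rewrite (contour_functional_poly (g_pw k) (g01 k) (D := mem s) (simg k))// add0r.
  over.
rewrite /= (sum_contour_functional g_pw g01 simg wind); last by rewrite sz_s.
by rewrite sz_s cQ.
Qed.
End SolventResidues.

(** * Matrix exponentials *)

Section MatrixExponential.
Variable R : realType.
Local Notation C := R[i].
Local Notation Re := complex.Re.
Local Notation Im := complex.Im.
Local Notation normc := Normc.normc.

Lemma cvg_sum (T : Type) (F : set_system T) {FF : Filter F} (I : finType)
    (u : I -> T -> R) (l : I -> R) :
  (forall i, u i x @[x --> F] --> l i) -> \sum_i u i x @[x --> F] --> \sum_i l i.
Proof.
move=> ul; elim: (index_enum I) => [|i s IH].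
  rewrite big_nil (_ : (fun x => _) = fun=> 0); first exact: cvg_cst.
  by apply/funext => x; rewrite big_nil.
rewrite big_cons (_ : (fun x => _) = fun x => u i x + \sum_(j <- s) u j x).
  exact: cvgD.
by apply/funext => x; rewrite big_cons.
Qed.

(** Stated for an abstract absolute value, to serve real and complex matrices. *)
Lemma mx_power_bound (K : comPzRingType) (nu : K -> R) (a n : nat)
    (P : 'M[K]_(a, n)) (M : 'M[K]_n) :
  (forall x, 0 <= nu x) -> nu 0 = 0 ->
  (forall x y, nu (x + y) <= nu x + nu y) -> (forall x y, nu (x * y) = nu x * nu y) ->
  exists c, exists2 r, 0 <= c /\ 0 <= r &
    forall k i j, nu ((P *m M ^+ k) i j) <= c * r ^+ k.
Proof.
move=> nu_ge0 nu0 nuD nuM.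
have nu_sum (I : finType) (F : I -> K) : nu (\sum_i F i) <= \sum_i nu (F i).
  elim/big_rec2: _ => [|i y x _ IH]; first by rewrite nu0.
  by rewrite (le_trans (nuD _ _))// lerD2l.
have part (I : finType) (F : I -> R) i : (forall i, 0 <= F i) -> F i <= \sum_i F i.
  by move=> F0; rewrite (bigD1 i)//= lerDl sumr_ge0.
pose r := \sum_j \sum_l nu (M l j); pose c := \sum_i \sum_j nu (P i j).
have r0 : 0 <= r by rewrite sumr_ge0// => j _; rewrite sumr_ge0.
have c0 : 0 <= c by rewrite sumr_ge0// => j _; rewrite sumr_ge0.
exists c; exists r => // k; elim: k => [|k IH] i j.
  rewrite !expr0 mulr1 mulmx1.
  rewrite (le_trans (part _ (fun j => nu (P i j)) j _))//.
  by apply: (part _ (fun i => \sum_j nu (P i j)) i) => l; rewrite sumr_ge0.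
rewrite !exprSr mulmxA mxE (le_trans (nu_sum _ _))//.
rewrite (@le_trans _ _ (\sum_l (c * r ^+ k) * nu (M l j)))//.
  by apply: ler_sum => l _; rewrite nuM ler_wpM2r.
rewrite -mulr_sumr mulrA ler_wpM2l ?mulr_ge0 ?exprn_ge0//.
by apply: (part _ (fun j => \sum_l nu (M l j)) j) => l; rewrite sumr_ge0.
Qed.

Lemma exp_series_cvg (u : nat -> R) (c r : R) :
  (forall k, `|u k| <= c * r ^+ k) ->
  cvgn (fun n : nat => \sum_(0 <= k < n) u k / k`!%:R).
Proof.
move=> uk; apply: (@normed_cvg _ R^o (fun k => u k / k`!%:R)).
apply: (@series_le_cvg _ _ (fun k => c * exp_coeff r k)) => [k|k|k|].
- exact: normr_ge0.
- rewrite mulrA mulr_ge0 ?invr_ge0 ?ler0n//.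
  exact: le_trans (uk k).
- rewrite /= normrM [`|_^-1|]ger0_norm ?invr_ge0 ?ler0n// mulrA.
  by rewrite ler_wpM2r// invr_ge0 ler0n.
- have := is_cvg_seriesZ (k := c) (@is_cvg_series_exp_coeff R r).
  by congr (cvgn (series _)); apply/funext => k.
Qed.

Definition mexp_partial (K : unitRingType) (n : nat) (M : 'M[K]_n) (N : nat) : 'M[K]_n :=
  \sum_(k < N) (k`!%:R)^-1 *: M ^+ k.

(** Convergence of real and imaginary parts of all entries, the mode of convergence in
    which [mexp] is defined. *)
Definition entrywise_cvg (a b : nat) (u : nat -> 'M[C]_(a, b)) (L : 'M[C]_(a, b)) :=
  forall i j, (Re (u N i j) @[N --> \oo] --> Re (L i j)) /\
              (Im (u N i j) @[N --> \oo] --> Im (L i j)).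

Lemma factC (k : nat) : (k`!%:R : C)^-1 = ((k`!%:R)^-1)%:C.
Proof. by rewrite fmorphV rmorph_nat. Qed.

Lemma Re_realM (x : R) (z : C) : Re (x%:C * z) = x * Re z.
Proof. by rewrite ReM /= mul0r subr0. Qed.

Lemma Im_realM (x : R) (z : C) : Im (x%:C * z) = x * Im z.
Proof. by rewrite ImM /= mul0r addr0. Qed.

Lemma Re_sum (I : Type) (s : seq I) (Q : pred I) (F : I -> C) :
  Re (\sum_(i <- s | Q i) F i) = \sum_(i <- s | Q i) Re (F i).
Proof. by elim/big_rec2: _ => // i y x _ <-; rewrite ReD. Qed.

Lemma Im_sum (I : Type) (s : seq I) (Q : pred I) (F : I -> C) :
  Im (\sum_(i <- s | Q i) F i) = \sum_(i <- s | Q i) Im (F i).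
Proof. by elim/big_rec2: _ => // i y x _ <-; rewrite ImD. Qed.

Lemma mexp_cvg (n : nat) (M : 'M[C]_n) : entrywise_cvg (mexp_partial M) (mexp M).
Proof.
have nuD (x y : C) : normc (x + y) <= normc x + normc y by exact: le_normcD.
have [c [r _ bound]] := mx_power_bound 1%:M M (@normc_ge0 R) (Normc.normc0 R) nuD (@Normc.normcM R).
move=> i j; rewrite mxE /clim /=.
have mono k : normc ((M ^+ k) i j) <= c * r ^+ k by have := bound k i j; rewrite mul1mx.
split.
  rewrite (_ : (fun N => _) = fun N => \sum_(0 <= k < N) Re ((M ^+ k) i j) / k`!%:R).
    apply: exp_series_cvg => k; exact: le_trans (normc_Re _) (mono k).
  apply/funext => N; rewrite summxE Re_sum big_mkord; apply: eq_bigr => k _.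
  by rewrite mxE factC Re_realM mulrC.
rewrite (_ : (fun N => _) = fun N => \sum_(0 <= k < N) Im ((M ^+ k) i j) / k`!%:R).
  apply: exp_series_cvg => k; exact: le_trans (normc_Im _) (mono k).
apply/funext => N; rewrite summxE Im_sum big_mkord; apply: eq_bigr => k _.
by rewrite mxE factC Im_realM mulrC.
Qed.

Lemma entrywise_cvgMl (a b c : nat) (P : 'M[C]_(a, b)) (u : nat -> 'M[C]_(b, c)) L :
  entrywise_cvg u L -> entrywise_cvg (fun N => P *m u N) (P *m L).
Proof.
move=> uL i j; split.
  rewrite (_ : (fun N => _) = fun N => \sum_l (Re (P i l) * Re (u N l j) - Im (P i l) * Im (u N l j))).
    rewrite mxE Re_sum; apply: cvg_sum => l; rewrite ReM.
    by have [ur ui] := uL l j; apply: cvgB; apply: cvgM => //; exact: cvg_cst.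
  by apply/funext => N; rewrite mxE Re_sum; apply: eq_bigr => l _; rewrite ReM.
rewrite (_ : (fun N => _) = fun N => \sum_l (Re (P i l) * Im (u N l j) + Im (P i l) * Re (u N l j))).
  rewrite mxE Im_sum; apply: cvg_sum => l; rewrite ImM.
  by have [ur ui] := uL l j; apply: cvgD; apply: cvgM => //; exact: cvg_cst.
by apply/funext => N; rewrite mxE Im_sum; apply: eq_bigr => l _; rewrite ImM.
Qed.

Lemma entrywise_cvgMr (a b c : nat) (u : nat -> 'M[C]_(a, b)) L (P : 'M[C]_(b, c)) :
  entrywise_cvg u L -> entrywise_cvg (fun N => u N *m P) (L *m P).
Proof.
move=> uL i j; split.
  rewrite (_ : (fun N => _) = fun N => \sum_l (Re (u N i l) * Re (P l j) - Im (u N i l) * Im (P l j))).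
    rewrite mxE Re_sum; apply: cvg_sum => l; rewrite ReM.
    by have [ur ui] := uL i l; apply: cvgB; apply: cvgM => //; exact: cvg_cst.
  by apply/funext => N; rewrite mxE Re_sum; apply: eq_bigr => l _; rewrite ReM.
rewrite (_ : (fun N => _) = fun N => \sum_l (Re (u N i l) * Im (P l j) + Im (u N i l) * Re (P l j))).
  rewrite mxE Im_sum; apply: cvg_sum => l; rewrite ImM.
  by have [ur ui] := uL i l; apply: cvgD; apply: cvgM => //; exact: cvg_cst.
by apply/funext => N; rewrite mxE Im_sum; apply: eq_bigr => l _; rewrite ImM.
Qed.

Lemma entrywise_cvg_unique (a b : nat) (u : nat -> 'M[C]_(a, b)) L L' :
  entrywise_cvg u L -> entrywise_cvg u L' -> L = L'.
Proof.
move=> uL uL'; apply/matrixP => i j; have [r1 i1] := uL i j; have [r2 i2] := uL' i j.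
by apply: complex_ext; [apply: cvg_unique r1 r2|apply: cvg_unique i1 i2].
Qed.

(** The relation passes to powers, to partial sums and to the limit. The matrices may
    have different sizes: it is used with [V] the block column of powers of a solvent. *)
Lemma mexp_intertwine (a b : nat) (M : 'M[C]_a) (N : 'M[C]_b) (V : 'M[C]_(a, b)) :
  M *m V = V *m N -> mexp M *m V = V *m mexp N.
Proof.
move=> MV; apply: (@entrywise_cvg_unique _ _ (fun n => mexp_partial M n *m V)).
  by apply: entrywise_cvgMr; exact: mexp_cvg.
have -> : (fun n => mexp_partial M n *m V) = (fun n => V *m mexp_partial N n).
  apply/funext => n; rewrite mulmx_suml mulmx_sumr; apply: eq_bigr => k _.
  rewrite -scalemxAl -scalemxAr; congr (_ *: _).
  elim: (k : nat) => [|l IH]; first by rewrite !expr0 mul1mx mulmx1.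
  by rewrite exprSr -mulmxA MV mulmxA IH -mulmxA [in RHS]exprSr.
by apply: entrywise_cvgMl; exact: mexp_cvg.
Qed.
End MatrixExponential.

Section RealExponential.
Variable R : realType.
Local Notation C := R[i].

Definition exp_coef (a n : nat) (P : 'M[R]_(a, n)) (M : 'M[R]_n) (i : 'I_a) (j : 'I_n) : nat -> R :=
  fun k => (P *m M ^+ k) i j / k`!%:R.

(** Entries are values of power series in [t], so that they can be differentiated term
    by term. *)
Definition rexp (n : nat) (M : 'M[R]_n) (t : R) : 'M[R]_n :=
  \matrix_(i, j) limn (pseries (exp_coef 1%:M M i j) t).

Lemma exp_coef_cvg (a n : nat) (P : 'M[R]_(a, n)) (M : 'M[R]_n) i j t :
  cvgn (pseries (exp_coef P M i j) t).
Proof.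
have [c [r [c0 r0] bound]] := mx_power_bound P M (@normr_ge0 _ R) (normr0 R) (@ler_normD _ R) (@normrM R).
have := @exp_series_cvg R (fun k => (P *m M ^+ k) i j * t ^+ k) c (r * `|t|).
rewrite (_ : (fun n => _) = pseries (exp_coef P M i j) t).
  apply => k; rewrite normrM normrX exprMn mulrA ler_wpM2r ?exprn_ge0//.
apply/funext => N; rewrite /pseries /series /=; apply: eq_bigr => k _.
by rewrite /exp_coef mulrAC.
Qed.

Lemma pseries_exp_coef (a n : nat) (P : 'M[R]_(a, n)) (M : 'M[R]_n) i j t :
  pseries (exp_coef P M i j) t @ \oo --> (P *m rexp M t) i j.
Proof.
rewrite (_ : pseries _ _ = fun N => \sum_l P i l * pseries (exp_coef 1%:M M l j) t N).
  rewrite mxE; apply: cvg_sum => l; apply: cvgM; first exact: cvg_cst.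
  by rewrite mxE; exact: exp_coef_cvg.
apply/funext => N; rewrite /pseries /series /=.
under [RHS]eq_bigr => l _ do rewrite mulr_sumr.
rewrite exchange_big /=; apply: eq_bigr => k _.
rewrite /exp_coef mxE !mulr_suml; apply: eq_bigr => l _.
by rewrite mul1mx -!mulrA.
Qed.

(** The factor [P] makes this family of coefficient sequences stable under formal
    differentiation. *)
Lemma pseries_diffs_exp_coef (a n : nat) (P : 'M[R]_(a, n)) (M : 'M[R]_n) i j :
  pseries_diffs (exp_coef P M i j) = exp_coef (P *m M) M i j.
Proof.
apply/funext => k; rewrite /pseries_diffs /exp_coef exprS mulmxA factS natrM invfM.
by rewrite mulrCA mulVKf ?pnatr_eq0.
Qed.

Lemma is_derive_rexp (n : nat) (M : 'M[R]_n) i j t :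
  is_derive t (1 : R) (fun t => rexp M t i j) ((M *m rexp M t) i j).
Proof.
rewrite (_ : (fun t => _) = fun t => limn (pseries (exp_coef 1%:M M i j) t)); last first.
  by apply/funext => s; rewrite mxE.
rewrite -(cvg_lim _ (@pseries_exp_coef _ _ M M i j t)); last exact: Rhausdorff.
(* The derived series is the series with factor [M]. *)
rewrite -{2}[M]mul1mx -pseries_diffs_exp_coef.
apply: (@pseries_snd_diffs _ _ (`|t| + 1)); rewrite ?pseries_diffs_exp_coef; try exact: exp_coef_cvg.
by rewrite [ltRHS]ger0_norm ?addr_ge0// ltrDl.
Qed.

Lemma exprZmx (K : comPzRingType) (n : nat) (c : K) (M : 'M[K]_n) k :
  (c *: M) ^+ k = c ^+ k *: M ^+ k.
Proof.
elim: k => [|k IH]; first by rewrite !expr0 scale1r.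
rewrite !exprS IH -[LHS]/((c *: M) *m (c ^+ k *: M ^+ k)).
by rewrite -scalemxAl -scalemxAr scalerA.
Qed.

Lemma mxC_inj (a b : nat) : injective (@mxC R a b).
Proof. exact: map_mx_inj. Qed.

Lemma mxCM (a b c : nat) (M : 'M[R]_(a, b)) (N : 'M[R]_(b, c)) :
  mxC (M *m N) = mxC M *m mxC N.
Proof. exact: map_mxM. Qed.

Lemma mxCX (n : nat) (M : 'M[R]_n) k : mxC (M ^+ k) = mxC M ^+ k.
Proof.
elim: k => [|k IH]; first by rewrite !expr0 /mxC map_mx1.
by rewrite !exprS -IH; exact: mxCM.
Qed.

Lemma mexp_real (n : nat) (M : 'M[R]_n) t : mexp (t%:C *: mxC M) = mxC (rexp M t).
Proof.
apply: (entrywise_cvg_unique (mexp_cvg _)) => i j.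
have mE N : mexp_partial (t%:C *: mxC M) N i j = (pseries (exp_coef 1%:M M i j) t N)%:C.
  rewrite /pseries /series /= big_mkord summxE rmorph_sum; apply: eq_bigr => k _ /=.
  rewrite mxE exprZmx mxE -mxCX mxE factC /exp_coef mul1mx.
  by rewrite -rmorphXn -!rmorphM /=; congr (_%:C); rewrite mulrC [RHS]mulrAC [t ^+ k * _]mulrC.
split.
  rewrite (_ : (fun N => _) = pseries (exp_coef 1%:M M i j) t).
    by rewrite !mxE; exact: exp_coef_cvg.
  by apply/funext => N; rewrite mE.
rewrite (_ : (fun N => _) = fun=> 0); first by rewrite mxE; exact: cvg_cst.
by apply/funext => N; rewrite mE.
Qed.

Lemma rexp_comm (n : nat) (M : 'M[R]_n) t : rexp M t *m M = M *m rexp M t.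
Proof.
apply: mxC_inj; rewrite !mxCM -mexp_real; apply: mexp_intertwine.
by rewrite -scalemxAl scalemxAr.
Qed.

Lemma rexp0 (n : nat) (M : 'M[R]_n) : rexp M 0 = 1%:M.
Proof.
apply/matrixP => i j; rewrite mxE; apply: cvg_lim; first exact: Rhausdorff.
rewrite -cvg_shiftS /pseries /=.
rewrite (_ : (fun N => _) = fun=> 1%:M i j); first exact: cvg_cst.
apply/funext => N; rewrite /series /= big_nat_recl//= big1 ?addr0.
  by rewrite /exp_coef expr0 mulmx1 expr0 fact0 divr1 mulr1.
by move=> k _; rewrite expr0n mulr0.
Qed.

Lemma rexp_cont (n : nat) (M : 'M[R]_n) i j : continuous (fun t => rexp M t i j).
Proof.
by move=> t; have ? := is_derive_rexp M i j t; exact/differentiable_continuous/derivable1_diffP.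
Qed.

Lemma is_derive_rexp_sub (n : nat) (M : 'M[R]_n) i j (t u : R) :
  is_derive u (1 : R) (fun u => rexp M (t - u) i j) (- (M *m rexp M (t - u)) i j).
Proof.
have d1 := is_derive_rexp M i j (t - u).
have d2 : is_derive u (1 : R) (fun u => t - u) (-1).
  by apply: is_derive_eq; rewrite add0r mul1r.
have := @is_derive1_comp _ (fun t => rexp M t i j) (fun u => t - u) u _ _ d1 d2.
by rewrite mulrN1.
Qed.

(** The derivative of [v |-> exp((s - v) M) exp(v M)] vanishes. *)
Lemma rexpB (n : nat) (M : 'M[R]_n) (t u : R) : rexp M (t - u) = rexp M t *m rexp M (- u).
Proof.
have G s v : rexp M (s - v) *m rexp M v = rexp M s.
  apply/matrixP => i j.
  have -> : rexp M s i j = (rexp M (s - 0) *m rexp M 0) i j by rewrite rexp0 mulmx1 subr0.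
  apply: (@is_derive_0_is_cst R (fun v => (rexp M (s - v) *m rexp M v) i j)) => w.
  rewrite (_ : (fun v => _) = \sum_l ((fun v => rexp M (s - v) i l) * (fun v => rexp M v l j))); last first.
    by apply/funext => v'; rewrite mxE fct_sumE.
  have ds l : is_derive w (1 : R) (fun v => rexp M (s - v) i l) (- (M *m rexp M (s - w)) i l).
    exact: is_derive_rexp_sub.
  have dl l : is_derive w (1 : R) (fun v => rexp M v l j) ((M *m rexp M w) l j).
    exact: is_derive_rexp.
  apply: is_derive_eq.
  rewrite big_split /=.
  have -> : \sum_l rexp M (s - w) i l *: (M *m rexp M w) l j = (rexp M (s - w) *m (M *m rexp M w)) i j.
    by rewrite mxE.
  have -> : \sum_l rexp M w l j *: - (M *m rexp M (s - w)) i l =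
            - ((M *m rexp M (s - w)) *m rexp M w) i j.
    by rewrite mxE -sumrN; apply: eq_bigr => l _; rewrite /GRing.scale /= mulrN mulrC.
  by rewrite mulmxA rexp_comm subrr.
have inv : rexp M u *m rexp M (- u) = 1%:M.
  by have := G 0 (- u); rewrite sub0r opprK rexp0.
by rewrite -(G t u) -mulmxA inv mulmx1.
Qed.
End RealExponential.

(** * Càdlàg functions and Riemann sums *)

Section CadlagPaths.
Variable R : realType.
Local Notation mu := (@lebesgue_measure R).
Implicit Types (nu f g : R -> R) (t s u : R).

(** Càdlàg real functions; vectors are treated entry by entry. *)
Definition rcll nu : Prop :=
  (forall t, 0 <= t -> nu x @[x --> t^'+] --> nu t) /\
  (forall t, 0 < t -> cvg (nu x @[x --> t^'-])).

Lemma cvg_colP (T : Type) (F : set_system T) {FF : Filter F} n (f : T -> 'cV[R]_n) (l : 'cV[R]_n) :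
  (forall i, f x i 0 @[x --> F] --> l i 0) <-> f x @[x --> F] --> l.
Proof.
split=> [fl|fl i]; last first.
  exact: (@cvg_comp _ _ _ f (fun M : 'cV[R]_n => M i 0) _ _ _ fl (@coord_continuous _ _ _ i 0 l)).
apply/cvg_ballP => e e0.
have : \forall x \near F, forall i, ball (l i 0) e (f x i 0).
  by apply: filter_forall => i; apply: (cvg_ball (fl i)).
apply: filterS => x lx; split => // i j; rewrite (ord1 j); exact: lx.
Qed.

Lemma cadlagP n (f : R -> 'cV[R]_n) : cadlag f <-> forall i, rcll (fun t => f t i 0).
Proof.
split=> [[fr fl] i|fi]; split=> t t0.
- exact: (cvg_colP _ _).2 (fr t t0) i.
- have /cvg_ex[l fl'] := fl t t0; apply/cvg_ex; exists (l i 0).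
  exact: (cvg_colP _ _).2 fl' i.
- by apply/cvg_colP => i; exact: (fi i).1.
- apply/cvg_ex; exists (\col_i lim (f x i 0 @[x --> t^'-])).
  by apply/cvg_colP => i; rewrite mxE; exact: (fi i).2.
Qed.

Lemma rcll_right nu t (e : R) : rcll nu -> 0 <= t -> 0 < e ->
  exists2 d : R, 0 < d & forall s, t <= s -> s < t + d -> `|nu t - nu s| < e.
Proof.
move=> [nur _] t0 e0; have /cvgrPdist_lt/(_ e e0) := nur t t0.
move=> /nbhs_ballP[d /= d0 dP]; exists d => // s.
rewrite le_eqVlt => /predU1P[<- _|ts std]; first by rewrite subrr normr0.
by apply: dP => //; rewrite /ball /= ltr0_norm ?subr_lt0// opprB ltrBlDl.
Qed.

Lemma rcll_left nu t : rcll nu -> 0 < t ->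
  exists l, exists2 d : R, 0 < d & forall s, t - d < s -> s < t -> `|l - nu s| < 1.
Proof.
move=> [_ nul] t0; have /cvg_ex[l] := nul t t0.
move=> /cvgrPdist_lt/(_ 1 ltr01)/nbhs_ballP[d /= d0 dP]; exists l; exists d => // s s1 s2.
by apply: dP => //; rewrite /ball /= gtr0_norm ?subr_gt0// ltrBlDr -ltrBlDl.
Qed.

(** Local boundedness, from one-sided limits, and compactness of the segment. *)
Lemma rcll_bounded nu T : rcll nu -> exists M : R, forall t, 0 <= t <= T -> `|nu t| <= M.
Proof.
move=> nuc.
(* The points are covered by neighbourhoods on which [nu] is bounded; left and right
   halves are treated separately, and at [0] there is only a right half. *)
have /compact_near_coveringP cpt : compact (`[0, T]%classic : set R) by exact: segment_compact.
have [|M [_ HM]] := cpt R (+oo : set_system R) (fun M x => 0 <= x -> `|nu x| <= M) _.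
  move=> x /=; rewrite in_itv /= => /andP[x0 xT].
  have [d d0 dP] := rcll_right nuc x0 ltr01.
  have [x0'|xgt0] := eqVneq x 0.
    exists ([set y | `|x - y| < d], [set M | `|nu x| + 1 < M]).
      split; first by apply/nbhs_ballP; exists d.
      by exists (`|nu x| + 1); split; first exact: num_real.
    move=> [y M] [/= xy xM] y0; rewrite x0' in xy *.
    have := dP y; rewrite x0' add0r => /(_ y0).
    rewrite sub0r normrN ger0_norm// in xy => /(_ xy); rewrite x0' in xM; move: xM.
    have := ler_normB (nu 0) (nu 0 - nu y).
    rewrite opprB addrCA subrr addr0; lra.
  have xp : 0 < x by rewrite lt_neqAle eq_sym xgt0.
  have [l [d' d'0 d'P]] := rcll_left nuc xp.
  exists ([set y | `|x - y| < Num.min d d'], [set M | `|nu x| + `|l| + 1 < M]).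
    split; first by apply/nbhs_ballP; exists (Num.min d d') => //=; rewrite lt_min d0.
    by exists (`|nu x| + `|l| + 1); split; first exact: num_real.
  move=> [y M] [/= xy xM] y0; move: xy; rewrite lt_min => /andP[xyd xyd'].
  have [xy|yx] := leP x y.
    have := dP y xy; move: xyd; rewrite ler0_norm ?subr_le0// opprB ltrBlDl => -> /(_ isT).
    have := ler_normB (nu x) (nu x - nu y); have := normr_ge0 l.
    rewrite opprB addrCA subrr addr0; lra.
  have := d'P y _ yx; move: xyd'; rewrite gtr0_norm ?subr_gt0// ltrBlDr -ltrBlDl => -> /(_ isT).
  have := ler_normB l (l - nu y); have := normr_ge0 (nu x).
  rewrite opprB addrCA subrr addr0; lra.
exists (M + 1) => t /andP[t0 tT].
by apply: (HM (M + 1)); rewrite ?ltrDl//= in_itv /= t0.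
Qed.

Section Grid.
Variables (t : R) (n : nat).
Hypothesis t_gt0 : 0 < t.

Definition grid (j : nat) : R := t / n.+1%:R * j%:R.
Definition grid_seq : seq R := mkseq (fun j => grid j.+1) n.+1.
(** The smallest grid point at or above [u]: composing with it turns a function into
    the step function that takes on each cell the value at the right end point. *)
Definition grid_up u : R := grid 1 * (Num.ceil (u / grid 1))%:~R.

Lemma grid1_gt0 : 0 < grid 1.
Proof. by rewrite /grid mulr1 divr_gt0// ltr0n. Qed.

Lemma gridE j : grid j = grid 1 * j%:R.
Proof. by rewrite /grid mulr1. Qed.

Lemma grid0 : grid 0 = 0. Proof. by rewrite /grid mulr0. Qed.

Lemma gridn : grid n.+1 = t.
Proof. by rewrite /grid divfK// pnatr_eq0. Qed.

Lemma gridS j : grid j.+1 - grid j = t / n.+1%:R.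
Proof. by rewrite /grid -mulrBr -natrB// subSnn mulr1. Qed.

Lemma grid_le i j : (i <= j)%N -> grid i <= grid j.
Proof. by move=> ij; rewrite gridE [leRHS]gridE ler_pM2l ?grid1_gt0// ler_nat. Qed.

Lemma grid_lt j : grid j < grid j.+1.
Proof. by rewrite gridE [ltRHS]gridE ltr_pM2l ?grid1_gt0// ltr_nat. Qed.

Lemma nth_grid j : (j <= n.+1)%N -> nth 0 (0 :: grid_seq) j = grid j.
Proof. by case: j => [|j] jn; [rewrite grid0|rewrite /= nth_mkseq]. Qed.

Lemma size_grid_seq : size grid_seq = n.+1. Proof. exact: size_mkseq. Qed.

Lemma grid_partition : itv_partition 0 t grid_seq.
Proof.
split.
  apply/(pathP 0) => j; rewrite size_grid_seq => jn.
  by rewrite nth_grid 1?ltnW// nth_mkseq// grid_lt.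
by rewrite (last_nth 0) size_grid_seq nth_grid// gridn.
Qed.

Lemma grid_up_bounds u : u <= grid_up u < u + grid 1.
Proof.
have g0 := grid1_gt0.
have /andP[c1 c2] := real_ceil_itv (num_real (u / grid 1)).
rewrite ler_pdivrMr// in c2.
rewrite /grid_up mulrC c2 /=.
rewrite ltr_pdivlMr// rmorphB /= mulrBl mul1r in c1.
by rewrite -ltrBlDr.
Qed.

Lemma grid_up_piece u j : grid j < u <= grid j.+1 -> grid_up u = grid j.+1.
Proof.
have g0 := grid1_gt0.
rewrite gridE [grid j.+1]gridE => /andP[u1 u2].
rewrite /grid_up (@ceil_def _ _ (j.+1%:Z))//.
have -> : (j.+1%:Z - 1)%:~R = j%:R :> R by rewrite -addn1 PoszD addrK.
rewrite ltr_pdivlMr// ler_pdivrMr// ![_ * grid 1]mulrC u1 /=; exact: u2.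
Qed.
End Grid.

(** Grid points approach [u] from above, so right continuity suffices. *)
Lemma grid_up_cvg nu t u : rcll nu -> 0 < t -> 0 <= u ->
  nu (grid_up t n u) @[n --> \oo] --> nu u.
Proof.
move=> nuc t0 u0; apply/cvgrPdist_lt => e e0.
have [d d0 dP] := rcll_right nuc u0 e0.
near=> n.
have /andP[h1 h2] := grid_up_bounds n t0 u.
apply: dP => //; apply: (lt_trans h2); rewrite ltrD2l.
rewrite /grid mulr1 ltr_pdivrMr ?ltr0n// mulrC -ltr_pdivrMr//.
have : (Num.bound (t / d) <= n)%N by near: n; exists (Num.bound (t / d)).
move=> bn; apply: (lt_le_trans (archi_boundP _)); first by rewrite divr_ge0 ?ltW.
by rewrite ler_nat ltnW.
Unshelve. all: by end_near. Qed.

Lemma grid_up_piece_continuous nu f t n j : 0 < t ->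
  continuous f ->
  piece_continuous (fun u => f u * nu (grid_up t n u)) (grid t n j) (grid t n j.+1).
Proof.
move=> t0 cf; exists (fun u => f u * nu (grid t n j.+1)).
  by move=> u _; apply: cvgM; [exact: cf|exact: cvg_cst].
move=> u; rewrite in_itv /= => /andP[u1 u2].
by rewrite (@grid_up_piece t n t0 u j)// u1 ltW.
Qed.

Lemma grid_up_measurable_bounded nu f t n : 0 < t -> continuous f ->
  measurable_fun (`[0, t]%classic : set R) (fun u => f u * nu (grid_up t n u)) /\
  exists M : R, forall u, 0 <= u <= t -> `|f u * nu (grid_up t n u)| <= M.
Proof.
move=> t0 cf; apply: (pw_measurable_bounded (grid_partition n t0)) => j.
rewrite size_grid_seq => jn; rewrite nth_grid 1?ltnW// nth_mkseq//.
exact: grid_up_piece_continuous.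
Qed.

(** A pointwise limit of step functions. *)
Lemma rcll_measurable nu t : rcll nu -> 0 <= t ->
  measurable_fun (`[0, t]%classic : set R) nu.
Proof.
move=> nuc; rewrite le_eqVlt => /predU1P[<-|t0].
  by rewrite set_itv1; exact: measurable_fun_set1.
apply: (@measurable_fun_cvg _ _ _ _ (fun n u => 1 * nu (grid_up t n u))).
  move=> n; apply: (grid_up_measurable_bounded nu n t0 _).1.
  by move=> ?; exact: cvg_cst.
move=> u /=; rewrite in_itv /= => /andP[u0 _].
under eq_fun do rewrite mul1r.
exact: grid_up_cvg.
Qed.

Lemma Rintegral_split f (a s t : R) : a <= s -> s <= t ->
  mu.-integrable `[a, t] (EFin \o f) ->
  Rintegral mu `[a, t]%classic f =
  Rintegral mu `[a, s]%classic f + Rintegral mu `[s, t]%classic f.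
Proof.
move=> as_ st fi.
rewrite -(@Rintegral_itv_obnd_cbnd _ s (BRight t)).
  by rewrite -(@Rintegral_itvB _ f (BLeft a) (BRight t) s) ?bnd_simp// addrC subrK.
by apply: integrableS fi => //; apply: subset_itvr; rewrite bnd_simp.
Qed.

(** On each cell the integrand is the derivative of [f] times a constant. *)
Lemma integral_grid_up nu f g t n : 0 < t ->
  (forall u, is_derive u (1 : R) f (g u)) -> continuous g ->
  Rintegral mu `[0, t]%classic (fun u => g u * nu (grid_up t n u)) =
  \sum_(0 <= j < n.+1) (f (grid t n j.+1) - f (grid t n j)) * nu (grid t n j.+1).
Proof.
move=> t0 fd cg; pose F u := g u * nu (grid_up t n u).
have [mF [M FM]] := grid_up_measurable_bounded nu n t0 cg.
have sub a b : 0 <= a -> b <= t -> mu.-integrable `[a, b] (EFin \o F).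
  move=> a0 bt; apply: integrableS (integrable_bounded_itv mF FM) => //.
  by apply: subset_itv; rewrite bnd_simp.
have g0 j : 0 <= grid t n j by rewrite -(grid0 t n) grid_le.
suff step k : (k <= n.+1)%N -> Rintegral mu `[0, grid t n k]%classic F =
   \sum_(0 <= j < k) (f (grid t n j.+1) - f (grid t n j)) * nu (grid t n j.+1).
  by rewrite -step// gridn.
elim: k => [|k IH] kn; first by rewrite grid0 set_itv1 Rintegral_set1 big_nil.
have ktn : grid t n k.+1 <= t by rewrite -[leRHS](gridn t n) grid_le.
rewrite (@Rintegral_split _ _ (grid t n k))//; last 2 first.
- exact: ltW (grid_lt _ t0 _).
- exact: sub.
rewrite IH 1?ltnW// big_nat_recr//=; congr (_ + _).
rewrite Rintegral_segment_oo; last exact: sub.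
pose c := nu (grid t n k.+1).
have gi : mu.-integrable `[grid t n k, grid t n k.+1] (EFin \o g).
  apply: continuous_compact_integrable; first exact: segment_compact.
  by apply: within_segment_continuous => u _; exact: cg.
transitivity (Rintegral mu `]grid t n k, grid t n k.+1[%classic (fun u => g u * c)).
  apply: eq_Rintegral => u; rewrite inE /= in_itv /= => /andP[u1 u2].
  by rewrite /F (@grid_up_piece t n t0 u k)// u1 ltW.
rewrite RintegralZr//; last first.
  by apply: integrableS gi => //; exact: subset_itv_oo_cc.
rewrite -Rintegral_segment_oo//; congr (_ * _).
by apply: continuous_FTC => [|u _]; [exact: ltW (grid_lt _ t0 _)|exact: cg].
Qed.

Lemma integral_grid_up_cvg nu g t : rcll nu -> 0 < t -> continuous g ->
  Rintegral mu `[0, t]%classic (fun u => g u * nu (grid_up t n u)) @[n --> \oo] -->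
  Rintegral mu `[0, t]%classic (fun u => g u * nu u).
Proof.
move=> nuc t0 cg.
have [N nuN] := rcll_bounded (t + t) nuc.
have cgn : {within `[0, t], continuous (fun u => `|g u|)}.
  apply: within_segment_continuous => u _.
  by apply: (@cvg_norm _ R^o); exact: cg.
have [c _ gmax] := EVT_max (ltW t0) cgn.
have N0 : 0 <= N.
  have tt : 0 <= t + t by rewrite addr_ge0// ltW.
  have := nuN 0; rewrite lexx tt => /(_ isT).
  exact: le_trans.
pose K := `|g c| * N.
have mgn n := (grid_up_measurable_bounded nu n t0 cg).1.
have bnd u v : 0 <= u <= t -> 0 <= v <= t + t -> `|g u * nu v| <= K.
  move=> ut vt; rewrite normrM ler_pM// ?nuN//.
  by apply: (gmax u); rewrite in_itv.
have mg : measurable_fun (`[0, t]%classic : set R) (fun u => g u * nu u).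
  apply: measurable_funM; last exact: rcll_measurable (ltW t0).
  apply: subspace_continuous_measurable_fun => //.
  by apply: within_segment_continuous => u _; exact: cg.
have up_bnd n u : 0 <= u <= t -> 0 <= grid_up t n u <= t + t.
  move=> /andP[u0 ut]; have /andP[h1 h2] := grid_up_bounds n t0 u.
  rewrite (le_trans u0 h1) /= (le_trans (ltW h2))// lerD//.
  by rewrite -[leRHS](gridn t n) grid_le.
have [|||||_ _ dc] := @dominated_convergence _ _ _ mu `[0, t]%classic (measurable_itv _)
  (fun n u => (g u * nu (grid_up t n u))%:E) (fun u => (g u * nu u)%:E) (cst K%:E).
- by move=> n; apply/measurable_EFinP; exact: mgn.
- by apply/measurable_EFinP; exact: mg.
- apply: aeW => u /=; rewrite in_itv /= => /andP[u0 _].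
  apply: cvg_EFin; first by apply: nearW.
  by apply: cvgM; [exact: cvg_cst|exact: grid_up_cvg].
- by apply: (@integrable_bounded_itv _ _ _ (cst K) `|K|).
- apply: aeW => u n /=; rewrite in_itv /= => ut.
  by rewrite lee_fin; apply: bnd => //; exact: up_bnd.
apply: fine_cvg; rewrite /Rintegral fineK//.
apply: integrable_fin_num => //.
by apply: (@integrable_bounded_itv _ _ _ _ K) => // u /[dup] /andP[u0 ut] ut'; apply: bnd;
  rewrite // u0 (le_trans ut)// lerDl ltW.
Qed.

(** Summation by parts moves the increments onto the smooth function [f]; the sums
    become integrals of step functions, to which dominated convergence applies. The
    limit is the integral of [f] against [nu], written by parts. *)
Lemma riemann_sum_cvg nu f g t : rcll nu -> 0 < t ->
  (forall u, is_derive u (1 : R) f (g u)) -> continuous g ->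
  \sum_(0 <= j < n.+1) f (grid t n j) * (nu (grid t n j.+1) - nu (grid t n j)) @[n --> \oo] -->
  f t * nu t - f 0 * nu 0 - Rintegral mu `[0, t]%classic (fun u => g u * nu u).
Proof.
move=> nuc t0 fd cg.
rewrite (_ : (fun n => _) = fun n => f t * nu t - f 0 * nu 0 -
   Rintegral mu `[0, t]%classic (fun u => g u * nu (grid_up t n u))).
  by apply: cvgB; [exact: cvg_cst|exact: integral_grid_up_cvg].
apply/funext => n; rewrite (integral_grid_up nu n t0 fd cg).
have -> : f t * nu t - f 0 * nu 0 =
  \sum_(0 <= j < n.+1) (f (grid t n j.+1) * nu (grid t n j.+1) - f (grid t n j) * nu (grid t n j)).
  by rewrite telescope_sumr// gridn grid0.
by rewrite -sumrB; apply: eq_bigr => j _; ring.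
Qed.
End CadlagPaths.

(** * The pathwise solution of the state equation *)

Section PathSolution.
Variable R : realType.
Local Notation mu := (@lebesgue_measure R).
Implicit Types (nu f g phi : R -> R) (t s u : R).

Lemma rcll_cont f : continuous f -> rcll f.
Proof.
move=> cf; split=> t _; first by apply: cvg_at_right_filter; exact: cf.
by apply/cvg_ex; exists (f t); apply: cvg_at_left_filter; exact: cf.
Qed.

Lemma rcllD f g : rcll f -> rcll g -> rcll (fun t => f t + g t).
Proof.
move=> [fr fl] [gr gl]; split=> t t0; first by apply: cvgD; [exact: fr|exact: gr].
have /cvg_ex[a fa] := fl t t0; have /cvg_ex[b gb] := gl t t0.
by apply/cvg_ex; exists (a + b); exact: cvgD.
Qed.

Lemma rcllM f g : rcll f -> rcll g -> rcll (fun t => f t * g t).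
Proof.
move=> [fr fl] [gr gl]; split=> t t0; first by apply: cvgM; [exact: fr|exact: gr].
have /cvg_ex[a fa] := fl t t0; have /cvg_ex[b gb] := gl t t0.
by apply/cvg_ex; exists (a * b); exact: cvgM.
Qed.

Lemma rcll_sum (I : finType) (f : I -> R -> R) :
  (forall i, rcll (f i)) -> rcll (fun t => \sum_i f i t).
Proof.
move=> fi; elim: (index_enum I) => [|i s IH].
  rewrite (_ : (fun _ => _) = fun=> 0); first by apply: rcll_cont => t; exact: cvg_cst.
  by apply/funext => t; rewrite big_nil.
rewrite (_ : (fun _ => _) = fun t => f i t + \sum_(j <- s) f j t); first exact: rcllD.
by apply/funext => t; rewrite big_cons.
Qed.

Lemma rcll_mulmx a n b (P : R -> 'M[R]_(a, n)) (Q : R -> 'M[R]_(n, b)) :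
  (forall i j, rcll (fun t => P t i j)) -> (forall i j, rcll (fun t => Q t i j)) ->
  forall i j, rcll (fun t => (P t *m Q t) i j).
Proof.
move=> Pc Qc i j; rewrite (_ : (fun _ => _) = fun t => \sum_l P t i l * Q t l j).
  by apply: rcll_sum => l; exact: rcllM.
by apply/funext => t; rewrite mxE.
Qed.

Lemma rcll_cst (x : R) : rcll (fun=> x).
Proof. by apply: rcll_cont => t; exact: cvg_cst. Qed.

Lemma rcll_integrable f t : rcll f -> 0 <= t -> mu.-integrable `[0, t] (EFin \o f).
Proof.
move=> fc t0; have [M fM] := rcll_bounded t fc.
exact: integrable_bounded_itv (rcll_measurable fc t0) fM.
Qed.

Lemma rcll_measurable_sub f s t : rcll f -> 0 <= s -> s <= t ->
  measurable_fun (`[s, t]%classic : set R) f.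
Proof.
move=> fc s0 st; apply: measurable_funS (rcll_measurable fc (le_trans s0 st)) => //.
by apply: subset_itvr; rewrite bnd_simp.
Qed.

Lemma Rintegral_sum (I : finType) (f : I -> R -> R) t :
  (forall i, rcll (f i)) -> 0 <= t ->
  Rintegral mu `[0, t]%classic (fun u => \sum_i f i u) =
  \sum_i Rintegral mu `[0, t]%classic (f i).
Proof.
move=> fc t0.
have sc (s : seq I) : rcll (fun t => \sum_(i <- s) f i t).
  elim: s => [|i s IH].
    rewrite (_ : (fun _ => _) = fun=> 0); first exact: rcll_cst.
    by apply/funext => u; rewrite big_nil.
  rewrite (_ : (fun _ => _) = fun t => f i t + \sum_(j <- s) f j t); first exact: rcllD.
  by apply/funext => u; rewrite big_cons.
elim: (index_enum I) => [|i s IH].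
  rewrite big_nil; transitivity (Rintegral mu `[0, t]%classic (cst 0)).
    by apply: eq_Rintegral => u _; rewrite big_nil.
  by rewrite Rintegral_cst// mul0r.
rewrite big_cons -IH -RintegralD//; [|exact: rcll_integrable|exact: rcll_integrable].
by apply: eq_Rintegral => u _; rewrite big_cons.
Qed.

Section Primitive.
Variables (phi : R -> R) (x : R).
Hypothesis phic : rcll phi.
Definition primitive t : R := x + Rintegral mu `[0, t]%classic phi.

Lemma primitive0 : primitive 0 = x.
Proof. by rewrite /primitive set_itv1 Rintegral_set1 addr0. Qed.

Lemma primitiveB s t : 0 <= s -> s <= t ->
  primitive t - primitive s = Rintegral mu `[s, t]%classic phi.
Proof.
move=> s0 st; rewrite /primitive (Rintegral_split s0 st).
  by ring.
by apply: rcll_integrable => //; exact: le_trans st.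
Qed.

(** For negative arguments the domain of integration is empty, so that the primitive is
    constant there and the bound extends to the left half-line. *)
Lemma primitive_lip T : exists2 M : R, 0 <= M &
  forall s t, s <= t -> t <= T -> `|primitive t - primitive s| <= M * (t - s).
Proof.
have [M phiM] := rcll_bounded T phic.
exists `|M| => // s t st tT.
have neg r : r < 0 -> primitive r = primitive 0.
  by move=> r0; rewrite primitive0 /primitive set_itv_ge ?bnd_simp -?ltNge// Rintegral_set0 addr0.
have pos a b : 0 <= a -> a <= b -> b <= T -> `|primitive b - primitive a| <= `|M| * (b - a).
  move=> a0 ab bT; rewrite primitiveB//.
  apply: Rintegral_norm_bound => // [|r /andP[ar rb]].
    exact: rcll_measurable_sub.
  by rewrite (le_trans (phiM r _)) ?ler_norm// (le_trans a0 ar) (le_trans rb bT).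
have [s0|s0] := leP 0 s; first exact: pos.
rewrite (neg s s0); have [t0|t0] := leP 0 t.
  by rewrite (le_trans (pos 0 t _ _ _))// ler_wpM2l// lerD2l lerN2 ltW.
by rewrite (neg t t0) subrr normr0 mulr_ge0// subr_ge0.
Qed.

Lemma primitive_continuous : continuous primitive.
Proof.
move=> t; have [M M0 lip] := primitive_lip (t + 1).
apply/cvgrPdist_lt => e e0; near=> s.
have sT : s <= t + 1.
  have : `|t - s| < 1 by near: s; apply/nbhs_ballP; exists 1 => /=.
  by rewrite ltr_norml => /andP[? ?]; lra.
have lip' : `|primitive t - primitive s| <= M * `|t - s|.
  have [st|ts] := leP s t.
    by rewrite (ger0_norm (_ : 0 <= t - s)) ?subr_ge0// lip// lerDl.
  by rewrite distrC (ltr0_norm (_ : t - s < 0)) ?subr_lt0// opprB lip// ltW.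
apply: le_lt_trans lip' _.
apply: (@le_lt_trans _ _ ((M + 1) * `|t - s|)); first by rewrite ler_wpM2r// lerDl.
rewrite mulrC -ltr_pdivlMr ?ltr_wpDl//.
near: s; apply/nbhs_ballP; exists (e / (M + 1)) => //=.
by rewrite divr_gt0// ltr_wpDl.
Unshelve. all: by end_near. Qed.
End Primitive.

(** The primitive of [phi] is differentiable only where [phi] is continuous. Instead,
    the difference of both sides has increments of second order: with [U] the
    primitive, the increment over [s, t] is the integral of
    [g(u) (U(t) - U(u)) + (f(s) - f(u)) phi(u)], and both factors in parentheses are
    at most a multiple of [t - s]. *)
Lemma product_rule f g phi (x T : R) : rcll phi -> 0 <= T ->
  (forall u, is_derive u (1 : R) f (g u)) -> continuous g ->
  f T * primitive phi x T =
  f 0 * x + Rintegral mu `[0, T]%classic (fun u => g u * primitive phi x u + f u * phi u).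
Proof.
move=> phic T0 fd cg.
pose U := primitive phi x; have Uc : continuous U by exact: primitive_continuous.
have cf : continuous f.
  by move=> u; have ? := fd u; exact/differentiable_continuous/derivable1_diffP.
pose psi u := g u * U u + f u * phi u.
have psic : rcll psi.
  by apply: rcllD; apply: rcllM => //; exact: rcll_cont.
(* [D] is the difference of both sides at [t], up to the constant [f 0 * x]. *)
pose D t := f t * U t - Rintegral mu `[0, t]%classic psi.
suff DT : D 0 = D T.
  rewrite -[LHS](subrK (Rintegral mu `[0, T]%classic psi)) -/U -/(D T) -DT.
  by rewrite /D set_itv1 Rintegral_set1 subr0 /U primitive0.
have [Mp phiM] := rcll_bounded T phic.
have [Mg gM] := rcll_bounded T (rcll_cont cg).
have flip s t : 0 <= s -> s <= t -> t <= T -> `|f t - f s| <= `|Mg| * (t - s).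
  move=> s0 st tT; rewrite -(@continuous_FTC _ s t f g)//; last by move=> u _; exact: cg.
  apply: Rintegral_norm_bound => // [|u /andP[su ut]].
    by apply: rcll_measurable_sub => //; exact: rcll_cont.
  by rewrite (le_trans (gM u _)) ?ler_norm// (le_trans s0 su) (le_trans ut tT).
have Ulip s t : 0 <= s -> s <= t -> t <= T -> `|U t - U s| <= `|Mp| * (t - s).
  move=> s0 st tT; rewrite /U primitiveB//.
  apply: Rintegral_norm_bound => // [|u /andP[su ut]].
    exact: rcll_measurable_sub.
  by rewrite (le_trans (phiM u _)) ?ler_norm// (le_trans s0 su) (le_trans ut tT).
apply: (@quadratic_modulus_cst _ D 0 T (`|Mg| * `|Mp| + `|Mg| * `|Mp|)) => // s t s0 st tT.
have t0 : 0 <= t by exact: le_trans st.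
have ig h : rcll h -> mu.-integrable `[s, t] (EFin \o h).
  move=> hc; apply: integrableS (rcll_integrable hc t0) => //.
  by apply: subset_itvr; rewrite bnd_simp.
pose r1 u := g u * (U t - U u); pose r2 u := (f s - f u) * phi u.
have r1c : rcll r1.
  apply: rcllM; first exact: rcll_cont.
  apply: rcll_cont => u; apply: cvgB; [exact: cvg_cst|exact: Uc].
have r2c : rcll r2.
  apply: rcllM => //; apply: rcll_cont => u; apply: cvgB; [exact: cvg_cst|exact: cf].
have -> : D t - D s = Rintegral mu `[s, t]%classic (fun u => r1 u + r2 u).
  have -> : D t - D s = (f t * U t - f s * U s) - Rintegral mu `[s, t]%classic psi.
    rewrite /D (Rintegral_split s0 st); last exact: rcll_integrable.
    by ring.
  have -> : f t * U t - f s * U s = (f t - f s) * U t + f s * (U t - U s) by ring.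
  rewrite [in f s * _]/U primitiveB// -(@continuous_FTC _ s t f g)//; last by move=> u _; exact: cg.
  rewrite -RintegralZr//; last by apply: ig; exact: rcll_cont.
  rewrite -RintegralZl//; last exact: ig.
  have c1 : rcll (fun u => g u * U t) by apply: rcllM; [exact: rcll_cont|exact: rcll_cst].
  have c2 : rcll (fun u => f s * phi u) by apply: rcllM => //; exact: rcll_cst.
  rewrite -RintegralD//; [|exact: ig|exact: ig].
  rewrite -RintegralB//; [|by apply: ig; exact: rcllD|exact: ig].
  by apply: eq_Rintegral => u _; rewrite /psi /r1 /r2; ring.
rewrite expr2 mulrA; apply: Rintegral_norm_bound => //.
  by apply: rcll_measurable_sub => //; exact: rcllD.
move=> u /andP[su ut].
have u0 : 0 <= u by exact: le_trans su.
have uT : u <= T by exact: le_trans tT.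
have uT' : 0 <= u <= T by rewrite u0.
rewrite (le_trans (ler_normD _ _))// mulrDl; apply: lerD.
  rewrite normrM -mulrA ler_pM//; first by rewrite (le_trans (gM u uT')) ?ler_norm.
  rewrite (le_trans (Ulip u t _ _ _))// ler_wpM2l// lerD2l lerN2//.
rewrite normrM distrC -mulrA mulrCA mulrC ler_pM//.
  by rewrite (le_trans (phiM u uT')) ?ler_norm.
by rewrite (le_trans (flip s u _ _ _))// ler_wpM2l// lerD2r.
Qed.

Section LinearEquation.
Variables (n m : nat) (M : 'M[R]_n) (B : 'M[R]_(n, m)) (x0 : 'cV[R]_n) (N : R -> 'cV[R]_m).
Hypothesis Nc : cadlag N.
Hypothesis N0 : N 0 = 0.

Let phi (l : 'I_n) (u : R) : R := (rexp M (- u) *m (M *m B *m N u)) l 0.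

(** Variation of constants for [dZ = M Z dt + B dN] with the noise integrated by
    parts, [exp(t M) (x0 + int_0^t exp(- u M) M B N(u) du) + B N(t)], which makes sense
    for every càdlàg path [N] starting at zero. *)
Definition path_solution (t : R) : 'cV[R]_n :=
  rexp M t *m (\col_l primitive (phi l) (x0 l 0) t) + B *m N t.

Let Nr i j : rcll (fun t => N t i j).
Proof. by rewrite (ord1 j); move/cadlagP : Nc; apply. Qed.

Let Er i j : rcll (fun t => rexp M t i j).
Proof. by apply: rcll_cont; exact: rexp_cont. Qed.

Let Esr t i j : continuous (fun u => rexp M (t - u) i j).
Proof.
move=> u; have ? := is_derive_rexp_sub M i j t u.
exact/differentiable_continuous/derivable1_diffP.
Qed.

Let phi_rcll l : rcll (phi l).
Proof.
apply: rcll_mulmx => i j.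
  rewrite (_ : (fun u => _) = fun u => rexp M (0 - u) i j); last first.
    by apply/funext => u; rewrite sub0r.
  by apply: rcll_cont; exact: Esr.
by apply: rcll_mulmx => i' j'; [exact: rcll_cst|exact: Nr].
Qed.

Lemma path_solution_rcll i : rcll (fun t => path_solution t i 0).
Proof.
rewrite (_ : (fun _ => _) = fun t => (rexp M t *m (\col_l primitive (phi l) (x0 l 0) t)) i 0 + (B *m N t) i 0).
  apply: rcllD; apply: rcll_mulmx => i' j'; [exact: Er| |exact: rcll_cst|exact: Nr].
  rewrite (_ : (fun _ => _) = primitive (phi i') (x0 i' 0)).
    by apply: rcll_cont; exact: primitive_continuous.
  by apply/funext => t; rewrite mxE.
by apply/funext => t; rewrite mxE.
Qed.

Lemma path_solution_cadlag : cadlag path_solution.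
Proof. by apply/cadlagP => i; exact: path_solution_rcll. Qed.

Lemma path_solution0 : path_solution 0 = x0.
Proof.
rewrite /path_solution rexp0 mul1mx N0 mulmx0 addr0; apply/matrixP => i j.
by rewrite mxE primitive0 (ord1 j).
Qed.

(** The product rule for the entries of [exp(t M)] and of the integral. *)
Lemma path_solution_integral t : 0 <= t ->
  path_solution t = x0 + \col_i Rintegral mu `[0, t]%classic (fun s => (M *m path_solution s) i 0)
                    + B *m N t.
Proof.
move=> t0; congr (_ + _); apply/matrixP => i j; rewrite (ord1 j) {j}.
rewrite [LHS]mxE [RHS]mxE [in RHS]mxE.
pose psi l u := (M *m rexp M u) i l * primitive (phi l) (x0 l 0) u + rexp M u i l * phi l u.
have Mr l : continuous (fun u => (M *m rexp M u) i l).
  move=> u; rewrite (_ : (fun _ => _) = fun u => \sum_k M i k * rexp M u k l).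
    by apply: cvg_sum => k; apply: cvgM; [exact: cvg_cst|exact: rexp_cont].
  by apply/funext => v; rewrite mxE.
transitivity (\sum_l (rexp M 0 i l * x0 l 0 + Rintegral mu `[0, t]%classic (psi l))).
  apply: eq_bigr => l _; rewrite [X in _ * X]mxE.
  exact: (@product_rule _ _ (phi l) (x0 l 0) t (phi_rcll l) t0
            (fun u => is_derive_rexp M i l u) (Mr l)).
rewrite big_split /=; congr (_ + _).
  by rewrite rexp0 -[in RHS](mul1mx x0) [RHS]mxE.
have psir l : rcll (psi l).
  apply: rcllD; apply: rcllM.
  - by apply: rcll_cont; exact: Mr.
  - by apply: rcll_cont; exact: primitive_continuous.
  - exact: Er.
  - exact: phi_rcll.
rewrite -Rintegral_sum//; apply: eq_Rintegral => u _.
rewrite big_split /= /path_solution mulmxDr mulmxA [RHS]mxE; congr (_ + _).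
  by rewrite [RHS]mxE; apply: eq_bigr => l _; congr (_ * _); rewrite mxE.
transitivity ((rexp M u *m (rexp M (- u) *m (M *m B *m N u))) i 0).
  by rewrite mxE.
by rewrite mulmxA -rexpB subrr rexp0 mul1mx mulmxA.
Qed.

(** Left-point sums of the integrand of the stochastic integral converge along uniform
    grids, for every single path. *)
Lemma path_solution_riemann t i : 0 < t ->
  (\sum_(0 <= j < k.+1) rexp M (t - grid t k j) *m B *m (N (grid t k j.+1) - N (grid t k j))) i 0
    @[k --> \oo] --> (path_solution t - rexp M t *m x0) i 0.
Proof.
move=> t0.
pose F (b : 'I_m) u := (rexp M (t - u) *m B) i b.
pose G (b : 'I_m) u := - (M *m rexp M (t - u) *m B) i b.
have Fd b u : is_derive u (1 : R) (F b) (G b u).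
  rewrite (_ : F b = \sum_l ((fun u => rexp M (t - u) i l) * cst (B l b))); last first.
    by apply/funext => v; rewrite /F mxE fct_sumE.
  have dl l := is_derive_rexp_sub M i l t u.
  apply: is_derive_eq; rewrite /G mxE -sumrN; apply: eq_bigr => l _.
  by rewrite /GRing.scale /= mulr0 add0r mulrN mulrC.
have Gc b : continuous (G b).
  rewrite (_ : G b = fun u => - \sum_l (\sum_k M i k * rexp M (t - u) k l) * B l b).
    move=> u; apply: cvgN; apply: cvg_sum => l; apply: cvgM; last exact: cvg_cst.
    by apply: cvg_sum => k; apply: cvgM; [exact: cvg_cst|exact: Esr].
  apply/funext => u; rewrite /G mxE; congr (- _); apply: eq_bigr => l _.
  by rewrite mxE.
rewrite (_ : (fun _ => _) = fun k => \sum_b \sum_(0 <= j < k.+1)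
    F b (grid t k j) * (N (grid t k j.+1) b 0 - N (grid t k j) b 0)); last first.
  apply/funext => k; rewrite summxE exchange_big /=; apply: eq_bigr => j _.
  by rewrite mxE; apply: eq_bigr => b _; congr (_ * _); rewrite mxE [X in _ + X]mxE.
have -> : (path_solution t - rexp M t *m x0) i 0 =
   \sum_b (F b t * N t b 0 - F b 0 * N 0 b 0 -
           Rintegral mu `[0, t]%classic (fun u => G b u * N u b 0)).
  have GNr b : rcll (fun u => G b u * N u b 0) by apply: rcllM => //; exact: rcll_cont.
  rewrite sumrB -Rintegral_sum ?(ltW t0)//.
  have -> : \sum_b (F b t * N t b 0 - F b 0 * N 0 b 0) = (B *m N t) i 0.
    by rewrite mxE; apply: eq_bigr => b _; rewrite N0 !mxE mulr0 subr0 /F subrr rexp0 mul1mx.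
  rewrite /path_solution addrAC [LHS]mxE addrC; congr (_ + _).
  have -> : \col_l primitive (phi l) (x0 l 0) t = x0 + \col_l Rintegral mu `[0, t]%classic (phi l).
    by apply/matrixP => l j; rewrite !mxE (ord1 j).
  rewrite mulmxDr addrAC subrr add0r.
  have Ephi l : rcll (fun u => rexp M t i l * phi l u) by apply: rcllM => //; exact: rcll_cst.
  transitivity (Rintegral mu `[0, t]%classic (fun u => \sum_l rexp M t i l * phi l u)).
    rewrite Rintegral_sum ?(ltW t0)// mxE; apply: eq_bigr => l _.
    rewrite RintegralZl//; last by apply: rcll_integrable => //; exact: ltW.
    by congr (_ * _); rewrite mxE.
  rewrite -[RHS]mulN1r -RintegralZl//; last first.
    by apply: rcll_integrable (ltW t0); exact: rcll_sum.
  apply: eq_Rintegral => u _; rewrite mulN1r -sumrN.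
  transitivity ((rexp M t *m (rexp M (- u) *m (M *m B *m N u))) i 0); first by rewrite mxE.
  rewrite mulmxA -rexpB mulmxA mulmxA rexp_comm mxE; apply: eq_bigr => b _.
  by rewrite /G mulNr opprK.
by apply: cvg_sum => b; apply: riemann_sum_cvg => //; exact: Nr.
Qed.
End LinearEquation.
End PathSolution.

(** * Algebra of the state space model *)

Section StateSpaceAlgebra.

Definition solvent_block (K : fieldType) (d p : nat) (S : 'M[K]_d) : 'M[K]_(\sum_(i < p) d, d) :=
  \mxcol_(i < p) (S ^+ i).

(** Left multiplication by the companion matrix shifts the powers of [S]; in the last
    block row the solvent equation produces [S^p]. *)
Lemma companion_solvent_block (K : fieldType) (d p : nat) (A : nat -> 'M[K]_d) (S : 'M[K]_d) :
  right_solvent p A S -> Astar p A *m solvent_block p S = solvent_block p S *m S.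
Proof.
move=> solv; rewrite /Astar /solvent_block mul_mxblock_mxrow mxcol_mul.
apply: eq_mxcol => i.
have SM k : S ^+ k *m S = S ^+ k.+1 by rewrite exprSr.
have [ip|ip] := eqVneq i.+1 p.
  rewrite SM ip; move/eqP: solv; rewrite addr_eq0 => /eqP ->.
  rewrite -sumrN big_add1 /= big_mkord.
  rewrite (reindex_inj rev_ord_inj) /=; apply: eq_bigr => j _.
  rewrite mulNmx; congr (- (A _ *m S ^+ _)); have := ltn_ord j; lia.
have ip' : (i.+1 < p)%N by rewrite ltn_neqAle ip ltn_ord.
rewrite (bigD1 (Ordinal ip'))//= eqxx mul1mx SM big1 ?addr0// => j jp.
have -> : (j == i.+1 :> nat) = false.
  by apply/negbTE; apply: contraNneq jp => ji; apply/eqP/val_inj.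
by rewrite mul0mx.
Qed.

Lemma block_vandermonde_mul (K : fieldType) (d m p : nat) (S : 'I_p -> 'M[K]_d)
    (Y : 'I_p -> 'M[K]_(d, m)) :
  block_vandermonde S *m (\mxcol_(k < p) Y k) = \sum_k solvent_block p (S k) *m Y k.
Proof. by rewrite /block_vandermonde mxblockEh mul_mxrow_mxcol. Qed.

Lemma output_solvent_block (K : fieldType) (d p : nat) (S : 'M[K]_d) : (0 < p)%N ->
  Cstar K d p *m solvent_block p S = 1%:M.
Proof.
move=> p0; rewrite /Cstar /solvent_block mul_mxrow_mxcol (bigD1 (Ordinal p0))//=.
rewrite expr0 mulmx1 big1 ?addr0// => j j0.
have -> : (j == 0 :> nat) = false.
  by apply/negbTE; apply: contraNneq j0 => j0; apply/eqP/val_inj.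
by rewrite mul0mx.
Qed.

Variable R : realType.

Lemma mxC_sum (a b : nat) (I : Type) (s : seq I) (P : pred I) (F : I -> 'M[R]_(a, b)) :
  mxC (\sum_(i <- s | P i) F i) = \sum_(i <- s | P i) mxC (F i).
Proof. exact: raddf_sum. Qed.

Lemma mxCD (a b : nat) (M N : 'M[R]_(a, b)) : mxC (M + N) = mxC M + mxC N.
Proof. exact: map_mxD. Qed.

Lemma mxC_Astar (d p : nat) (A : nat -> 'M[R]_d) :
  mxC (Astar p A) = Astar p (fun j => mxC (A j)).
Proof.
apply/matrixP => i j; rewrite !mxE; case: ifP => _; first by rewrite !mxE rmorphN.
by case: ifP => _; rewrite !mxE ?rmorph_nat// rmorph0.
Qed.

Lemma mxC_Cstar (d p : nat) : mxC (Cstar R d p) = Cstar R[i] d p.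
Proof.
by apply/matrixP => i j; rewrite !mxE; case: ifP => _; rewrite !mxE ?rmorph_nat// rmorph0.
Qed.

Lemma mxC_beta (d m p q : nat) (A : nat -> 'M[R]_d) (B : nat -> 'M[R]_(d, m)) n :
  mxC (beta p q A B n) = beta p q (fun j => mxC (A j)) (fun j => mxC (B j)) n.
Proof.
suff recE f k : mxC (beta_rec p q A B f k) =
    beta_rec p q (fun j => mxC (A j)) (fun j => mxC (B j)) f k by exact: recE.
elim: f k => [|f IH] k /=; first exact: map_mx0.
case: ifP => _; first exact: map_mx0.
rewrite mxCD; congr (_ + _); rewrite -[mxC (- _)]/(map_mx _ _) map_mxN; congr (- _).
rewrite -/(mxC _) mxC_sum; apply: eq_bigr => i _.
by rewrite mxCM IH.
Qed.

Lemma mxC_Bstar (d m p q : nat) (A : nat -> 'M[R]_d) (B : nat -> 'M[R]_(d, m)) :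
  mxC (Bstar p q A B) =
  \mxcol_(i < p) beta p q (fun j => mxC (A j)) (fun j => mxC (B j)) i.+1.
Proof.
by apply/matrixP => i j; rewrite mxE [RHS]mxE -mxC_beta !mxE.
Qed.
End StateSpaceAlgebra.

(** * Limits in probability *)

Section LimitInProbability.
Context (dO : measure_display) (Omega : measurableType dO) (R : realType)
  (P : probability Omega R).
Local Notation C := R[i].
Local Notation Re := complex.Re.
Local Notation Im := complex.Im.
Local Notation normc := Normc.normc.

Definition cmeasurable (f : Omega -> C) : Prop :=
  measurable_fun [set: Omega] (fun w => Re (f w)) /\
  measurable_fun [set: Omega] (fun w => Im (f w)).

Lemma cmeasurable_cst (z : C) : cmeasurable (fun=> z).
Proof. by split; exact: measurable_cst. Qed.

Lemma cmeasurableD f g : cmeasurable f -> cmeasurable g -> cmeasurable (fun w => f w + g w).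
Proof.
move=> [fr fi] [gr gi]; split.
  under eq_fun do rewrite ReD; exact: measurable_funD.
by under eq_fun do rewrite ImD; exact: measurable_funD.
Qed.

Lemma cmeasurableM f g : cmeasurable f -> cmeasurable g -> cmeasurable (fun w => f w * g w).
Proof.
move=> [fr fi] [gr gi]; split.
  under eq_fun do rewrite ReM.
  by apply: measurable_funB; exact: measurable_funM.
under eq_fun do rewrite ImM.
by apply: measurable_funD; exact: measurable_funM.
Qed.

Lemma cmeasurable_sum (I : Type) (s : seq I) (f : I -> Omega -> C) :
  (forall i, cmeasurable (f i)) -> cmeasurable (fun w => \sum_(i <- s) f i w).
Proof.
move=> fm; elim: s => [|i s IH].
  by under eq_fun do rewrite big_nil; exact: cmeasurable_cst.
by under eq_fun do rewrite big_cons; exact: cmeasurableD.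
Qed.

Lemma measurable_norm_ge (f g : Omega -> C) (e : R) : cmeasurable f -> cmeasurable g -> 0 <= e ->
  measurable [set w | (e%:C <= `|f w - g w|)%R].
Proof.
move=> fm gm e0.
have [hr hi] : cmeasurable (fun w => f w + -1 * g w).
  by apply: cmeasurableD => //; apply: cmeasurableM => //; exact: cmeasurable_cst.
have m2 : measurable_fun [set: Omega]
    (fun w => Re (f w + -1 * g w) ^+ 2 + Im (f w + -1 * g w) ^+ 2).
  by apply: measurable_funD; exact: measurable_funX.
have := m2 measurableT _ (measurable_itv `[e ^+ 2, +oo[); rewrite setTI.
congr measurable; apply/seteqP; split => w /=;
  rewrite in_itv /= andbT mulN1r -normc_sqr -[`|_|]/((normc _)%:C) lecR;
  by rewrite ler_pXn2r// nnegrE normc_ge0.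
Qed.

Definition cvg_in_probability (Z : nat -> Omega -> C) (I : Omega -> C) : Prop :=
  forall eps eta : R, 0 < eps -> 0 < eta ->
    exists n0 : nat, forall n, (n0 <= n)%N ->
      (P [set w | (eps%:C <= `|Z n w - I w|)%R] <= eta%:E)%E.

Lemma norm_sum_bound (K : finType) (c z : K -> C) (e : R) : 0 <= e ->
  (forall k, normc (z k) <= e) -> normc (\sum_k c k * z k) <= (\sum_k normc (c k)) * e.
Proof.
move=> e0 ze; rewrite mulr_suml.
apply: (@big_rec2 _ _ (fun x (y : R) => normc x <= y)) => [|k y x _ IH].
  by rewrite Normc.normc0.
apply: le_trans (le_normcD _ _) _; apply: lerD => //.
by rewrite Normc.normcM ler_wpM2l ?normc_ge0.
Qed.

(** Each intersection is contained in sets of arbitrarily small probability. *)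
Lemma negligible_liminf (E : nat -> set Omega) :
  (forall n, measurable (E n)) ->
  (forall eta : R, 0 < eta -> exists n0 : nat, forall n, (n0 <= n)%N -> (P (E n) <= eta%:E)%E) ->
  P.-negligible (\bigcup_m \bigcap_(n in [set n | (m <= n)%N]) E n).
Proof.
move=> mE small; apply: negligible_bigcup => m.
have mI : measurable (\bigcap_(n in [set n | (m <= n)%N]) E n).
  by apply: bigcap_measurable => //; exists m => /=.
exists (\bigcap_(n in [set n | (m <= n)%N]) E n); split => //.
apply/eqP; rewrite eq_le measure_ge0 andbT.
apply/lee_addgt0Pr => eta eta0; rewrite add0e.
have [n0 n0P] := small _ eta0.
apply: le_trans (n0P (maxn m n0) (leq_maxr _ _)).
apply: le_measure; rewrite ?inE//.
by apply: bigcap_inf => /=; exact: leq_maxl.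
Qed.

(** Outside [bad e n] the combination of the [I k] is within a multiple of [e] of the
    combination of the [Z k n]. Almost every point lies outside [bad e n] for
    infinitely many [n], and along these the second combination tends to [J].
    The [Z k n] themselves need not converge pointwise, only their combination. *)
Lemma limit_in_probability_ae (K : finType) (c : K -> C) (Z : K -> nat -> Omega -> C)
    (I : K -> Omega -> C) (J : Omega -> C) (G : set Omega) :
  (forall k n, cmeasurable (Z k n)) -> (forall k, cmeasurable (I k)) ->
  (forall k, cvg_in_probability (Z k) (I k)) ->
  {ae P, forall w, G w} ->
  (forall w, G w -> Re (\sum_k c k * Z k n w) @[n --> \oo] --> Re (J w) /\
                    Im (\sum_k c k * Z k n w) @[n --> \oo] --> Im (J w)) ->
  {ae P, forall w, \sum_k c k * I k w = J w}.
Proof.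
move=> mZ mI ZI aeG ZJ.
pose c1 := \sum_k normc (c k).
have c10 : 0 <= c1 by rewrite sumr_ge0// => k _; exact: normc_ge0.
pose bad (e : R) n := \bigcup_(k in [set: K]) [set w | (e%:C <= `|Z k n w - I k w|)%R].
have mbad e n : 0 < e -> measurable (bad e n).
  move=> e0; apply: fin_bigcup_measurable; first exact: finite_finset.
  by move=> k _; apply: measurable_norm_ge => //; exact: ltW.
have badE e n w : ~ bad e n w -> forall k, normc (I k w - Z k n w) <= e.
  move=> nb k; rewrite leNgt; apply/negP => lt; apply: nb; exists k => //=.
  by rewrite -[`|_|]/((normc _)%:C) lecR -normcN opprB ltW.
have bad_small e : 0 < e -> forall eta : R, 0 < eta ->
    exists n0 : nat, forall n, (n0 <= n)%N -> (P (bad e n) <= eta%:E)%E.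
  move=> e0 eta eta0.
  pose eta' := eta / #|K|.+1%:R.
  have eta'0 : 0 < eta' by rewrite divr_gt0// ltr0n.
  have /choice[n0 n0P] : forall k, exists n0 : nat, forall n, (n0 <= n)%N ->
      (P [set w | (e%:C <= `|Z k n w - I k w|)%R] <= eta'%:E)%E.
    by move=> k; exact: ZI.
  exists (\max_k n0 k) => n nn.
  pose E k := [set w | (e%:C <= `|Z k n w - I k w|)%R].
  have -> : bad e n = \big[setU/set0]_(k <- enum K) E k.
    rewrite -bigcup_seq /bad; congr (\bigcup_(k in _) E k).
    by apply/seteqP; split => // k _ /=; rewrite mem_enum.
  have [_ PE] : measurable (\big[setU/set0]_(k <- enum K) E k) /\
      (P (\big[setU/set0]_(k <- enum K) E k) <= ((size (enum K))%:R * eta')%:E)%E.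
    elim: (enum K) => [|k s [mU PU]]; first by rewrite big_nil mul0r measure0.
    have mE : measurable (E k) by apply: measurable_norm_ge => //; exact: ltW.
    rewrite big_cons; split; first exact: measurableU.
    apply: le_trans (measureU2 P mE mU) _.
    rewrite /= -natr1 mulrDl mul1r addrC EFinD; apply: leeD => //.
    by apply: n0P; apply: leq_trans nn; exact: leq_bigmax.
  apply: le_trans PE _; rewrite lee_fin -cardE /eta' mulrA ler_pdivrMr ?ltr0n//.
  by rewrite mulrC ler_wpM2l ?ler_nat// ltW.
(* Thresholds [1 / (r + 1)] suffice to make the difference vanish. *)
have nz r : P.-negligible (\bigcup_m \bigcap_(n in [set n | (m <= n)%N]) bad r.+1%:R^-1 n).
  have r0 : 0 < r.+1%:R^-1 :> R by rewrite invr_gt0 ltr0n.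
  by apply: negligible_liminf; [move=> n; exact: mbad|exact: bad_small].
have ae_bad : {ae P, forall w r, ~ (\bigcup_m \bigcap_(n in [set n | (m <= n)%N]) bad r.+1%:R^-1 n) w}.
  apply: ae_foralln => r; rewrite /almost_everywhere /=.
  apply: negligibleS (nz r) => w /= /contrapT //.
apply: filterS2 aeG ae_bad => w Gw nbad.
apply/eqP; rewrite -subr_eq0; apply/eqP/Normc.eq0_normc.
set D := _ - J w.
have Dle r : normc D <= (c1 + 2) * r.+1%:R^-1.
  have r0 : 0 < r.+1%:R^-1 :> R by rewrite invr_gt0 ltr0n.
  have [ZR ZI'] := ZJ w Gw.
  have [N1 _ N1P] : \forall n \near \oo, `|Re (J w) - Re (\sum_k c k * Z k n w)| < r.+1%:R^-1.
    by move/cvgrPdist_lt : ZR; exact.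
  have [N2 _ N2P] : \forall n \near \oo, `|Im (J w) - Im (\sum_k c k * Z k n w)| < r.+1%:R^-1.
    by move/cvgrPdist_lt : ZI'; exact.
  have [n [n1 n2 nb]] : exists n, [/\ (N1 <= n)%N, (N2 <= n)%N & ~ bad r.+1%:R^-1 n w].
    apply: contrapT => H; apply: (nbad r); exists (maxn N1 N2) => // n /= Nn.
    apply: contrapT => nb; apply: H; exists n; split => //.
      exact: leq_trans (leq_maxl _ _) Nn.
    exact: leq_trans (leq_maxr _ _) Nn.
  have -> : D = \sum_k c k * (I k w - Z k n w) - (J w - \sum_k c k * Z k n w).
    rewrite /D; under [in RHS]eq_bigr do rewrite mulrBr.
    by rewrite sumrB; ring.
  rewrite (le_trans (le_normcD _ _))// normcN mulrDl lerD//.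
    by apply: norm_sum_bound; [exact: ltW|exact: badE].
  apply: normc_le_ReIm; rewrite ?ReD ?ReN ?ImD ?ImN ltW//; [exact: N1P|exact: N2P].
apply/eqP; rewrite eq_le normc_ge0 andbT leNgt; apply/negP => D0.
have c2 : 0 < c1 + 2 by rewrite ltr_wpDl.
have := archi_boundP (ltW (divr_gt0 c2 D0)); set n := Num.bound _ => nb.
have := Dle n; apply/negP; rewrite -ltNge ltr_pdivrMr ?ltr0n//.
rewrite ltr_pdivrMr// in nb; apply: (lt_trans nb).
by rewrite [ltRHS]mulrC ltr_pM2r// ltr_nat.
Qed.
End LimitInProbability.

(** * The state process *)

Section StateProcess.
Variable R : realType.
Context (dO : measure_display) (Omega : measurableType dO) (P : probability Omega R).
Local Notation C := R[i].
Local Notation Re := complex.Re.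
Local Notation Im := complex.Im.
Variables (d m p q : nat) (A : nat -> 'M[R]_d) (B : nat -> 'M[R]_(d, m)).
Hypothesis q_lt_p : (q < p)%N.
Variable L : R -> Omega -> 'cV[R]_m.
Hypothesis L_random : forall t, 0 <= t -> random_vector (L t).
Variable S : 'I_p -> 'M[C]_d.
Hypothesis solvS : forall k, right_solvent p (fun j => mxC (A j)) (S k).
Variable Res : 'I_p -> 'M[C]_(d, m).
Let V k := solvent_block p (S k).
Let As := Astar p A.
Let Bs := Bstar p q A B.
Hypothesis VRes : \sum_k V k *m Res k = mxC Bs.

Lemma cmeasurable_mulmx (a b : nat) (M : 'M[C]_(a, b)) (Y : Omega -> 'cV[C]_b) :
  (forall j, cmeasurable (fun w => Y w j 0)) -> forall i, cmeasurable (fun w => (M *m Y w) i 0).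
Proof.
move=> mY i; rewrite (_ : (fun w => _) = fun w => \sum_j M i j * Y w j 0).
  by apply: cmeasurable_sum => j; apply: cmeasurableM => //; exact: cmeasurable_cst.
by apply/funext => w; rewrite mxE.
Qed.

Lemma cmeasurable_sum_cV (a : nat) (I : Type) (s : seq I) (Y : I -> Omega -> 'cV[C]_a) :
  (forall k i, cmeasurable (fun w => Y k w i 0)) ->
  forall i, cmeasurable (fun w => (\sum_(k <- s) Y k w) i 0).
Proof.
move=> mY i; rewrite (_ : (fun w => _) = fun w => \sum_(k <- s) Y k w i 0).
  by apply: cmeasurable_sum.
by apply/funext => w; rewrite summxE.
Qed.

Lemma mexp_solvent_block (u : R) k : mexp (u%:C *: mxC As) *m V k = V k *m mexp (u%:C *: S k).
Proof.
apply: mexp_intertwine; rewrite -scalemxAl -scalemxAr; congr (_ *: _).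
by rewrite mxC_Astar companion_solvent_block.
Qed.

(** The sums for the Ornstein-Uhlenbeck processes combine to the sum for the state
    equation, and the latter is real. *)
Lemma solvent_block_riemann (t : R) (s : seq R) w :
  \sum_k V k *m riemann_sum L (fun u => mexp ((t - u)%:C *: S k) *m Res k) s w =
  mxC (\sum_(j < size s) rexp As (t - nth 0 (0 :: s) j) *m Bs *m
        (L (nth 0 s j) w - L (nth 0 (0 :: s) j) w)).
Proof.
rewrite mxC_sum.
transitivity (\sum_k \sum_(j < size s) mexp ((t - nth 0 (0 :: s) j)%:C *: mxC As) *m
    (V k *m Res k) *m mxC (L (nth 0 s j) w - L (nth 0 (0 :: s) j) w)).
  apply: eq_bigr => k _; rewrite /riemann_sum mulmx_sumr; apply: eq_bigr => j _.
  by rewrite !mulmxA -mexp_solvent_block.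
rewrite exchange_big; apply: eq_bigr => j _ /=.
by rewrite -mulmx_suml -mulmx_sumr VRes mexp_real !mxCM.
Qed.

Lemma cmeasurable_riemann (f : R -> 'M[C]_(d, m)) (s : seq R) i :
  (forall j, (j <= size s)%N -> 0 <= nth 0 (0 :: s) j) ->
  cmeasurable (fun w => (riemann_sum L f s w) i 0).
Proof.
move=> s0; rewrite /riemann_sum; apply: cmeasurable_sum_cV => j.
apply: cmeasurable_mulmx => l.
have Lm u : 0 <= u -> measurable_fun [set: Omega] (fun w => L u w l 0).
  by move=> u0; exact: L_random.
have js := ltn_ord j.
split => /=.
  rewrite (_ : (fun w => _) = fun w => L (nth 0 s j) w l 0 - L (nth 0 (0 :: s) j) w l 0).
    apply: measurable_funB; apply: Lm; last by apply: s0; exact: ltnW.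
    exact: (s0 j.+1).
  by apply/funext => w; rewrite !mxE.
rewrite (_ : (fun w => _) = fun=> 0); first exact: measurable_cst.
by apply/funext => w; rewrite !mxE.
Qed.

Variable G : set Omega.
Hypothesis mG : measurable G.
Hypothesis aeG : {ae P, forall w, G w}.
Hypothesis GL : forall w, G w -> cadlag (L ^~ w) /\ L 0 w = 0.

(** The driving process, set to zero for negative times and on the paths outside [G],
    so that all paths are càdlàg and all values measurable. *)
Definition regular_noise (t : R) (w : Omega) : 'cV[R]_m :=
  if 0 <= t then \1_G w *: L t w else 0.
Local Notation N := regular_noise.

Lemma regular_noiseE t w : G w -> 0 <= t -> N t w = L t w.
Proof. by move=> Gw t0; rewrite /N t0 indicE mem_set// scale1r. Qed.

Lemma regular_noise_off w : ~ G w -> N ^~ w = fun=> 0.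
Proof.
move=> Gw; apply/funext => t; rewrite /N indicE memNset// scale0r.
by case: ifP.
Qed.

Lemma regular_noise0 w : N 0 w = 0.
Proof.
have [Gw|Gw] := pselect (G w); first by rewrite regular_noiseE// (GL Gw).2.
by have /(congr1 (fun f => f 0)) := regular_noise_off Gw.
Qed.

Lemma regular_noise_cadlag w : cadlag (N ^~ w).
Proof.
have [Gw|Gw] := pselect (G w); last first.
  rewrite regular_noise_off//; split=> t _; first exact: cvg_cst.
  by apply/cvg_ex; exists 0; exact: cvg_cst.
have [[Lr Ll] _] := GL Gw; split=> t t0.
  rewrite regular_noiseE//; apply: cvg_trans (Lr t t0); apply: near_eq_cvg.
  apply: filterS (nbhs_right_ge t) => x tx.
  by rewrite regular_noiseE// (le_trans t0).
have /cvg_ex[l Ll'] := Ll t t0; apply/cvg_ex; exists l.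
apply: cvg_trans Ll'; apply: near_eq_cvg.
by apply: filterS (nbhs_left_ge t0) => x x0; rewrite regular_noiseE.
Qed.

Lemma regular_noise_measurable t i : measurable_fun [set: Omega] (fun w => N t w i 0).
Proof.
have [t0|t0] := boolP (0 <= t); last first.
  rewrite (_ : (fun w => _) = fun=> 0); first exact: measurable_cst.
  by apply/funext => w; rewrite /N (negPf t0) mxE.
rewrite (_ : (fun w => _) = fun w => \1_G w * L t w i 0).
  apply: measurable_funM; last exact: L_random.
  exact: measurable_indic.
by apply/funext => w; rewrite /N t0 mxE.
Qed.

Variable X0 : Omega -> 'cV[R]_(\sum_(i < p) d).
Hypothesis mX0 : random_vector X0.

Definition state (t : R) (w : Omega) : 'cV[R]_(\sum_(i < p) d) :=
  path_solution As Bs (X0 w) (N ^~ w) t.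

Lemma measurable_real_mulmx (a b : nat) (M : 'M[R]_(a, b)) (Y : Omega -> 'cV[R]_b) :
  (forall j, measurable_fun [set: Omega] (fun w => Y w j 0)) ->
  forall i, measurable_fun [set: Omega] (fun w => (M *m Y w) i 0).
Proof.
move=> mY i; rewrite (_ : (fun w => _) = fun w => \sum_j M i j * Y w j 0).
  apply: measurable_sum => j; apply: measurable_funM => //; exact: measurable_cst.
by apply/funext => w; rewrite mxE.
Qed.

(** As a limit of Riemann sums: measurability in [w] is not visible on the Lebesgue
    integral in [path_solution]. *)
Lemma state_random t : 0 <= t -> random_vector (state t).
Proof.
rewrite le_eqVlt => /predU1P[<-|t0] i.
  under eq_fun do rewrite /state path_solution0 ?regular_noise0//.
  exact: mX0.
apply: (@measurable_fun_cvg _ _ _ _ (fun k w => (rexp As t *m X0 w) i 0 +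
  (\sum_(0 <= j < k.+1) rexp As (t - grid t k j) *m Bs *m (N (grid t k j.+1) w - N (grid t k j) w)) i 0)).
  move=> k; apply: measurable_funD; first exact: measurable_real_mulmx.
  rewrite (_ : (fun w => _) = fun w => \sum_(0 <= j < k.+1)
    (rexp As (t - grid t k j) *m Bs *m (N (grid t k j.+1) w - N (grid t k j) w)) i 0).
    apply: measurable_sum => j; apply: measurable_real_mulmx => l.
    rewrite (_ : (fun w => _) = fun w => N (grid t k j.+1) w l 0 - N (grid t k j) w l 0).
      by apply: measurable_funB; exact: regular_noise_measurable.
    by apply/funext => w; rewrite !mxE.
  by apply/funext => w; rewrite summxE.
move=> w _; have -> : state t w i 0 = (rexp As t *m X0 w) i 0 +
    (state t w - rexp As t *m X0 w) i 0.
  by rewrite [X in _ + X]mxE [X in _ + (_ + X)]mxE addrC subrK.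
apply: cvgD; first exact: cvg_cst.
apply: path_solution_riemann => //; [exact: regular_noise_cadlag|exact: regular_noise0].
Qed.

Lemma state_solves : solves_sde P L As Bs state.
Proof.
split; first exact: state_random.
apply: filterS aeG => w Gw; split.
  by apply: path_solution_cadlag; [exact: regular_noise_cadlag].
move=> t t0; rewrite {1}/state path_solution_integral//; last exact: regular_noise_cadlag.
have -> : state 0 w = X0 w by rewrite /state path_solution0// regular_noise0.
by rewrite (GL Gw).2 subr0 regular_noiseE.
Qed.

Variable Yk : 'I_p -> R -> Omega -> 'cV[C]_d.
Hypothesis OU : forall k, is_OU_process P L (S k) (Res k) (Yk k).
Hypothesis init : {ae P, forall w, \sum_k V k *m Yk k 0 w = mxC (X0 w)}.

(** Along uniform grids the Riemann sums for the single processes converge in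
    probability by assumption, and their combination converges for every path in [G]. *)
Lemma stochastic_integrals_combine (t : R) (I : 'I_p -> Omega -> 'cV[C]_d) : 0 < t ->
  (forall k, is_stochastic_integral P L (fun u => mexp ((t - u)%:C *: S k) *m Res k) t (I k)) ->
  {ae P, forall w, \sum_k V k *m I k w = mxC (state t w - rexp As t *m X0 w)}.
Proof.
move=> t0 hI.
pose RS k n w := riemann_sum L (fun u => mexp ((t - u)%:C *: S k) *m Res k) (grid_seq t n) w.
have entry i : {ae P, forall w,
    \sum_(x : 'I_p * 'I_d) V x.1 i x.2 * I x.1 w x.2 0 =
    mxC (state t w - rexp As t *m X0 w) i 0}.
  apply: (@limit_in_probability_ae _ _ _ _ _ _ (fun x n w => RS x.1 n w x.2 0) _ _ G) => //.
  - move=> [k l] n /=; apply: cmeasurable_riemann => j; rewrite size_grid_seq => jn.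
    by rewrite nth_grid// -(grid0 t n) grid_le.
  - by move=> [k l] /=; have [mI _] := hI k; exact: mI.
  - move=> [k l] eps eta eps0 eta0 /=; have [_ cI] := hI k.
    have [delta delta0 cI'] := cI _ _ eps0 eta0.
    exists (Num.bound (t / delta)) => n nn.
    have := cI' (grid_seq t n) (grid_partition n t0).
    rewrite size_grid_seq => /(_ _ l); rewrite -/(RS k n).
    have mesh : forall j, (j < n.+1)%N ->
        nth 0 (grid_seq t n) j - nth 0 (0 :: grid_seq t n) j < delta.
      move=> j jn; rewrite nth_grid 1?ltnW// nth_mkseq// gridS.
      rewrite ltr_pdivrMr ?ltr0n// mulrC -ltr_pdivrMr//.
      apply: (lt_le_trans (archi_boundP _)); first by rewrite divr_ge0 ?ltW.
      by rewrite ler_nat ltnW.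
    move=> /(_ mesh); under eq_set do rewrite mxE [X in _ + X]mxE.
    by [].
  - move=> w Gw.
    have E n : \sum_(x : 'I_p * 'I_d) V x.1 i x.2 * RS x.1 n w x.2 0 =
       ((\sum_(0 <= j < n.+1) rexp As (t - grid t n j) *m Bs *m
           (N (grid t n j.+1) w - N (grid t n j) w)) i 0)%:C.
      rewrite -(pair_bigA _ (fun k l => V k i l * RS k n w l 0)) /=.
      transitivity ((\sum_k V k *m RS k n w) i 0).
        by rewrite summxE; apply: eq_bigr => k _; rewrite mxE.
      rewrite solvent_block_riemann mxE; congr (fun_of_matrix _ _ _)%:C.
      rewrite size_grid_seq big_mkord; apply: eq_bigr => j _.
      rewrite nth_grid 1?ltnW// nth_mkseq//.
      by rewrite !regular_noiseE// -(grid0 t n) grid_le.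
    split.
      rewrite (_ : (fun n => _) = fun n => (\sum_(0 <= j < n.+1) rexp As (t - grid t n j) *m Bs *m
           (N (grid t n j.+1) w - N (grid t n j) w)) i 0); last first.
        by apply/funext => n; rewrite E.
      rewrite mxE /=.
      apply: path_solution_riemann => //; [exact: regular_noise_cadlag|exact: regular_noise0].
    rewrite (_ : (fun n => _) = fun=> 0); last by apply/funext => n; rewrite E.
    by rewrite mxE /=; exact: cvg_cst.
have : {ae P, forall w, forall i, \sum_(x : 'I_p * 'I_d) V x.1 i x.2 * I x.1 w x.2 0 =
    mxC (state t w - rexp As t *m X0 w) i 0} by apply: filter_forall => i; exact: entry.
apply: filterS => w Ew.
apply/matrixP => i j; rewrite (ord1 j) -(Ew i).
rewrite -(pair_bigA _ (fun k l => V k i l * I k w l 0)) /= summxE.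
by apply: eq_bigr => k _; rewrite mxE.
Qed.

Lemma state_sum t : 0 <= t -> {ae P, forall w, \sum_k V k *m Yk k t w = mxC (state t w)}.
Proof.
rewrite le_eqVlt => /predU1P[<-|t0].
  by apply: filterS init => w ->; rewrite /state path_solution0 ?regular_noise0.
have /choice[I hI] : forall k, exists I : Omega -> 'cV[C]_d,
    is_stochastic_integral P L (fun u => mexp ((t - u)%:C *: S k) *m Res k) t I /\
    {ae P, forall w, Yk k t w = mexp (t%:C *: S k) *m Yk k 0 w + I w}.
  by move=> k; have [_ [I I1 I2]] := OU k (ltW t0); exists I.
have ae1 := stochastic_integrals_combine t0 (fun k => (hI k).1).
have ae2 : {ae P, forall w, forall k, Yk k t w = mexp (t%:C *: S k) *m Yk k 0 w + I k w}.
  by apply: filter_forall => k; exact: (hI k).2.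
apply: filterS3 init ae1 ae2 => w w0 w1 w2.
transitivity (\sum_k (mexp (t%:C *: mxC As) *m (V k *m Yk k 0 w) + V k *m I k w)).
  by apply: eq_bigr => k _; rewrite w2 mulmxDr !mulmxA -mexp_solvent_block.
rewrite big_split /= w1 -mulmx_sumr w0 mexp_real -mxCM -mxCD.
by rewrite addrC subrK.
Qed.
End StateProcess.

(** * The superposition of Ornstein-Uhlenbeck processes *)

Theorem theorem3p1 (R : realType) (dO : measure_display)
    (Omega : measurableType dO) (P : probability Omega R)
    (d m p q : nat) (d_gt0 : (0 < d)%N) (m_gt0 : (0 < m)%N)
    (q_gt0 : (0 < q)%N) (q_lt_p : (q < p)%N)
    (L : R -> Omega -> 'cV[R]_m) (levyL : levy_process P L)
    (A : nat -> 'M[R]_d) (B : nat -> 'M[R]_(d, m))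
    (irrF : left_coprime (monic_mxpoly p A) (mxpoly_of q B))
    (S : 'I_p -> 'M[R[i]]_d)
    (regS : forall k, regular_right_solvent p (fun j => mxC (A j)) (S k))
    (complS : complete_solvents (fun j => mxC (A j)) S)
    (Res : 'I_p -> 'M[R[i]]_(d, m))
    (resS : forall k, is_residue (monic_mxpoly p (fun j => mxC (A j)))
                                 (mxpoly_of q (fun j => mxC (B j)))
                                 (S k) (Res k))
    (Yk : 'I_p -> R -> Omega -> 'cV[R[i]]_d)
    (OU_Yk : forall k, is_OU_process P L (S k) (Res k) (Yk k))
    (initY : {ae P, forall w, exists v : 'cV[R]_(\sum_(i < p) d),
       block_vandermonde S *m (\mxcol_(k < p) Yk k 0 w) = mxC v}) :
  exists2 Y : R -> Omega -> 'cV[R]_d,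
    (forall t : R, 0 <= t -> {ae P, forall w, \sum_k Yk k t w = mxC (Y t w)}) &
    is_MCARMA P p q L A B Y.
Proof.
pose V k := solvent_block p (S k).
have solvS k : right_solvent p (fun j => mxC (A j)) (S k) by case: (regS k).
have VRes : \sum_k V k *m Res k = mxC (Bstar p q A B).
  transitivity (\sum_k \mxcol_(i < p) (S k ^+ i *m Res k)).
    by apply: eq_bigr => k _; exact: mxcol_mul.
  rewrite -mxcol_sum mxC_Bstar; apply: eq_mxcol => i.
  exact: (solvent_residue_sum q_lt_p regS complS resS (ltn_ord i)).
have [L_random L0 _ _ Lcadlag] := levyL.
(* The exceptional paths lie in a measurable null set [bad], which makes the indicator
   of its complement measurable. *)
have [bad [mbad Pbad badE]] : {ae P, forall w, cadlag (L ^~ w) /\ L 0 w = 0}.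
  exact: filterS2 Lcadlag L0.
pose G := ~` bad.
have mG : measurable G by exact: measurableC.
have aeG : {ae P, forall w, G w} by exists bad; split => // w /contrapT.
have GL w : G w -> cadlag (L ^~ w) /\ L 0 w = 0.
  by move=> Gw; apply: contrapT => nw; apply: Gw; exact: badE.
pose X0 w : 'cV[R]_(\sum_(i < p) d) :=
  \col_i complex.Re ((\sum_k V k *m Yk k 0 w) i 0).
have mX0 : random_vector X0.
  move=> i; rewrite (_ : (fun w => _) = fun w => complex.Re ((\sum_k V k *m Yk k 0 w) i 0)).
    have cm : cmeasurable (fun w => (\sum_k V k *m Yk k 0 w) i 0).
      apply: cmeasurable_sum_cV => k; apply: cmeasurable_mulmx => j.
      by have [m0 _] := OU_Yk k 0 (lexx 0); exact: m0.
    by case: cm.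
  by apply/funext => w; rewrite mxE.
have init : {ae P, forall w, \sum_k V k *m Yk k 0 w = mxC (X0 w)}.
  apply: filterS initY => w [v]; rewrite block_vandermonde_mul => vE.
  by rewrite vE; congr mxC; apply/matrixP => i j; rewrite (ord1 j) mxE vE mxE.
pose X := state q A B L G X0.
exists (fun t w => Cstar R d p *m X t w).
  move=> t t0.
  apply: filterS (state_sum L_random solvS VRes aeG GL OU_Yk init t0) => w Xw.
  rewrite mxCM -Xw mxC_Cstar mulmx_sumr; apply: eq_bigr => k _.
  by rewrite mulmxA output_solvent_block ?mul1mx// (leq_ltn_trans _ q_lt_p).
exists X; first exact: (state_solves q A B L_random mG aeG GL mX0).
by move=> t _; apply: aeW.
Qed.
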